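(* Let $\mathfrak D$ be the cluster scattering diagram in $M^\circ_{\mathbb R}$ of a cluster variety of type $\mathcal A$ for which $p_1^*$ is injective. Let $(\gamma^{(1)},\gamma^{(2)})$ be a pair of broken lines balanced at $x_0\in M^\circ$ and let $(a,b)$ be a pair of positive integers. Then there exists a broken line segment $\tilde\gamma:[0,T]\to M^\circ_{\mathbb R}$ such that $\tilde\gamma(0)=\frac{I(\gamma^{(1)})}{a}$, $\tilde\gamma(T)=\frac{I(\gamma^{(2)})}{b}$, and $\tilde\gamma\left(\frac{b}{a+b}T\right)=\frac{x_0}{a+b}$.
   Context: **Fixed data.** A finite set $I$ with a subset $I_{\mathrm{uf}}$; a lattice $N$ of rank $|I|$; a saturated sublattice $N_{\mathrm{uf}}\subseteq N$ of rank $|I_{\mathrm{uf}}|$; a skew-symmetric bilinear form $\{\cdot,\cdot\}:N\times N\to\mathbb Q$; a finite index sublattice $N^\circ\subseteq N$ with $\{N_{\mathrm{uf}},N^\circ\}\subset\mathbb Z$, $\{N,N_{\mathrm{uf}}\cap N^\circ\}\subset\mathbb Z$; positive integers $(d_i)_{i\in I}$ with gcd $1$; $M^\circ=\mathrm{Hom}(N^\circ,\mathbb Z)$, $M^\circ_{\mathbb R}=M^\circ\otimes\mathbb R$. A seed: a basis $(e_i)_{i\in I}$ of $N$ with $(e_i)_{i\in I_{\mathrm{uf}}}$ a basis of $N_{\mathrm{uf}}$ and $(d_ie_i)$ a basis of $N^\circ$. $p_1^*:N_{\mathrm{uf}}\to M^\circ$, $n\mapsto\{n,\cdot\}$, is assumed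 injective. $N^+=\{\sum_{i\in I_{\mathrm{uf}}}a_ie_i:a_i\in\mathbb Z_{\ge0},\sum a_i>0\}$. $P$ is the monoid of integral points of a full dimensional strictly convex rational polyhedral cone in $M^\circ_{\mathbb R}$ containing all $p_1^*(e_i)$, $i\in I_{\mathrm{uf}}$; $J=P\setminus\{0\}$; $\widehat{\mathbb C[P]}$ is the $J$-adic completion. **Scattering diagram.** A wall is a pair $(\mathfrak d,f_{\mathfrak d})$ with $\mathfrak d\subseteq n^\perp\subset M^\circ_{\mathbb R}$ a convex rational polyhedral cone of codimension one, $n\in N^+$, $f_{\mathfrak d}=1+\sum_{k\ge1}c_kz^{kp_1^*(n)}\in\widehat{\mathbb C[P]}$; incoming if $p_1^*(n)\in\mathfrak d$, otherwise outgoing. A scattering diagram is a collection of walls with finitely many $f_{\mathfrak d}\not\equiv1$ mod $J^k$ for each $k$. $\mathrm{Supp}(\mathfrak D)=\bigcup\mathfrak d$; $\mathrm{Sing}(\mathfrak D)$ is the union of all $\partial\mathfrak d$ and all codimension two intersections $\mathfrak d_1\cap\mathfrak d_2$. Crossing walls by a path $\gamma$ at time $t$ acts by $z^m\mapsto z^mf_{\mathfrak d}^{\epsilon\langle n_0',m\rangle}$, $n_0'$ the generator of $\mathbb R_{\ge0}n\cap N^\circ$, $\epsilon=-\mathrm{sgn}\langle n,\gamma'(t)\rangle$; $\mathfrak D$ is consistent if path ordered products of these depend only on endpoints of paths. The cluster scattering diagram is the consistent diagram, unique up to equivalence (equality of path ordered products), consisting of the walls $(e_i^\perp,1+z^{p_1^*(e_i)})$,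 $i\in I_{\mathrm{uf}}$, and otherwise only outgoing walls, with representative chosen so that all $f_{\mathfrak d}=(1+z^{p_1^*(n)})^c$, $n\in N^+$, $c\in\mathbb Z_{>0}$. **Broken lines.** A generic broken line with initial exponent $\mathfrak m\in M^\circ\setminus\{0\}$ and endpoint $x_0\notin\mathrm{Supp}(\mathfrak D)$ is a continuous proper piecewise linear path $\gamma:(-\infty,0]\to M^\circ_{\mathbb R}\setminus\mathrm{Sing}(\mathfrak D)$, $\gamma(0)=x_0$, bending only at walls, with finitely many domains of linearity $L$, each with a monomial $c_Lz^{\mathfrak m_L}$, such that: the unbounded domain carries $z^{\mathfrak m}$; $\gamma'=-\mathfrak m_L$ on $L$; if $\gamma$ bends from $L$ to $L'$ at time $t$, then $c_{L'}z^{\mathfrak m_{L'}}$ is a term of the image of $c_Lz^{\mathfrak m_L}$ under the crossing automorphism of all walls containing $\gamma(t)$. $I(\gamma)=\mathfrak m$, and $F(\gamma)$ is the exponent of the last domain of linearity (the one ending at $x_0$). A non-generic broken line is a piecewise linear ray $\gamma:(-\infty,0]\to M^\circ_{\mathbb R}$ with $\gamma(0)\in\mathrm{Supp}(\mathfrak D)$ or image meeting $\mathrm{Sing}(\mathfrak D)$, together with a sequence of generic broken lines $(\gamma_k)$ converging pointwise to $\gamma$, all with the same initial exponent, bending at the same walls in the same order and with the same decorating monomials. Its domains of linearity are the limits of those of the $\gamma_k$ (possibly degenerate to points, still recorded with their monomials); $I(\gamma)$ and $F(\gamma)$ are those of the $\gamma_k$. A broken line is a generic or non-generic one; a generic one may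 also be viewed with a constant defining sequence. **Broken line segments.** A segment of a broken line is its restriction to a closed interval $[t_0,t_1]\subset(-\infty,0]$ (possibly $t_0=t_1$), usually reparametrized by translation as a map $[0,t_1-t_0]\to M^\circ_{\mathbb R}$; its endpoints are the images of the interval's ends. **Balanced pairs.** A pair of generic broken lines is based if the two have the same endpoint. A pair $(\gamma^{(1)},\gamma^{(2)})$ of broken lines is based if every pair $(\gamma_k^{(1)},\gamma_k^{(2)})$ of the defining sequences is based. It is balanced at $x_0$ if it is based, $\gamma^{(1)}(0)=\gamma^{(2)}(0)=x_0$ and $F(\gamma^{(1)})+F(\gamma^{(2)})=x_0$. *)

(* Defs.v *)
From HB Require Import structures.
From mathcomp Require Import all_boot all_order all_algebra.
From mathcomp Require Import finmap complex.
From mathcomp Require Import all_classical all_reals all_analysis.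

Set Implicit Arguments.
Unset Strict Implicit.
Unset Printing Implicit Defensive.

Import Order.TTheory GRing.Theory Num.Theory.
Import numFieldNormedType.Exports.

Local Open Scope classical_set_scope.
Local Open Scope ring_scope.

(* A lattice of rank #|I| is Z^#|I|; no basis of it is distinguished, the seeds
   below are arbitrary bases. *)
Notation lattice I := 'rV[int]_#|I|.

Definition lattice_basis (I : finType) (J : {set I}) (e : I -> lattice I)
    (L : {pred lattice I}) : Prop :=
  [/\ forall i, i \in J -> e i \in L,
      forall n, n \in L ->
        exists a : I -> int, n = \sum_(i in J) e i *~ a i
    & forall a : I -> int, \sum_(i in J) e i *~ a i = 0 ->
        forall i, i \in J -> a i = 0].

Definition bilin (I : finType) (B : 'M[rat]_#|I|) (n n' : lattice I) : rat :=
  (map_mx intr n *m B *m (map_mx intr n')^T) 0 0.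

Record fixed_data (I : finType) := FixedData {
  uf : {set I};
  form : 'M[rat]_#|I|;
  Nuf : {pred lattice I};
  No : {pred lattice I};
  dmul : I -> nat;
  form_skew : form^T = - form;
  Nuf_zmod : zmod_closed Nuf;
  Nuf_saturated : forall (k : int) (n : lattice I),
    k != 0 -> n *~ k \in Nuf -> n \in Nuf;
  Nuf_rank : exists b : I -> lattice I, lattice_basis uf b Nuf;
  No_zmod : zmod_closed No;
  No_index : exists s : seq (lattice I), forall n, exists2 r, r \in s & n - r \in No;
  form_uf_No : forall n n', n \in Nuf -> n' \in No ->
    bilin form n n' \is a Num.int;
  form_N_ufNo : forall n n', n' \in Nuf -> n' \in No ->
    bilin form n n' \is a Num.int;
  dmul_gt0 : forall i, (0 < dmul i)%N;
  dmul_gcd : \big[gcdn/0%N]_i dmul i = 1%N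
}.

Record seed (I : finType) (F : fixed_data I) := Seed {
  evec :> I -> lattice I;
  evec_N : lattice_basis [set: I]%SET evec predT;
  evec_Nuf : lattice_basis (uf F) evec (Nuf F);
  evec_No : lattice_basis [set: I]%SET (fun i => evec i *+ dmul F i) (No F)
}.

(* [N°] has finite index in [N], so [M°_R = Hom(N°, R) = Hom(N, R)]; an element
   is given by its values on the standard basis of [N = Z^#|I|], and [M°]
   consists of the elements taking integer values on [N°]. *)
Notation dual_space R I := 'rV[R]_#|I|.

Section Space.
Variables (R : realType) (I : finType).
Local Notation N := (lattice I).
Local Notation M := (dual_space R I).

Definition pairing (n : N) (x : M) : R := \sum_j (n 0 j)%:~R * x 0 j.

Definition perp (n : N) : set M := [set x | pairing n x = 0].

Definition is_span (A : set M) (V : {vspace M}) : Prop :=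
  (forall x, A x -> x \in V) /\
  (forall U : {vspace M}, (forall x, A x -> x \in U) -> (V <= U)%VS).

(* The dimension of a convex cone is that of its linear span. *)
Definition codim (k : nat) (A : set M) : Prop :=
  exists2 V : {vspace M}, is_span A V & (\dim V + k)%N = #|I|.

Definition rational_polyhedral_cone (A : set M) : Prop :=
  exists ns : seq N, A = [set x | forall n, n \in ns -> 0 <= pairing n x].

Definition strictly_convex (A : set M) : Prop :=
  forall x, A x -> A (- x) -> x = 0.

Variable F : fixed_data I.

Definition Mo : set M := [set x | forall n, n \in No F -> pairing n x \is a Num.int].

Definition p1 (n : N) : M := map_mx ratr (map_mx intr n *m form F).

Definition p1_injective : Prop :=
  forall n n', n \in Nuf F -> n' \in Nuf F -> p1 n = p1 n' -> n = n'.

Definition Nplus (e : seed F) : set N :=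
  [set n | exists2 a : I -> nat,
     n = \sum_(i in uf F) e i *+ a i & (0 < \sum_(i in uf F) a i)%N].

Definition on_ray (n n' : N) : Prop :=
  exists2 r : R, 0 <= r & map_mx intr n' = r *: map_mx intr n.

(* The generator of the monoid [R_{>=0} n \cap N°], for [n <> 0]. *)
Definition No_generator (n : N) : N :=
  xget 0 [set n0 | [/\ n0 \in No F, on_ray n n0
    & forall n', n' \in No F -> on_ray n n' -> exists k : nat, n' = n0 *+ k]].

End Space.

Section CompletedRing.
Variables (R : realType) (I : finType) (F : fixed_data I).
Variable sigma : set (dual_space R I).
Local Notation M := (dual_space R I).

Definition Pmon : set M := sigma `&` Mo F.

(* Exponents of the monomials in [J^k]. *)
Fixpoint Jpow (k : nat) : set M :=
  if k is k'.+1
  then [set m | exists u v, [/\ Pmon u, u != 0, Jpow k' v & m = u + v]]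
  else Pmon.

(* As [sigma] is strictly convex, [C[P]/J^k] is finite dimensional and the
   completion consists of all formal sums of monomials with exponent in [P]; a
   formal sum is represented by its function of coefficients. *)
Definition formal_series := M -> R[i].

Definition in_completion (f : formal_series) : Prop := forall m, f m != 0 -> Pmon m.

Definition mono (m : M) : formal_series := fun u => (u == m)%:R.

Definition sone : formal_series := mono 0.

(* The continuous linear map with [z^m |-> z^m G(m)]; the sums are finite since
   [sigma] is strictly convex. *)
Definition mono_subst (G : M -> formal_series) (f : formal_series) : formal_series :=
  fun u => \sum_(m \in [set m | Pmon m /\ Pmon (u - m)]) f m * G m (u - m).

Definition smul (f g : formal_series) : formal_series := mono_subst (fun=> g) f.

Definition sinv (f : formal_series) : formal_series :=
  xget sone [set g | in_completion g /\ smul f g = sone].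

Definition spow (f : formal_series) (k : nat) : formal_series := iter k (smul f) sone.

Definition spowz (f : formal_series) (k : int) : formal_series :=
  match k with
  | Posz j => spow f j
  | Negz j => spow (sinv f) j.+1
  end.

Definition eq_modJ (k : nat) (f g : formal_series) : Prop :=
  forall m, Pmon m -> ~ Jpow k m -> f m = g m.

End CompletedRing.

Record wall (R : realType) (I : finType) := Wall {
  wcone : set (dual_space R I);
  wnormal : lattice I;
  wfun : formal_series R I
}.

Section Walls.
Variables (R : realType) (I : finType) (F : fixed_data I) (e : seed F).
Variable sigma : set (dual_space R I).
Local Notation M := (dual_space R I).

Definition is_wall (w : wall R I) : Prop :=
  [/\ Nplus e (wnormal w),
      rational_polyhedral_cone (wcone w) /\ codim 1 (wcone w),
      wcone w `<=` perp (wnormal w),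
      wfun w 0 = 1
    & forall m, wfun w m != 0 -> exists k : nat, m = p1 R F (wnormal w) *+ k].

Definition incoming (w : wall R I) : Prop := wcone w (p1 R F (wnormal w)).

(* The boundary of the cone relative to the hyperplane that it spans. *)
Definition wall_boundary (w : wall R I) : set M :=
  wcone w `\`
  [set x | \forall y \near within (perp (wnormal w)) (nbhs x), wcone w y].

Definition binomial_fun (n : lattice I) : formal_series R I :=
  fun u => mono 0 u + mono (p1 R F n) u.

Definition initial_wall (i : I) : wall R I :=
  Wall (perp (e i)) (e i) (binomial_fun (e i)).

(* [epsilon <n'_0, m>], an integer when [m] is in [M°], for a path crossing the
   wall [w] with velocity [v]. *)
Definition crossing_exponent (w : wall R I) (v m : M) : int :=
  Num.floor (- Num.sg (pairing (wnormal w) v) *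
             pairing (No_generator R F (wnormal w)) m).

Variables (W : choiceType) (D : W -> wall R I).

Definition nontrivial_mod (k : nat) : set W :=
  [set w | ~ eq_modJ F sigma k (wfun (D w)) (@sone R I)].

Definition scattering_diagram : Prop :=
  (forall w, is_wall (D w)) /\ (forall k, finite_set (nontrivial_mod k)).

Definition Supp : set M := \bigcup_w wcone (D w).

Definition Sing : set M :=
  [set x | exists w, wall_boundary (D w) x] `|`
  [set x | exists w1 w2, codim 2 (wcone (D w1) `&` wcone (D w2)) /\
                         (wcone (D w1) `&` wcone (D w2)) x].

Definition walls_at (x : M) : set W := [set w | wcone (D w) x].

(* Crossing all the walls through [x] with velocity [v] sends [z^m] to
   [z^m * crossing_factor_mod k x v m] modulo [J^k]. *)
Definition crossing_factor_mod (k : nat) (x v m : M) : formal_series R I :=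
  \big[smul F sigma/@sone R I]_(w \in walls_at x `&` nontrivial_mod k)
    spowz F sigma (wfun (D w)) (crossing_exponent (D w) v m).

(* [g] is the [J]-adic limit of the previous products. *)
Definition is_crossing_factor (x v m : M) (g : formal_series R I) : Prop :=
  in_completion F sigma g /\
  forall k, eq_modJ F sigma k g (crossing_factor_mod k x v m).

Definition velocity (gamma : R -> M) (t : R) : M :=
  \row_j derive1 (fun s => gamma s 0 j) t.

(* Paths are smooth immersions of [0, 1], given as restrictions of functions
   that are smooth on the whole line. *)
Definition admissible_path (gamma : R -> M) : Prop :=
  [/\ forall j k t, derivable (derive1n k (fun s => gamma s 0 j)) t 1,
      forall t, 0 <= t <= 1 -> velocity gamma t != 0 /\ ~ Sing (gamma t),
      ~ Supp (gamma 0) /\ ~ Supp (gamma 1)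
    & forall t w, 0 <= t <= 1 -> wcone (D w) (gamma t) ->
        pairing (wnormal (D w)) (velocity gamma t) != 0].

(* The finitely many times, in increasing order, at which [gamma] crosses a wall
   that is nontrivial modulo [J^k]. *)
Definition crossing_times (k : nat) (gamma : R -> M) : seq R :=
  sort <=%O (enum_fset (fset_set [set t | 0 <= t <= 1 /\
    exists2 w, nontrivial_mod k w & wcone (D w) (gamma t)])).

(* Path ordered product modulo [J^k]; the first wall crossed acts first. *)
Definition path_ordered_product (k : nat) (gamma : R -> M) (f : formal_series R I) :
    formal_series R I :=
  foldl (fun g t =>
           mono_subst F sigma
             (crossing_factor_mod k (gamma t) (velocity gamma t)) g)
        f (crossing_times k gamma).

Definition consistent : Prop :=
  forall gamma1 gamma2 : R -> M,
    admissible_path gamma1 -> admissible_path gamma2 ->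
    gamma1 0 = gamma2 0 -> gamma1 1 = gamma2 1 ->
    forall k f, in_completion F sigma f ->
      eq_modJ F sigma k (path_ordered_product k gamma1 f)
                        (path_ordered_product k gamma2 f).

Definition cluster_scattering_diagram : Prop :=
  [/\ scattering_diagram,
      consistent,
      forall i, i \in uf F -> exists! w, D w = initial_wall i,
      forall w, (exists2 i, i \in uf F & D w = initial_wall i) \/
                ~ incoming (D w)
    & forall w, exists2 c : nat, (0 < c)%N &
        wfun (D w) = spow F sigma (binomial_fun (wnormal (D w))) c].

End Walls.

Section PiecewiseLinear.
Variables (R : realType) (I : finType).
Local Notation M := (dual_space R I).

(* The [j]-th of the closed intervals into which the sequence [ts] of negative
   numbers cuts ]-oo, 0]; the last one ends at [0] by the default value of
   [nth]. *)
Definition in_domain (ts : seq R) (j : nat) (t : R) : bool :=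
  ((j == 0%N) || (ts`_(j.-1) <= t)) && (t <= ts`_j).

(* On ]-oo, 0], [gamma] is piecewise linear with breaks at the times [ts] and
   successive velocities [vs]. *)
Definition piecewise_linear (ts : seq R) (vs : seq M) (gamma : R -> M) : Prop :=
  [/\ sorted <%R ts, all (fun t => t < 0) ts, size vs = (size ts).+1
    & forall j s t, (j < size vs)%N -> in_domain ts j s -> in_domain ts j t ->
        gamma t = gamma s + (t - s) *: vs`_j].

End PiecewiseLinear.

(* The path is only relevant on ]-oo, 0]; [gmonos] lists the monomials
   [(c_L, m_L)] of the domains of linearity, starting with the unbounded one. *)
Record generic_line (R : realType) (I : finType) := GenericLine {
  gpath :> R -> dual_space R I;
  gtimes : seq R;
  gmonos : seq (R[i] * dual_space R I)
}.

Record broken_line (R : realType) (I : finType) := BrokenLine {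
  bpath :> R -> dual_space R I;
  bapprox : nat -> generic_line R I
}.

Section BrokenLines.
Variables (R : realType) (I : finType) (F : fixed_data I).
Variable sigma : set (dual_space R I).
Variables (W : choiceType) (D : W -> wall R I).
Local Notation M := (dual_space R I).

Definition coef (g : generic_line R I) (j : nat) : R[i] :=
  (nth (0, 0) (gmonos g) j).1.

Definition expo (g : generic_line R I) (j : nat) : M :=
  (nth (0, 0) (gmonos g) j).2.

Definition initial_exponent (g : generic_line R I) : M := expo g 0.

Definition final_exponent (g : generic_line R I) : M :=
  expo g (size (gmonos g)).-1.

Definition is_term_of_crossing (x m : M) (c : R[i]) (m' : M) (c' : R[i]) : Prop :=
  exists g : formal_series R I, [/\ is_crossing_factor F sigma D x (- m) m g,
                c' = c * g (m' - m) & c' != 0].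

Definition is_generic_line (g : generic_line R I) : Prop :=
  [/\ [/\ Mo F (initial_exponent g), initial_exponent g != 0 & coef g 0 = 1],
      [/\ {within [set t | t <= 0], continuous (gpath g)},
          forall K : set M, compact K -> compact [set t | t <= 0 /\ K (g t)],
          forall t, t <= 0 -> ~ Sing D (g t)
        & ~ Supp D (g 0)],
      piecewise_linear (gtimes g) [seq - m.2 | m <- gmonos g] g
    & forall j, (j < size (gtimes g))%N ->
        [/\ Supp D (g (gtimes g)`_j), expo g j != expo g j.+1
          & is_term_of_crossing (g (gtimes g)`_j)
              (expo g j) (coef g j) (expo g j.+1) (coef g j.+1)]].

Definition bends_at (g : generic_line R I) (j : nat) (w : W) : Prop :=
  wcone (D w) (g (gtimes g)`_j).

Definition is_nongeneric_line (b : broken_line R I) : Prop :=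
  [/\ Supp D (b 0) \/ (exists2 t, t <= 0 & Sing D (b t)),
      exists ts vs, piecewise_linear ts vs b,
      forall k, is_generic_line (bapprox b k) /\ gmonos (bapprox b k) = gmonos (bapprox b 0%N),
      forall j, (j < size (gtimes (bapprox b 0%N)))%N ->
        exists w, forall k, bends_at (bapprox b k) j w
    & forall t, t <= 0 -> (fun k => bapprox b k t) @ \oo --> b t].

Definition is_broken_line (b : broken_line R I) : Prop :=
  (exists g, [/\ is_generic_line g, forall t, t <= 0 -> b t = g t
               & forall k, bapprox b k = g])
  \/ is_nongeneric_line b.

(* [I(gamma)] and [F(gamma)]; all terms of the defining sequence of a broken
   line carry the same monomials. *)
Definition Iexp (b : broken_line R I) : M := initial_exponent (bapprox b 0%N).

Definition Fexp (b : broken_line R I) : M := final_exponent (bapprox b 0%N).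

Definition based (b1 b2 : broken_line R I) : Prop :=
  forall k, bapprox b1 k 0 = bapprox b2 k 0.

Definition balanced (b1 b2 : broken_line R I) (x0 : M) : Prop :=
  [/\ based b1 b2, b1 0 = x0, b2 0 = x0 & Fexp b1 + Fexp b2 = x0].

(* [seg] is only relevant on [0, T]. *)
Definition is_broken_line_segment (T : R) (seg : R -> M) : Prop :=
  exists b t0 t1, [/\ is_broken_line b, t0 <= t1 <= 0, T = t1 - t0
    & forall t, 0 <= t <= T -> seg t = b (t0 + t)].

End BrokenLines.

(* Main.v *)
Require Import Defs.
From mathcomp Require Import all_boot all_order all_algebra.
From mathcomp Require Import finmap complex polyrcf.
From mathcomp Require Import all_classical all_reals all_analysis.
From mathcomp Require Import zify ring lra.

(** Let [gamma] be one of the two broken lines, of endpoint [x0], and let [a] and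
    [c = a + b] be the weights. Consider the path [gamma(t) / (c - a t)]. It runs
    from [I(gamma) / a] at [t = -oo] to [x0 / c] at [t = 0]. If [gamma] is
    [B - t m] on a domain of linearity, then the derivative of the new path is
    [- (c m - a B) / (c - a t) ^+ 2] there, so up to a change of time it is
    piecewise linear of exponent [c m - a B]. Walls are cones, so it meets the
    same walls as [gamma], and where [gamma] bends from [m] to [m + u] at time [t]
    its exponent changes by [(c - a t) u], while its distance to the wall is
    [c - a t] times that of [m]. As the wall functions are powers of binomials with
    positive coefficients, [z^u] occurring in [f ^+ K] implies that [z^(j u)]
    occurs in [f ^+ (j K)] (lemma [bend_scales]), so this is an allowed bend, at
    least after all exponents have been multiplied by a common denominator of the
    numbers [c - a t]; these are rational by [twisted_rational]. At [x0 / c] the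
    exponent is [c F(gamma) - a x0]. By the balancing condition it is the opposite
    of the one obtained from the other line with the weight [b], so the first path
    followed by the second one backwards is straight there, and this is the
    segment.

    This joined line has to be shown to be a broken line, generic or not, up to
    its unbounded domain. Its bends may collide or lie on boundaries of walls, and
    it may meet the singular locus, both because the given lines may be limits and
    because the segment is prolonged. Once the hyperplanes of the bends and the
    exponents are fixed, everything about a bent line is a linear function of its
    end (lemma [config_unique]). Let [y] be the common end of two of the
    approximations of the given lines; moving [x0] towards [y] induces a first
    order deformation of the joined line that separates its bends and moves them
    off the boundaries of the walls (lemmas [join_order], [cone_lex]). Moving the
    end further along a moment curve of higher order avoids the singular locus,
    because it lies in countably many subspaces of codimension two
    ([generic_end]). Off the singular locus, all walls through a point are
    parallel, and the crossing factor becomes a product of polynomials in one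
    variable ([factor_mod_ray]); only the finitely many walls that are nontrivial
    modulo some [J^k] matter for a given coefficient, so by the pigeonhole
    principle the coefficients can be kept constant along a sequence of
    deformations ([generic_sequence]). The joined line is the limit of such a
    sequence, as the general lemma [broken_line_from_limit] says. *)

Set Implicit Arguments.
Unset Strict Implicit.
Unset Printing Implicit Defensive.

Import Order.TTheory GRing.Theory Num.Theory.
Import numFieldNormedType.Exports.

Local Open Scope classical_set_scope.
Local Open Scope ring_scope.

(** * The pairing and the form *)

Section Pairing.
Variables (R : realType) (I : finType).
Local Notation N := (lattice I).
Local Notation M := (dual_space R I).
Implicit Types (n : N) (x y : M).

Definition ncol n : 'cV[R]_#|I| := (map_mx intr n)^T.

Lemma pairingE n x : pairing n x = (x *m ncol n) 0 0.
Proof. by rewrite mxE; apply: eq_bigr => j _; rewrite !mxE mulrC. Qed.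

Lemma pairingD n x y : pairing n (x + y) = pairing n x + pairing n y.
Proof. by rewrite !pairingE mulmxDl mxE. Qed.

Lemma pairingZ n a x : pairing n (a *: x) = a * pairing n x.
Proof. by rewrite !pairingE -scalemxAl mxE. Qed.

Lemma pairing0 n : pairing n (0 : M) = 0.
Proof. by rewrite pairingE mul0mx mxE. Qed.

Lemma pairingN n x : pairing n (- x) = - pairing n x.
Proof. by rewrite -scaleN1r pairingZ mulN1r. Qed.

Lemma pairingB n x y : pairing n (x - y) = pairing n x - pairing n y.
Proof. by rewrite pairingD pairingN. Qed.

Lemma pairingMn n x k : pairing n (x *+ k) = pairing n x *+ k.
Proof. by rewrite -scaler_nat pairingZ mulr_natl. Qed.

Lemma pairing0l x : pairing 0 x = 0.
Proof. by rewrite /pairing big1 // => j _; rewrite mxE mul0r. Qed.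

Lemma pairingDl n n' x : pairing (n + n') x = pairing n x + pairing n' x.
Proof.
by rewrite /pairing -big_split; apply: eq_bigr => j _; rewrite mxE intrD mulrDl.
Qed.

Lemma pairingMnl n k x : pairing (n *+ k) x = pairing n x *+ k.
Proof. by elim: k => [|k IH]; rewrite ?pairing0l // !mulrS pairingDl IH. Qed.

End Pairing.

Section Form.
Variables (R : realType) (I : finType) (F : fixed_data I).
Local Notation N := (lattice I).
Local Notation M := (dual_space R I).

Lemma p1D (n n' : N) : p1 R F (n + n') = p1 R F n + p1 R F n'.
Proof. by rewrite /p1 map_mxD mulmxDl map_mxD. Qed.

Lemma p10 : p1 R F 0 = 0.
Proof. by rewrite /p1 map_mx0 mul0mx map_mx0. Qed.

Lemma p1Mn (n : N) k : p1 R F (n *+ k) = p1 R F n *+ k.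
Proof. by elim: k => [|k IH]; rewrite ?p10 // !mulrS p1D IH. Qed.

Lemma p1_sum (J : {set I}) (f : I -> N) :
  p1 R F (\sum_(i in J) f i) = \sum_(i in J) p1 R F (f i).
Proof. by apply: (big_morph (p1 R F) p1D p10). Qed.

Lemma pairing_p1 (n n' : N) : pairing n' (p1 R F n) = ratr (bilin (Defs.form F) n n').
Proof.
rewrite /bilin /pairing /p1 [in RHS]mxE rmorph_sum /=; apply: eq_bigr => j _.
rewrite [in LHS]mxE; set z := (_ *m _) 0 j.
by rewrite !mxE rmorphM /= mulrC ratr_int.
Qed.

(** By skew-symmetry of the form. A bend at a wall with normal vector [n] adds a
    multiple of [p1 n] to the exponent, that is, a vector along the wall. *)
Lemma pairing_p1_self (n : N) : pairing n (p1 R F n) = 0.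
Proof.
rewrite pairing_p1 /bilin; set A := map_mx _ n; set z := _ 0 0.
suff /eqP : z = - z.
  by rewrite -addr_eq0 -mulr2n mulrn_eq0 /= => /eqP ->; apply: rmorph0.
rewrite {1}/z -[LHS]/((A *m Defs.form F *m A^T) 0 0).
rewrite -[in LHS](trmxK (A *m Defs.form F *m A^T)) [LHS]mxE.
by rewrite !trmx_mul trmxK (form_skew F) mulNmx mulmxN mulmxA mxE.
Qed.

Lemma p1_Mo (n : N) : n \in Nuf F -> Mo F (p1 R F n).
Proof.
move=> nN n' n'N; rewrite pairing_p1.
have /intrP[k ->] := form_uf_No nN n'N.
by rewrite ratr_int intr_int.
Qed.

Lemma Mo_add (x y : M) : Mo F x -> Mo F y -> Mo F (x + y).
Proof. by move=> hx hy n hn; rewrite pairingD rpredD ?hx ?hy. Qed.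

Lemma Mo0 : Mo F (0 : M).
Proof. by move=> n hn; rewrite pairing0 rpred0. Qed.

Lemma Mo_opp (x : M) : Mo F x -> Mo F (- x).
Proof. by move=> hx n hn; rewrite pairingN rpredN hx. Qed.

Lemma Mo_Mn (x : M) k : Mo F x -> Mo F (x *+ k).
Proof. by move=> hx n hn; rewrite pairingMn rpredMn ?hx. Qed.

(** In the basis of a seed, the product of the [d_i] will do. *)
Lemma No_multiple (e : seed F) :
  exists2 d : nat, (0 < d)%N & forall n, n *+ d \in No F.
Proof.
exists (\prod_i dmul F i)%N; first by rewrite prodn_gt0 // => i; apply: dmul_gt0.
move=> n; have [_ /(_ n isT)[a ->] _] := evec_N e.
have [h0 hB] := No_zmod F.
have hN x : x \in No F -> - x \in No F by move=> hx; rewrite -sub0r hB.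
have hD x y : x \in No F -> y \in No F -> x + y \in No F.
  by move=> hx hy; rewrite -(opprK y) hB ?hN.
have hMn x k : x \in No F -> x *+ k \in No F.
  by move=> hx; elim: k => [|k IH]; rewrite ?mulr0n // mulrS hD.
have hZ x (k : int) : x \in No F -> x *~ k \in No F.
  by move=> hx; case: k => k; rewrite -?pmulrn -?nmulrn ?hMn ?hN ?hMn.
rewrite -sumrMnl; apply: (big_ind (fun x => x \in No F)) => // i _.
have -> : (\prod_i dmul F i = dmul F i * \prod_(j | j != i) dmul F j)%N.
  by rewrite (bigD1 i).
have [/(_ i (finset.in_setT i)) hi _ _] := evec_No e.
by rewrite mulrnA hMn // pmulrn mulrzAC -pmulrn hZ.
Qed.

End Form.

(** * The monoid of exponents and series in one monomial *)

Section Monoid.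
Variables (R : realType) (I : finType) (F : fixed_data I) (e : seed F).
Variable sigma : set (dual_space R I).
Hypothesis sigma_cone : rational_polyhedral_cone sigma.
Hypothesis sigma_strict : strictly_convex sigma.
Local Notation N := (lattice I).
Local Notation M := (dual_space R I).
Local Notation P := (Pmon F sigma).
Local Notation J := (Jpow F sigma).

Lemma Pmon0 : P 0.
Proof.
case: sigma_cone => ns ->; split; last exact: Mo0.
by move=> n _; rewrite pairing0.
Qed.

Lemma Pmon_add u v : P u -> P v -> P (u + v).
Proof.
case: sigma_cone => ns ->; move=> [u1 u2] [v1 v2]; split; last exact: Mo_add.
by move=> n hn; rewrite pairingD addr_ge0 ?u1 ?v1.
Qed.

Lemma Pmon_Mn u k : P u -> P (u *+ k).
Proof.
move=> hu; elim: k => [|k IH]; first exact: Pmon0.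
by rewrite mulrS; apply: Pmon_add.
Qed.

Lemma Jpow_addP k u v : P u -> J k v -> J k (u + v).
Proof.
elim: k u v => [|k IH] u v hu /=; first exact: Pmon_add.
move=> [x [y [hx x0 hy ->]]]; exists x, (u + y); split=> //.
- exact: IH.
- by rewrite addrCA.
Qed.

Lemma Jpow_anti k l : (k <= l)%N -> J l `<=` J k.
Proof.
have hS j : J j.+1 `<=` J j.
  move=> u [x [y [hx _ hy ->]]]; exact: Jpow_addP.
by move=> /subnK <-; elim: (l - k)%N => [//|j IH] u /hS /IH.
Qed.

(** The sum of the inequalities defining a strictly convex cone is positive on
    its nonzero points; up to a common denominator it is integral on [P], so it
    bounds the number of terms in a decomposition of an element of [P]. *)
Lemma Jpow_separated u : P u -> exists k, ~ J k u.
Proof.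
case: sigma_cone (sigma_strict) => ns sE strict Pu.
have [d d0 hd] := No_multiple e.
pose h (x : M) := d%:R * \sum_(n <- ns) pairing n x.
have hD x y : h (x + y) = h x + h y.
  rewrite /h -mulrDr -big_split; congr (_ * _).
  by apply: eq_bigr => n _; rewrite pairingD.
have sge x n : P x -> n \in ns -> 0 <= pairing n x.
  by case=> + _; rewrite sE; apply.
have hge1 x : P x -> x != 0 -> 1 <= h x.
  move=> Px x0; have Px' := Px; case: Px' => sx mx.
  have hint : h x \is a Num.int.
    rewrite /h mulr_sumr; apply: rpred_sum => n _.
    by rewrite mulr_natl -pairingMnl mx.
  have sum0 : 0 <= \sum_(n <- ns) pairing n x.
    by rewrite big_seq; apply: sumr_ge0 => n hn; apply: sge.
  have h0 : 0 <= h x by rewrite mulr_ge0.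
  have hn0 : h x != 0.
    apply: contra_neq x0 => /eqP; rewrite mulf_eq0 pnatr_eq0 -leqn0 leqNgt d0 /=.
    rewrite big_seq psumr_eq0 => [/allP s0|n hn]; last exact: sge.
    apply: (strict _ sx); rewrite sE => n hn; rewrite pairingN.
    by have := s0 _ hn; rewrite hn /= => /eqP ->; rewrite oppr0.
  have : 0 < h x by rewrite lt_neqAle eq_sym hn0.
  have /intrP[z ->] := hint; rewrite ltr0z => z0.
  by rewrite ler1z.
have hJ k x : J k x -> k%:R <= h x.
  elim: k x => [|k IH] x.
    move=> Px; have [->|/(hge1 _ Px)] := eqVneq x 0; last by apply: le_trans.
    by rewrite /h big1 ?mulr0 // => n _; rewrite pairing0.
  move=> [y [z [Py y0 /IH hz ->]]].
  by rewrite hD -natr1 addrC lerD // hge1.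
exists (Num.bound (h u)) => /hJ; apply/negP; rewrite -ltNge.
exact: archi_boundP (hJ 0%N u Pu).
Qed.

End Monoid.

Section PolySeries.
Variables (R : realType) (I : finType) (F : fixed_data I).
Variable sigma : set (dual_space R I).
Hypothesis sigma_cone : rational_polyhedral_cone sigma.
Local Notation M := (dual_space R I).
Local Notation P := (Pmon F sigma).
Local Notation J := (Jpow F sigma).
Variable p : M.
Hypotheses (Pp : P p) (p0 : p != 0).

(** The substitution [X := z^p]. Natural coefficients are enough, and make
    positivity automatic. *)
Definition poly_series (Q : {poly nat}) : formal_series R I :=
  fun u => \sum_(i < size Q) (Q`_i)%R%:R * (u == p *+ i)%:R.

Lemma mulrn_inj_p : injective (fun i => p *+ i).
Proof.
move=> i j /= /eqP; rewrite -[p *+ i]scaler_nat -[p *+ j]scaler_nat -subr_eq0 -scalerBl scaler_eq0.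
by rewrite (negPf p0) orbF subr_eq0 eqr_nat => /eqP.
Qed.

Lemma poly_series_mul Q i : poly_series Q (p *+ i) = (Q`_i)%R%:R.
Proof.
rewrite /poly_series; case: (ltnP i (size Q)) => hi.
  rewrite (bigD1 (Ordinal hi)) //= eqxx mulr1 big1 ?addr0 // => j ji.
  rewrite (inj_eq mulrn_inj_p) eq_sym; case: eqP => [E|]; last by rewrite mulr0.
  by case/eqP: ji; apply: val_inj.
rewrite nth_default // big1 // => j _; rewrite (inj_eq mulrn_inj_p).
by case: eqP => [E|]; rewrite ?mulr0 //; have := ltn_ord j; rewrite -E ltnNge hi.
Qed.

Lemma poly_series_neq0 Q u : poly_series Q u != 0 ->
  exists2 i, u = p *+ i & (Q`_i)%R != 0%N.
Proof.
apply: contraPP => h; apply/negP; rewrite negbK; apply/eqP.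
rewrite /poly_series big1 // => i _.
case: eqP => [E|]; last by rewrite mulr0.
have [->|q] := eqVneq (Q`_i) 0; first by rewrite mul0r.
by exfalso; apply: h; exists i.
Qed.

Lemma poly_series_inj : injective poly_series.
Proof.
move=> Q Q' E; apply/polyP => i; apply/eqP; rewrite -(eqr_nat R[i]).
by rewrite -!poly_series_mul E.
Qed.

Lemma poly_series1 : poly_series 1 = @sone R I.
Proof.
apply/funext => u; rewrite /poly_series /sone /mono size_poly1 big_ord1.
by rewrite coef1 eqxx mul1r.
Qed.

Lemma smul_poly_series Q Q' :
  smul F sigma (poly_series Q) (poly_series Q') = poly_series (Q * Q').
Proof.
apply/funext => u; rewrite /smul /mono_subst.
have [[k ->]|nk] := pselect (exists k, u = p *+ k); last first.
  transitivity (0 : R[i]).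
    apply: fsbig1 => m [_ _]; apply/eqP; apply: contra_notT nk.
    rewrite mulf_eq0 negb_or => /andP[/poly_series_neq0[i -> _]].
    move=> /poly_series_neq0[j /eqP]; rewrite subr_eq => /eqP -> _.
    by exists (j + i)%N; rewrite mulrnDr.
  apply/esym/eqP; apply: contra_notT nk => /poly_series_neq0[i -> _].
  by exists i.
rewrite poly_series_mul coefM.
have rP m : m \in [seq p *+ i | i <- iota 0 k.+1] ->
    P m /\ P (p *+ k - m).
  case/mapP=> i; rewrite mem_iota add0n => /andP[_ ik] ->; split.
    exact: Pmon_Mn.
  by rewrite -mulrnBr //; apply: Pmon_Mn.
rewrite (fsbigE [seq p *+ i | i <- iota 0 k.+1]); first last.
- move=> m [_ _] mr; apply/eqP; rewrite mulf_eq0.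
  apply: contraNT mr; rewrite negb_or.
  move=> /andP[/poly_series_neq0[i -> _] /poly_series_neq0[j /eqP]].
  rewrite subr_eq -mulrnDr => /eqP/mulrn_inj_p -> _.
  by apply/mapP; exists i => //; rewrite mem_iota /= add0n ltnS leq_addl.
- by move=> m /= /rP.
- by rewrite map_inj_uniq ?iota_uniq //; apply: mulrn_inj_p.
rewrite big_seq_cond (eq_bigl (fun m => m \in [seq p *+ i | i <- iota 0 k.+1])).
  rewrite -big_seq big_map -[iota 0 k.+1]/(index_iota 0 k.+1) big_mkord.
  rewrite natr_sum; apply: eq_bigr => i _.
  by rewrite -mulrnBr -1?ltnS // !poly_series_mul natrM.
move=> m; case: (boolP (m \in _)) => //= /rP h.
by apply/mem_set.
Qed.

Lemma spow_poly_series Q k :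
  spow F sigma (poly_series Q) k = poly_series (Q ^+ k).
Proof.
elim: k => [|k IH]; first by rewrite expr0 poly_series1.
by rewrite exprS -smul_poly_series -IH.
Qed.

End PolySeries.

(** * Walls through a smooth point *)

Section Parallel.
Variables (R : realType) (I : finType).
Local Notation N := (lattice I).
Local Notation M := (dual_space R I).

Definition parallel (n n' : N) : Prop :=
  forall i j, n 0 i * n' 0 j = n 0 j * n' 0 i.

Lemma perp_pair_vspace (n n' : N) : ~ parallel n n' ->
  exists2 V : {vspace M}, (\dim V + 2)%N = #|I| &
    forall y, y \in V <-> perp n y /\ perp n' y.
Proof.
move=> /existsNP[i /existsNP[j /eqP nij]].
pose C := row_mx (ncol R n) (ncol R n').
pose f := linfun (mulmxr C : 'rV[R]_#|I| -> 'rV[R]_(1 + 1)).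
have fE y : f y = row_mx (y *m ncol R n) (y *m ncol R n').
  by rewrite lfunE /= mul_mx_row.
have f0 y : f y = 0 <-> perp n y /\ perp n' y.
  rewrite fE -[0](@row_mx0 _ 1 1 1); split.
    move=> /eq_row_mx[h1 h2]; rewrite /perp /=.
    by rewrite !pairingE h1 h2 mxE.
  rewrite /perp /= !pairingE => -[h1 h2]; congr row_mx; apply/matrixP => k l.
    by rewrite !ord1 h1 mxE.
  by rewrite !ord1 h2 mxE.
exists (lker f); last first.
  by move=> y; rewrite memv_ker -f0; split=> /eqP.
have full : (f @: fullv)%VS = fullv.
  apply/eqP; rewrite eqEsubv subvf /=; apply/subvP => z _.
  pose a := z 0 (lshift 1 0); pose b := z 0 (rshift 1 0).
  pose d : R := (n 0 i)%:~R * (n' 0 j)%:~R - (n 0 j)%:~R * (n' 0 i)%:~R.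
  have d0 : d != 0 by rewrite /d -!intrM -intrB intr_eq0 subr_eq0.
  pose u : M := ((a * (n' 0 j)%:~R - b * (n 0 j)%:~R) / d) *: delta_mx 0 i
      + ((b * (n 0 i)%:~R - a * (n' 0 i)%:~R) / d) *: delta_mx 0 j.
  have delta (k : N) l : pairing k (delta_mx 0 l : M) = (k 0 l)%:~R.
    rewrite /pairing (bigD1 l) //= mxE !eqxx mulr1 big1 ?addr0 // => m ml.
    by rewrite mxE (negPf ml) andbF mulr0.
  suff -> : z = f u by apply: memv_img; apply: memvf.
  have e1 : pairing n u = a.
    by rewrite pairingD !pairingZ !delta /d; field; exact: d0.
  have e2 : pairing n' u = b.
    by rewrite pairingD !pairingZ !delta /d; field; exact: d0.
  rewrite fE -[LHS](hsubmxK z); congr row_mx; apply/matrixP => k l; rewrite !ord1.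
    by rewrite -pairingE e1 /a mxE.
  by rewrite -pairingE e2 /b mxE.
have := limg_ker_dim f fullv.
by rewrite capfv full !dimvf /dim /= !mul1n.
Qed.

End Parallel.

Section SmoothPoints.
Variables (R : realType) (I : finType) (F : fixed_data I) (e : seed F).
Local Notation N := (lattice I).
Local Notation M := (dual_space R I).

Lemma near_perp_line (n : N) (x y : M) (A : set M) :
  (\forall z \near within (perp n) (nbhs x), A z) ->
  perp n x -> perp n y -> \forall t \near (0 : R), A (x + t *: y).
Proof.
move=> hA hx hy.
have c : (fun t : R => x + t *: y) @ (0 : R) --> x.
  rewrite -[X in _ --> X]addr0 -(scale0r y).
  by apply: cvgD; [exact: cvg_cst|exact: cvgZ cvg_id (cvg_cst _)].
have h : \forall t \near (0 : R), perp n (x + t *: y) -> A (x + t *: y) := c _ hA.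
apply: filterS h => t; apply.
by rewrite /perp /= pairingD pairingZ hx hy mulr0 addr0.
Qed.

Variables (W : choiceType) (D : W -> wall R I).
Hypothesis hwall : forall w, is_wall e (D w).

Lemma wall_cone_perp w x : wcone (D w) x -> perp (wnormal (D w)) x.
Proof. by have [_ _ h _ _] := hwall w; apply: h. Qed.

(** Otherwise the point would be on the boundary of the wall. *)
Lemma near_wall w x : ~ Sing D x -> wcone (D w) x ->
  \forall z \near within (perp (wnormal (D w))) (nbhs x), wcone (D w) z.
Proof.
move=> hs hx; apply: contrapT => h; apply: hs; left.
by exists w; split.
Qed.

Lemma wall_face w x (ns : seq N) nu : ~ Sing D x -> wcone (D w) x ->
  wcone (D w) = [set y | forall n, n \in ns -> 0 <= pairing n y] ->
  nu \in ns -> pairing nu x = 0 ->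
  forall y : M, perp (wnormal (D w)) y -> pairing nu y = 0.
Proof.
move=> hs hx wE nin nx y hy.
have px := wall_cone_perp hx; have hw := near_wall hs hx.
have py : perp (wnormal (D w)) (- y) by rewrite /perp /= pairingN hy oppr0.
have hge (z : M) : perp (wnormal (D w)) z -> 0 <= pairing nu z.
  move=> hz; have h1 := near_perp_line hw px hz.
  near (0 : R)^'+ => t.
  have t0 : 0 < t by near: t; apply: nbhs_right_gt.
  have : wcone (D w) (x + t *: z).
    by near: t; exact: (@cvg_within _ (nbhs (0 : R)) _ _ _ h1).
  by rewrite wE => /(_ _ nin); rewrite pairingD pairingZ nx add0r pmulr_rge0.
apply/eqP; rewrite eq_le hge // andbT -oppr_ge0 -pairingN; exact: hge.
Unshelve. all: by end_near. Qed.

(** Otherwise the intersection of the two walls would contain a neighbourhood of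
    the point in a subspace of codimension two, and the point would be singular. *)
Lemma walls_parallel w1 w2 x : ~ Sing D x -> wcone (D w1) x -> wcone (D w2) x ->
  parallel (wnormal (D w1)) (wnormal (D w2)).
Proof.
move=> hs h1 h2; apply: contrapT => np; apply: (hs); right.
exists w1, w2; split=> //.
have [V dV hV] := perp_pair_vspace R np.
exists V => //; split=> [y [/wall_cone_perp y1 /wall_cone_perp y2]|U hU].
  exact/hV.
apply/subvP => y /hV[y1 y2].
have n1 := near_perp_line (near_wall hs h1) (wall_cone_perp h1) y1.
have n2 := near_perp_line (near_wall hs h2) (wall_cone_perp h2) y2.
near (0 : R)^'+ => t.
have t0 : t != 0 by apply: lt0r_neq0; near: t; apply: nbhs_right_gt.
have : x + t *: y \in U.
  apply: hU; split; near: t.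
    exact: (@cvg_within _ (nbhs (0 : R)) _ _ _ n1).
  exact: (@cvg_within _ (nbhs (0 : R)) _ _ _ n2).
have xU : x \in U by apply: hU.
by rewrite rpredDl // rpredZeq (negPf t0).
Unshelve. all: by end_near. Qed.

End SmoothPoints.

Section Nplus.
Variables (I : finType) (F : fixed_data I) (e : seed F).
Local Notation N := (lattice I).

Definition uf_comb (a : I -> nat) : N := \sum_(i in uf F) e i *+ a i.

Lemma uf_comb_inj (a b : I -> nat) c d :
  uf_comb a *+ c = uf_comb b *+ d ->
  forall i, i \in uf F -> (a i * c = b i * d)%N.
Proof.
move=> h i hi; have [_ _ indep] := evec_Nuf e.
pose z j : int := (a j * c)%N%:Z - (b j * d)%N%:Z.
have : \sum_(j in uf F) e j *~ z j = 0.
  rewrite /z; under eq_bigr do rewrite mulrzBr.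
  rewrite big_split sumrN /=.
  under eq_bigr do rewrite -pmulrn mulrnA.
  under [X in _ - X]eq_bigr do rewrite -pmulrn mulrnA.
  by apply/eqP; rewrite subr_eq0 !sumrMnl; apply/eqP.
move=> /indep /(_ i hi) /eqP; rewrite /z subr_eq0 => /eqP.
by move=> [].
Qed.

Lemma uf_comb_neq0 (a : I -> nat) : (0 < \sum_(i in uf F) a i)%N -> uf_comb a != 0.
Proof.
apply: contraTneq => a0; rewrite -leqNgt leqn0 sum_nat_eq0.
apply/forall_inP => i hi; apply/eqP.
have := @uf_comb_inj a (fun=> 0%N) 1 1.
rewrite !mulr1n {2}/uf_comb big1 => [/(_ a0 i hi)|j _]; last by rewrite mulr0n.
by rewrite !muln1.
Qed.

(** Both vectors have nonnegative coordinates in the seed, so their factor of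
    proportionality is the ratio of the sums of these coordinates. *)
Lemma Nplus_parallel (a b : I -> nat) :
  (0 < \sum_(i in uf F) a i)%N -> (0 < \sum_(i in uf F) b i)%N ->
  parallel (uf_comb a) (uf_comb b) ->
  forall i, i \in uf F ->
    (b i * \sum_(j in uf F) a j = a i * \sum_(j in uf F) b j)%N.
Proof.
move=> a0 b0 par i hi.
have /eqP/rowP/existsNP[i0 /eqP] : uf_comb a != 0 by apply: uf_comb_neq0.
rewrite [X in _ != X]mxE; set al := uf_comb a 0 i0 => al0.
set be := uf_comb b 0 i0.
have E : uf_comb b *~ al = uf_comb a *~ be.
  by apply/rowP => j; rewrite -!scaler_int !mxE !intz par mulrC.
have [_ _ indep] := evec_Nuf e.
have expand (c : I -> nat) (k : int) :
    uf_comb c *~ k = \sum_(j in uf F) e j *~ ((c j)%:Z * k).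
  by rewrite mulrz_suml; apply: eq_bigr => j _; rewrite mulrzA -pmulrn.
have coord j : j \in uf F -> (b j)%:Z * al = (a j)%:Z * be.
  move=> hj; pose z j : int := (b j)%:Z * al - (a j)%:Z * be.
  have : \sum_(j in uf F) e j *~ z j = 0.
    rewrite /z; under eq_bigr do rewrite mulrzBr.
    by rewrite big_split sumrN /= -!expand E subrr.
  by move=> /indep /(_ j hj) /eqP; rewrite /z subr_eq0 => /eqP.
have S : (\sum_(j in uf F) b j)%N%:Z * al = (\sum_(j in uf F) a j)%N%:Z * be.
  rewrite -[_%:Z]intz -[X in _ = X * _]intz !sumMz !mulr_suml.
  by apply: eq_bigr => j hj; rewrite !intz coord.
apply/eqP; rewrite -eqz_nat !PoszM -(inj_eq (mulIf al0)); apply/eqP.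
by rewrite /= mulrAC coord // -!mulrA S [be * _]mulrC.
Qed.

End Nplus.

(** * Wall functions in one hyperplane *)

Section MinimalVector.
Variables (I : finType) (A : {set I}).
Local Notation size a := (\sum_(i in A) a i)%N.

(** A vector of least size on its ray generates it, by division with remainder;
    applied to the coordinates of normal vectors in a seed. *)
Lemma minimal_ray_vector (a0 : I -> nat) : (0 < size a0)%N ->
  exists2 a : I -> nat, (0 < size a)%N &
    forall b : I -> nat, (0 < size b)%N ->
      (forall i, i \in A -> b i * size a0 = a0 i * size b)%N ->
      exists2 j, (0 < j)%N & forall i, i \in A -> b i = (a i * j)%N.
Proof.
move=> A0.
pose prop (b : I -> nat) := forall i, i \in A -> (b i * size a0 = a0 i * size b)%N.
pose Q s := `[< (0 < s)%N /\ exists2 a, size a = s & prop a >].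
have exQ : exists s, Q s by exists (size a0); apply/asboolP; split=> //; exists a0.
case: (ex_minnP exQ) => s /asboolP[s0 [a sa pa]] smin.
exists a; rewrite ?sa // => b b0 pb.
have ab i : i \in A -> (b i * s = a i * size b)%N.
  move=> hi; apply/eqP; rewrite -(eqn_pmul2r A0); apply/eqP.
  by rewrite mulnAC pb // [RHS]mulnAC pa // sa mulnAC.
pose q := (size b %/ s)%N; pose r := (size b %% s)%N.
have bE : size b = (q * s + r)%N by apply: divn_eq.
have qa i : i \in A -> (a i * q <= b i)%N.
  by move=> hi; rewrite -(leq_pmul2r s0) ab // bE mulnDr mulnA leq_addr.
have rE i : i \in A -> ((b i - a i * q) * s = a i * r)%N.
  by move=> hi; rewrite mulnBl ab // bE mulnDr mulnA addKn.
have r0 : r = 0%N.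
  apply/eqP; rewrite -leqn0 leqNgt; apply/negP => r0.
  suff /smin : Q r by rewrite leqNgt ltn_mod s0.
  have sr : size (fun i => b i - a i * q)%N = r.
    apply/eqP; rewrite -(eqn_pmul2r s0) big_distrl /=.
    by rewrite (eq_bigr _ rE) -big_distrl /= sa mulnC.
  apply/asboolP; split=> //; exists (fun i => b i - a i * q)%N => // i hi.
  apply/eqP; rewrite -(eqn_pmul2r s0); apply/eqP.
  by rewrite mulnAC rE // sr mulnAC pa // sa mulnAC.
exists q.
  rewrite lt0n; apply: contraTneq b0 => q0.
  by rewrite bE q0 r0.
move=> i hi; apply/eqP; rewrite eqn_leq qa // andbT -subn_eq0.
by rewrite -(eqn_pmul2r s0) rE // r0 muln0.
Qed.

End MinimalVector.

Section WallFunctions.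
Variables (R : realType) (I : finType) (F : fixed_data I) (e : seed F).
Hypothesis p1_inj : p1_injective R F.
Variable sigma : set (dual_space R I).
Hypothesis sigma_cone : rational_polyhedral_cone sigma.
Hypothesis sigma_p1 : forall i, i \in uf F -> sigma (p1 R F (e i)).
Variables (W : choiceType) (D : W -> wall R I).
Hypothesis hwall : forall w, is_wall e (D w).
Hypothesis hfun : forall w, exists2 c : nat, (0 < c)%N &
        wfun (D w) = spow F sigma (binomial_fun F (wnormal (D w))) c.
Local Notation N := (lattice I).
Local Notation M := (dual_space R I).
Local Notation P := (Pmon F sigma).
Local Notation J := (Jpow F sigma).

Lemma uf_comb_Nuf (a : I -> nat) : uf_comb e a \in Nuf F.
Proof.
have [h0 hB] := Nuf_zmod F; have [hN _ _] := evec_Nuf e.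
have hD x y : x \in Nuf F -> y \in Nuf F -> x + y \in Nuf F.
  by move=> hx hy; rewrite -(opprK y) hB // -sub0r hB.
rewrite /uf_comb; apply: (big_ind (fun x => x \in Nuf F)) => // i /hN hi.
by elim: (a i) => [|k IH]; rewrite ?mulr0n // mulrS hD.
Qed.

Lemma p1_uf_comb (a : I -> nat) : P (p1 R F (uf_comb e a)).
Proof.
rewrite p1_sum; apply: (big_ind P) => [||i hi]; first exact: Pmon0.
  by move=> x y; apply: Pmon_add.
rewrite p1Mn; apply: Pmon_Mn => //; split; first exact: sigma_p1.
by apply: p1_Mo; have [h _ _] := evec_Nuf e; apply: h.
Qed.

Lemma p1_uf_comb_neq0 (a : I -> nat) :
  (0 < \sum_(i in uf F) a i)%N -> p1 R F (uf_comb e a) != 0.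
Proof.
move=> a0; apply: contra_neq (uf_comb_neq0 e a0) => h.
apply: p1_inj; rewrite ?p10 ?uf_comb_Nuf //.
by have [] := Nuf_zmod F.
Qed.

Lemma binomial_poly_series (n : N) j : (0 < j)%N -> p1 R F n != 0 ->
  binomial_fun F (n *+ j) = poly_series (p1 R F n) (1 + 'X^j).
Proof.
move=> j0 p0; apply/funext => u; rewrite /binomial_fun /mono p1Mn.
have [[i ->]|h] := pselect (exists i, u = p1 R F n *+ i).
  rewrite poly_series_mul // coefD coef1 coefXn natrD.
  have E0 : (p1 R F n *+ i == 0) = (i == 0)%N by exact: (inj_eq (mulrn_inj_p p0) i 0%N).
  have Ej : (p1 R F n *+ i == p1 R F n *+ j) = (i == j) by exact: (inj_eq (mulrn_inj_p p0)).
  by rewrite E0 Ej; case: (_ == 0)%N; case: (_ == j).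
rewrite [RHS](_ : _ = 0); last first.
  by apply/eqP; apply: contra_notT h => /poly_series_neq0[i -> _]; exists i.
case: eqP => [u0|_]; first by case: h; exists 0%N.
case: eqP => [u0|_]; first by case: h; exists j.
by rewrite addr0.
Qed.

(** The functions of the walls in one hyperplane are polynomials in a single
    monomial, that of the primitive normal vector. As all walls through a point
    off the singular locus lie in one hyperplane, crossing such a point is a
    computation with polynomials in one variable. *)
Lemma ray_data w0 : exists (nu : N) (j c : W -> nat),
  [/\ P (p1 R F nu), p1 R F nu != 0 &
   forall w, parallel (wnormal (D w0)) (wnormal (D w)) ->
    [/\ (0 < j w)%N, (0 < c w)%N, wnormal (D w) = nu *+ j w &
        wfun (D w) = poly_series (p1 R F nu) ((1 + 'X^(j w)) ^+ c w)]].
Proof.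
have [[a0 n0E a0_gt0] _ _ _ _] := hwall w0.
have [a a_gt0 amin] := minimal_ray_vector a0_gt0.
have /choice[c hc] : forall w, exists c, (0 < c)%N /\
    wfun (D w) = spow F sigma (binomial_fun F (wnormal (D w))) c.
  by move=> w; have [c] := hfun w; exists c.
pose nu := uf_comb e a.
have : forall w, exists j, parallel (wnormal (D w0)) (wnormal (D w)) ->
    (0 < j)%N /\ wnormal (D w) = nu *+ j.
  move=> w; have [par|?] := pselect (parallel (wnormal (D w0)) (wnormal (D w))).
    have [[b nE b_gt0] _ _ _ _] := hwall w.
    have [||j j0 jE] := amin b => //.
      by apply: (@Nplus_parallel _ _ e) => //; rewrite /uf_comb -n0E -nE.
    exists j => _; split=> //; rewrite nE /nu /uf_comb -sumrMnl.
    by apply: eq_bigr => i hi; rewrite jE // mulrnA.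
  by exists 0%N.
move=> /choice[j hj]; exists nu, j, c; split.
- exact: p1_uf_comb.
- exact: p1_uf_comb_neq0.
move=> w /hj[j0 nE]; have [c0 fE] := hc w; split=> //.
rewrite fE nE binomial_poly_series ?p1_uf_comb_neq0 // spow_poly_series //.
- exact: p1_uf_comb.
- exact: p1_uf_comb_neq0.
Qed.

End WallFunctions.

(** * Polynomials with natural coefficients and crossing exponents *)

Section NatPoly.
Implicit Types Q S : {poly nat}.

Lemma coefM_ge Q S i k : ((Q`_i)%R * (S`_k)%R <= ((Q * S)%R`_(i + k))%R)%N.
Proof.
have ik : (i < (i + k).+1)%N by rewrite ltnS leq_addr.
rewrite coefM (bigD1 (Ordinal ik)) //= addKn; exact: leq_addr.
Qed.

Lemma coefX_ge Q i c : ((Q`_i)%R ^ c <= ((Q ^+ c)%R`_(i * c))%R)%N.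
Proof.
elim: c => [|c IH]; first by rewrite muln0 expr0 coef1.
rewrite exprS mulnS expnS; apply: leq_trans (coefM_ge _ _ _ _).
by rewrite leq_mul2l IH orbT.
Qed.

(** Congruence to [1] modulo ['X^(i.+1)]. *)
Definition one_upto i Q := forall r, (r <= i)%N -> (Q`_r)%R = (r == 0)%N%:R.

Lemma one_uptoM i Q S : one_upto i S ->
  forall r, (r <= i)%N -> ((Q * S)%R`_r)%R = (Q`_r)%R.
Proof.
move=> hS r ri; rewrite coefMr (bigD1 ord0) //= subn0 hS // mulr1 big1 ?addr0 //.
move=> j j0; rewrite hS; last by apply: leq_trans ri; rewrite -ltnS.
by have /negPf -> : (j : nat) != 0%N; rewrite ?mulr0.
Qed.

Lemma one_upto_prod i (T : Type) (s : seq T) (pr : pred T) (G : T -> {poly nat}) :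
  (forall w, pr w -> one_upto i (G w)) -> one_upto i (\prod_(w <- s | pr w) G w).
Proof.
move=> h; apply: (big_ind (one_upto i)) => //; first by move=> r _; rewrite coef1.
by move=> Q S hQ hS r ri; rewrite (one_uptoM _ hS) // hQ.
Qed.

Lemma one_upto_binomial i j k : (i < j)%N -> one_upto i ((1 + 'X^j) ^+ k).
Proof.
move=> ij; elim: k => [|k IH]; first by move=> r _; rewrite expr0 coef1.
move=> r ri; rewrite exprS (one_uptoM _ IH) // coefD coef1 coefXn.
by rewrite (ltn_eqF (leq_ltn_trans ri ij)) addr0.
Qed.

End NatPoly.

Section Generator.
Variables (R : realType) (I : finType) (F : fixed_data I).
Local Notation N := (lattice I).
Local Notation M := (dual_space R I).

Lemma on_rayMn (n n' : N) j : (0 < j)%N -> on_ray R (n *+ j) n' <-> on_ray R n n'.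
Proof.
move=> j0; have jR : (0 : R) < j%:R by rewrite ltr0n.
have E : map_mx intr (n *+ j) = j%:R *: map_mx intr n :> 'rV[R]_#|I|.
  apply/rowP => k; by rewrite !mxE mulmxnE rmorphMn /= mulr_natl.
split; case=> r r0 h.
  by exists (r * j%:R); [exact: mulr_ge0 (ltW _)|rewrite h E scalerA].
exists (r / j%:R); first exact: divr_ge0 (ltW _).
by rewrite h E scalerA divfK ?gt_eqF.
Qed.

Lemma No_generatorMn (n : N) j : (0 < j)%N ->
  No_generator R F (n *+ j) = No_generator R F n.
Proof.
move=> j0; rewrite /No_generator; congr (xget 0 _); apply/seteqP.
split=> n0 [h1 h2 h3]; split=> //.
- exact/(on_rayMn _ _ j0).
- by move=> n' hn' h; apply: h3 => //; apply/(on_rayMn _ _ j0).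
- exact/(on_rayMn _ _ j0).
- by move=> n' hn' h; apply: h3 => //; apply/(on_rayMn _ _ j0).
Qed.

Lemma pairing_on_ray (n n' : N) : on_ray R n n' ->
  exists2 r : R, 0 <= r & forall x : M, pairing n' x = r * pairing n x.
Proof.
case=> r r0 h; exists r => // x; rewrite /pairing mulr_sumr.
apply: eq_bigr => j _; have /rowP/(_ j) := h; rewrite !mxE => ->.
by rewrite mulrA.
Qed.

Definition ray_exponent (n : N) (v m : M) : int :=
  Num.floor (- Num.sg (pairing n v) * pairing (No_generator R F n) m).

Lemma crossing_exponentMn (w : wall R I) (n : N) j v m : (0 < j)%N ->
  wnormal w = n *+ j -> crossing_exponent F w v m = ray_exponent n v m.
Proof.
move=> j0 nE; rewrite /crossing_exponent nE No_generatorMn // pairingMnl.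
by rewrite -mulr_natl sgrM gtr0_sg ?ltr0n // mul1r.
Qed.

Lemma No_generatorP (n : N) :
  No_generator R F n = 0 \/
  No_generator R F n \in No F /\
    exists2 r : R, 0 <= r & forall x : M, pairing (No_generator R F n) x = r * pairing n x.
Proof.
rewrite /No_generator; case: xgetP => [n0 _ [h1 h2 _]|_]; last by left.
by right; split=> //; apply: pairing_on_ray.
Qed.

(** The sign of the velocity [- m] cancels that of the pairing of the wall with
    [m]: broken lines never use inverses of wall functions, and the power only
    depends on the distance of [m] to the wall. If there is no generator of the
    ray in [N°], the default value [0] makes all the powers [0]. *)
Lemma ray_exponentE (n : N) (m : M) : Mo F m ->
  exists K : nat, forall c (m' : M), `|pairing n m'| = c%:R * `|pairing n m| ->
    ray_exponent n (- m') m' = (K * c)%N%:Z.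
Proof.
move=> hm; rewrite /ray_exponent.
have [E|[n0N [r r0 hr]]] := No_generatorP n.
  by exists 0%N => c m' _; rewrite E pairing0l mulr0 floor0 mul0n.
have /intrP[z zE] := hm _ n0N.
exists `|z|%N => c m' h.
rewrite pairingN sgrN opprK hr mulrCA -normrEsg h mulrCA -[r](ger0_norm r0).
rewrite -normrM -hr zE -intr_norm -abszE -[X in c%:R * X]/(`|z|%N%:R).
by rewrite -natrM mulnC -[_%:R]/((`|z| * c)%N%:Z%:~R) intrKfloor.
Qed.

End Generator.

(** * Crossing factors off the singular locus *)

Section Crossing.
Variables (R : realType) (I : finType) (F : fixed_data I) (e : seed F).
Hypothesis p1_inj : p1_injective R F.
Variable sigma : set (dual_space R I).
Hypothesis sigma_cone : rational_polyhedral_cone sigma.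
Hypothesis sigma_strict : strictly_convex sigma.
Hypothesis sigma_p1 : forall i, i \in uf F -> sigma (p1 R F (e i)).
Variables (W : choiceType) (D : W -> wall R I).
Hypothesis hwall : forall w, is_wall e (D w).
Hypothesis hfin : forall k, finite_set (nontrivial_mod F sigma D k).
Hypothesis hfun : forall w, exists2 c : nat, (0 < c)%N &
        wfun (D w) = spow F sigma (binomial_fun F (wnormal (D w))) c.
Local Notation N := (lattice I).
Local Notation M := (dual_space R I).
Local Notation P := (Pmon F sigma).
Local Notation J := (Jpow F sigma).
Local Notation NT := (nontrivial_mod F sigma D).
Local Notation factor_mod := (crossing_factor_mod F sigma D).

Lemma nontrivial_mod_leq k l : (k <= l)%N -> NT k `<=` NT l.
Proof.
move=> kl w h hl; apply: h => m Pm nJ; apply: hl => // /(Jpow_anti sigma_cone kl).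
exact: nJ.
Qed.

Lemma finite_walls_at x k : finite_set (walls_at D x `&` NT k).
Proof. by apply: sub_finite_set (hfin k) => w []. Qed.

Section Ray.
Variables (w0 : W) (nu : N) (j c : W -> nat).
Local Notation p := (p1 R F nu).
Hypotheses (Pp : P p) (p0 : p != 0).
Hypothesis hray : forall w, parallel (wnormal (D w0)) (wnormal (D w)) ->
    [/\ (0 < j w)%N, (0 < c w)%N, wnormal (D w) = nu *+ j w &
        wfun (D w) = poly_series p ((1 + 'X^(j w)) ^+ c w)].
Variables (x m : M) (K : nat).
Hypothesis hx : forall w, wcone (D w) x -> parallel (wnormal (D w0)) (wnormal (D w)).
Hypothesis hK : ray_exponent F nu (- m) m = K%:Z.

Definition ray_factor (w : W) : {poly nat} := (1 + 'X^(j w)) ^+ (c w * K).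

Lemma spowz_wall w : wcone (D w) x ->
  spowz F sigma (wfun (D w)) (crossing_exponent F (D w) (- m) m) =
  poly_series p (ray_factor w).
Proof.
move=> /hx/hray[j0 c0 nE fE].
rewrite (crossing_exponentMn _ _ _ j0 nE) hK fE /= spow_poly_series //.
by rewrite -exprM.
Qed.

Lemma factor_mod_ray k : factor_mod k x (- m) m =
  poly_series p (\prod_(w <- fset_set (walls_at D x `&` NT k)) ray_factor w).
Proof.
set A := walls_at D x `&` NT k.
have seqE (s : seq W) : (forall w, w \in s -> wcone (D w) x) ->
    \big[smul F sigma/@sone R I]_(w <- s)
      spowz F sigma (wfun (D w)) (crossing_exponent F (D w) (- m) m) =
    poly_series p (\prod_(w <- s) ray_factor w).
  elim: s => [|w s IH] h; first by rewrite !big_nil (poly_series1 p).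
  rewrite !big_cons IH => [|v vs]; last by apply: h; rewrite inE vs orbT.
  rewrite spowz_wall; last by apply: h; rewrite inE eqxx.
  by rewrite smul_poly_series.
rewrite /crossing_factor_mod seqE; last first.
  move=> w; rewrite in_finite_support; last first.
    by apply: sub_finite_set (finite_walls_at x k) => v [].
  by rewrite inE => -[[]].
congr poly_series; set s := finite_support _ _ _.
have sE w : w \in s = (w \in A) && (ray_factor w != 1).
  rewrite /s in_finite_support; last first.
    by apply: sub_finite_set (finite_walls_at x k) => v [].
  apply/idP/andP => [|[/set_mem Aw w1]]; rewrite inE.
    move=> [Aw /= w1]; split; first exact/mem_set.
    apply/eqP => r1; apply: w1; case: Aw => [Aw _].
    by rewrite spowz_wall // r1 poly_series1.
  split=> // /=; case: Aw => Aw _; rewrite spowz_wall // -(poly_series1 p).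
  by move/(poly_series_inj p0)/eqP; apply/negP.
rewrite [RHS](bigID (fun w => ray_factor w == 1)) /=.
rewrite [X in _ = X * _]big1 ?mul1r => [|w /eqP //].
rewrite -[RHS]big_filter; apply: perm_big.
apply: uniq_perm; rewrite ?filter_uniq ?fset_uniq ?finite_support_uniq // => w.
rewrite sE mem_filter in_fset_set; last exact: finite_walls_at.
by rewrite andbC.
Qed.

(** The coefficient of the function of the wall at [p *+ j w] is positive, so
    the wall can only be trivial modulo [J^k] if this exponent is in [J^k]. *)
Lemma trivial_wall_Jpow k w : wcone (D w) x -> ~ NT k w -> J k (p *+ j w).
Proof.
move=> /hx/hray[j0 c0 _ fE] /contrapT tr; apply: contrapT => nJ.
have := tr (p *+ j w) (Pmon_Mn sigma_cone _ Pp) nJ.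
rewrite fE poly_series_mul // /sone /mono.
have -> : (p *+ j w == 0) = false.
  by rewrite -[0]/(p *+ 0) (inj_eq (mulrn_inj_p p0)) gtn_eqF.
move/eqP; rewrite pnatr_eq0 => /eqP h.
have := coefM_ge ((1 + 'X^(j w)) ^+ (c w).-1) (1 + 'X^(j w)) 0 (j w).
rewrite -exprSr prednK // h leqn0 muln_eq0 coefD coef1 coefXn eqxx addn_eq0 andbF orbF.
have := coefX_ge (1 + 'X^(j w)) 0 (c w).-1.
rewrite mul0n coefD coef1 coefXn /= [0%N == j w]eq_sym gtn_eqF // addr0 exp1n.
by move=> h1 /eqP h2; rewrite h2 in h1.
Qed.

(** Increasing the precision multiplies by walls that are trivial modulo [J^k]. *)
Lemma factor_mod_coherent k l u : (k <= l)%N -> P u -> ~ J k u ->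
  factor_mod l x (- m) m u = factor_mod k x (- m) m u.
Proof.
move=> kl Pu nJ; rewrite !factor_mod_ray.
have [[i uE]|h] := pselect (exists i, u = p *+ i); last first.
  have z Q : poly_series p Q u = 0.
    by apply/eqP; apply: contra_notT h => /poly_series_neq0[i -> _]; exists i.
  by rewrite !z.
rewrite uE !poly_series_mul //; congr (_ %:R).
set sl := fset_set _; set sk := fset_set _.
have inl w : (w \in sl) = (w \in walls_at D x `&` NT l).
  by rewrite in_fset_set //; exact: finite_walls_at.
have ink w : (w \in sk) = (w \in walls_at D x `&` NT k).
  by rewrite in_fset_set //; exact: finite_walls_at.
rewrite big_seq (bigID (fun w => w \in sk)) /= (one_uptoM (i := i)) //.
  congr (nth _ (polyseq _) _); rewrite -big_filter; apply: perm_big.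
  apply: uniq_perm; rewrite ?filter_uniq ?fset_uniq // => w.
  rewrite mem_filter andbC andbA andbb inl ink.
  apply/andP/idP => [[]//|/set_mem[h1 h2]]; split; apply/mem_set; split=> //.
  exact: nontrivial_mod_leq h2.
apply: one_upto_prod => w; rewrite inl ink => /andP[/set_mem[wx _] /negP nk].
apply: one_upto_binomial; rewrite ltnNge; apply/negP => ji.
apply: nJ; rewrite uE -(subnK ji) mulrnDr; apply: Jpow_addP => //.
  exact: Pmon_Mn.
by apply: trivial_wall_Jpow => // ntw; apply: nk; apply/mem_set.
Qed.

(** The coefficient of [z^u] is read off the product modulo any [J^k] that does
    not contain [u]. *)
Lemma crossing_factor_exists : exists g, is_crossing_factor F sigma D x (- m) m g.
Proof.
have /choice[kk hkk] : forall u, exists k, P u -> ~ J k u.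
  move=> u; have [Pu|nP] := pselect (P u); last by exists 0%N.
  by have [k hk] := Jpow_separated e sigma_cone sigma_strict Pu; exists k.
exists (fun u => if pselect (P u) then factor_mod (kk u) x (- m) m u else 0).
split=> [u|k u Pu nJ]; case: pselect => // {}Pu; first by rewrite eqxx.
have nJ' := hkk u Pu.
have [le|/ltnW le] := leqP k (kk u); first exact: factor_mod_coherent.
exact/esym/factor_mod_coherent.
Qed.

End Ray.

Lemma crossing_factorE x v m u k g : is_crossing_factor F sigma D x v m g ->
  P u -> ~ J k u -> g u = factor_mod k x v m u.
Proof. by move=> [_ h] Pu nJ; apply: h. Qed.

Section Bend.
Variables (w0 : W) (x1 m u : M) (g1 : formal_series R I).
Hypotheses (x1S : ~ Sing D x1) (w0x1 : wcone (D w0) x1) (mM : Mo F m).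
Hypothesis hg1 : is_crossing_factor F sigma D x1 (- m) m g1.
Hypotheses (gu : g1 u != 0) (u0 : u != 0).

Let par1 w : wcone (D w) x1 -> parallel (wnormal (D w0)) (wnormal (D w)).
Proof. exact: walls_parallel hwall _ _ _ x1S w0x1. Qed.

Lemma bend_P : P u.
Proof. by case: hg1 => h _; apply: h. Qed.

(** The wall functions must occur with a positive power, as otherwise the
    crossing factor would be [1]. Hence the exponent [m] is not along the wall,
    and the ray of the wall does have a generator in [N°]. *)
Lemma bend_direction : [/\ pairing (wnormal (D w0)) u = 0,
  pairing (wnormal (D w0)) m != 0 &
  exists2 n0, n0 \in No F & exists2 r : R, r != 0 &
    forall y : M, pairing n0 y = r * pairing (wnormal (D w0)) y].
Proof.
have [nu [j [c [Pp p0 hray]]]] :=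
  ray_data p1_inj sigma_cone sigma_p1 hwall hfun w0.
have par0 : parallel (wnormal (D w0)) (wnormal (D w0)) by move=> i k; rewrite mulrC.
have [j0 c0 nE _] := hray w0 par0.
have [K hK] := ray_exponentE nu mM.
have hKm : ray_exponent F nu (- m) m = K%:Z by rewrite (hK 1%N) ?muln1 ?mul1r.
have [k nJ] := Jpow_separated e sigma_cone sigma_strict bend_P.
have := gu; rewrite (crossing_factorE hg1 bend_P nJ).
rewrite (factor_mod_ray Pp p0 hray par1 hKm) => /poly_series_neq0[i uE ci].
have K0 : (0 < K)%N.
  rewrite lt0n; apply: contra_neq u0 => K0; rewrite uE; move: ci.
  rewrite big1 => [|w _]; last by rewrite /ray_factor K0 muln0 expr0.
  by rewrite coef1; case: (eqVneq i 0%N) => [->|].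
split.
- by rewrite uE nE pairingMnl pairingMn pairing_p1_self !mul0rn.
- apply: contraTneq K0 => nm; rewrite -leqNgt leqn0.
  have nm' : pairing nu m = 0.
    by move/eqP: nm; rewrite nE pairingMnl mulrn_eq0 gtn_eqF // => /eqP.
  have := hK 0%N m; rewrite nm' normr0 mulr0 muln0 hKm => /(_ erefl) /eqP.
  by rewrite eqz_nat.
- have [E|[n0N [r r0 hr]]] := No_generatorP R F nu.
    move/eqP: hKm; rewrite /ray_exponent E pairing0l mulr0 floor0 eqz_nat.
    by move=> /eqP K00; rewrite -K00 in K0.
  exists (No_generator R F nu) => //; exists (r / (j w0)%:R); last first.
    move=> y; rewrite hr nE pairingMnl -[pairing nu y *+ _]mulr_natl mulrA divfK //.
    by rewrite pnatr_eq0 gtn_eqF.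
  rewrite mulf_neq0 ?invr_eq0 ?pnatr_eq0 ?gtn_eqF //.
  apply: contraTneq K0 => r00; rewrite -leqNgt leqn0.
  by move/eqP: hKm; rewrite /ray_exponent hr r00 mul0r mulr0 floor0 eqz_nat eq_sym.
Qed.

(** The coefficients are natural numbers, so that nothing cancels in the [c]-th
    power of a product in which [z^u] occurs, nor when the functions of more
    walls, with constant term [1], are multiplied to it. *)
Lemma bend_scales k c x m' : ~ J k u -> ~ Sing D x -> wcone (D w0) x ->
  (walls_at D x1 `&` NT k) `<=` walls_at D x ->
  `|pairing (wnormal (D w0)) m'| = c%:R * `|pairing (wnormal (D w0)) m| ->
  exists2 g, is_crossing_factor F sigma D x (- m') m' g & g (u *+ c) != 0.
Proof.
move=> nJ xS w0x sub nm'.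
have [nu [j [cc [Pp p0 hray]]]] :=
  ray_data p1_inj sigma_cone sigma_p1 hwall hfun w0.
have par0 : parallel (wnormal (D w0)) (wnormal (D w0)) by move=> i l; rewrite mulrC.
have [j0 c0 nE _] := hray w0 par0.
have nuE : `|pairing nu m'| = c%:R * `|pairing nu m|.
  move: nm'; rewrite nE !pairingMnl !normrMn mulrnAr => /eqP.
  by rewrite eqr_pMn2r // => /eqP.
have [K hK] := ray_exponentE nu mM.
have hKm : ray_exponent F nu (- m) m = K%:Z by rewrite (hK 1%N) ?muln1 ?mul1r.
have hKm' := hK c m' nuE.
have par w : wcone (D w) x -> parallel (wnormal (D w0)) (wnormal (D w)).
  exact: walls_parallel hwall _ _ _ xS w0x.
have [g hg] := crossing_factor_exists Pp p0 hray par hKm'.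
exists g => //.
have := gu; rewrite (crossing_factorE hg1 bend_P nJ).
rewrite (factor_mod_ray Pp p0 hray par1 hKm) => /poly_series_neq0[i uE ci].
(* The precision must separate both [u] and its multiple. *)
have Puc : P (u *+ c) by apply: Pmon_Mn => //; exact: bend_P.
have [l0 nl0] := Jpow_separated e sigma_cone sigma_strict Puc.
pose l := maxn k l0.
have nl : ~ J l (u *+ c).
  by move=> h; apply: nl0; apply: Jpow_anti h => //; exact: leq_maxr.
rewrite (crossing_factorE hg Puc nl) (factor_mod_ray Pp p0 hray par hKm').
rewrite uE -mulrnA poly_series_mul // pnatr_eq0 -lt0n.
set sl := fset_set _; rewrite big_seq.
set sk := fset_set _ in ci.
have inl w : (w \in sl) = (w \in walls_at D x `&` NT l).
  by rewrite in_fset_set //; exact: finite_walls_at.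
have ink w : (w \in sk) = (w \in walls_at D x1 `&` NT k).
  by rewrite in_fset_set //; exact: finite_walls_at.
rewrite (bigID (fun w => w \in sk)) /= -[(i * c)%N]addn0.
apply: leq_trans (coefM_ge _ _ _ _); rewrite muln_gt0; apply/andP; split.
  have -> : \prod_(w <- sl | (w \in sl) && (w \in sk)) ray_factor j cc (K * c) w =
      (\prod_(w <- sk) ray_factor j cc K w) ^+ c.
    rewrite -prodrXl -big_filter.
    rewrite (perm_big (enum_fset sk)).
      by apply: eq_bigr => w _; rewrite /ray_factor -exprM mulnA.
    apply: uniq_perm; rewrite ?filter_uniq ?fset_uniq // => w.
    rewrite mem_filter andbC andbA andbb inl ink.
    apply/andP/idP => [[]//|/set_mem[h1 h2]]; split; apply/mem_set; split=> //.
      by apply: sub; split.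
    by apply: nontrivial_mod_leq h2; exact: leq_maxl.
  by apply: leq_trans (coefX_ge _ _ _); rewrite expn_gt0 lt0n ci.
elim/big_ind: _ => [|Q S hQ hS|w _]; first by rewrite coef1.
  by apply: leq_trans (coefM_ge Q S 0 0); rewrite muln_gt0 hQ hS.
rewrite /ray_factor -[X in (_)`_X](mul0n (cc w * (K * c))).
apply: leq_trans (coefX_ge _ _ _); rewrite expn_gt0 coefD coef1.
by rewrite addn_gt0.
Qed.

End Bend.

End Crossing.

(** * Curves in general position *)

Section Curve.
Variables (R : realType) (n : nat).
Local Notation M := 'rV[R]_n.
Implicit Types (c : 'cV[R]_n) (x : M).

(** Linear forms are columns, so that precomposing them with the matrices that
    describe broken lines is a matrix product. *)
Definition lform c x : R := (x *m c) 0 0.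

(** The point [e0 + s *: e1] moved along a moment curve of order two in [s]: near
    [e0] it behaves like the half-line from [e0] in the direction [e1], but it
    meets every hyperplane in finitely many points. *)
Definition curve (e0 e1 : M) (s : R) : M :=
  e0 + s *: e1 + \sum_(i < n) s ^+ i.+2 *: delta_mx 0 i.

Definition curve_poly (e0 e1 : M) c : {poly R} :=
  (lform c e0)%:P + lform c e1 *: 'X + \sum_(i < n) c i 0 *: 'X^(i.+2).

Lemma lformD c x y : lform c (x + y) = lform c x + lform c y.
Proof. by rewrite /lform mulmxDl mxE. Qed.

Lemma lformZ c a x : lform c (a *: x) = a * lform c x.
Proof. by rewrite /lform -scalemxAl mxE. Qed.

Lemma lform_curve e0 e1 c s : lform c (curve e0 e1 s) = (curve_poly e0 e1 c).[s].
Proof.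
rewrite /curve !lformD lformZ /curve_poly !hornerE; congr (_ + _).
  by rewrite mulrC.
rewrite horner_sum /lform mulmx_suml summxE; apply: eq_bigr => i _.
by rewrite -scalemxAl mxE -rowE mxE hornerZ hornerXn mulrC.
Qed.

(** The sign of [x0 + s * x1 + O(s ^+ 2)] for small positive [s]. *)
Definition lex_pos (x0 x1 : R) := 0 < x0 \/ x0 = 0 /\ 0 < x1.

Lemma curve_pos e0 e1 c : lex_pos (lform c e0) (lform c e1) ->
  \forall s \near (0 : R)^'+, 0 < lform c (curve e0 e1 s).
Proof.
pose Q := (lform c e1)%:P + \sum_(i < n) c i 0 *: 'X^(i.+1).
have QE s : lform c (curve e0 e1 s) = lform c e0 + s * Q.[s].
  rewrite lform_curve /curve_poly /Q !hornerE -addrA; congr (_ + _).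
  rewrite mulrDr mulrC; congr (_ + _).
  rewrite !horner_sum mulr_sumr; apply: eq_bigr => i _.
  by rewrite !hornerZ !hornerXn [RHS]mulrCA -exprS.
have pos (P : {poly R}) : 0 < P.[0] -> \forall s \near (0 : R), 0 < P.[s].
  move=> P0; exact: (cvgr_gt _ (@continuous_horner R P 0) _ P0).
have right (A : set R) : (\forall s \near (0 : R), A s) -> \forall s \near 0^'+, A s.
  exact: cvg_within.
move=> [c0|[c0 c1]].
  apply: right; have : 0 < (curve_poly e0 e1 c).[0].
    by rewrite -lform_curve QE mul0r addr0.
  by move=> /pos; apply: filterS => s; rewrite lform_curve.
have : 0 < Q.[0].
  rewrite /Q !hornerE horner_sum big1 ?addr0 // => i _.
  by rewrite hornerZ hornerXn expr0n mulr0.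
move=> /pos/right Q0; near=> s.
have s0 : 0 < s by near: s; apply: nbhs_right_gt.
have Qs : 0 < Q.[s] by near: s.
by rewrite QE c0 add0r mulr_gt0.
Unshelve. all: by end_near. Qed.

Lemma curve_poly_neq0 e0 e1 c : c != 0 -> curve_poly e0 e1 c != 0.
Proof.
move=> c0; have [i ci] : exists i, c i 0 != 0.
  apply: contrapT => /forallNP h; case/eqP: c0; apply/matrixP => i j.
  by rewrite ord1 mxE; apply/eqP; move: (h i) => /negP; rewrite negbK.
apply: contra_neq ci => /(congr1 (fun p : {poly R} => p`_(i.+2))).
rewrite coef0 !coefD coefC coefZ coefX mulr0 !add0r coef_sum.
rewrite (bigD1 i) //= coefZ coefXn eqxx mulr1 big1 ?addr0 // => j ji.
rewrite coefZ coefXn !eqSS; case: eqP => [E|]; last by rewrite mulr0.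
by case/eqP: ji; apply: val_inj.
Qed.

(** Each hyperplane excludes finitely many values of [s], and intervals are
    uncountable. *)
Lemma curve_avoids e0 e1 (B : set 'cV[R]_n) : countable B -> (forall c, B c -> c != 0) ->
  forall eps : R, 0 < eps ->
    exists2 s, 0 < s < eps & forall c, B c -> lform c (curve e0 e1 s) != 0.
Proof.
move=> cB B0 eps eps0; apply: contrapT => h.
pose Z := \bigcup_(c in B) [set` (rootsR (curve_poly e0 e1 c))].
have cZ : countable Z.
  by apply: bigcup_countable => // c _; apply: finite_set_countable.
have sub : [set` `]0, eps[%R] `<=` Z.
  move=> s /=; rewrite in_itv /= => hs; apply: contrapT => nZ; apply: h.
  exists s => // c Bc; rewrite lform_curve; apply/negP => rt.
  apply: nZ; exists c => //=; have cn := curve_poly_neq0 e0 e1 (B0 c Bc).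
  by have := roots_on_rootsR cn s; rewrite in_itv /= => <-.
have := countable_lebesgue_measure0 (sub_countable (subset_card_le sub) cZ).
by rewrite lebesgue_measure_itv /= lte_fin eps0 sube0 => -[] /eqP; rewrite gt_eqF.
Qed.

Lemma curve0 e0 e1 : curve e0 e1 0 = e0.
Proof.
by rewrite /curve scale0r addr0 big1 ?addr0 // => i _; rewrite expr0n scale0r.
Qed.

Lemma cvg_sum_fin (V : normedModType R) (T : Type) (G : set_system T) (k : nat)
    (f : 'I_k -> T -> V) (a : 'I_k -> V) : Filter G ->
  (forall i, f i x @[x --> G] --> a i) -> (\sum_i f i x) @[x --> G] --> \sum_i a i.
Proof.
move=> FG h; apply: cvg_big => //; exact: add_continuous.
Qed.

Lemma lform_cvg (T : Type) (G : set_system T) (f : T -> M) x c : Filter G ->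
  f @ G --> x -> lform c (f t) @[t --> G] --> lform c x.
Proof.
move=> FG h; rewrite /lform mxE.
under eq_fun do rewrite mxE.
apply: cvg_sum_fin => i; apply: cvgM; last exact: cvg_cst.
exact: (cvg_comp _ _ h (@coord_continuous R _ _ 0 i x)).
Qed.

Lemma curve_cvg e0 e1 (u : nat -> R) : u @ \oo --> 0 ->
  (fun k => curve e0 e1 (u k)) @ \oo --> e0.
Proof.
move=> u0; rewrite -[X in _ --> X](curve0 e0 e1) /curve.
apply: cvgD; first by apply: cvgD; [exact: cvg_cst|exact: cvgZ u0 (cvg_cst _)].
apply: cvg_sum_fin => i; apply: cvgZ; last exact: cvg_cst.
exact: (cvg_comp _ _ u0 (@exprn_continuous R i.+2 0)).
Qed.

End Curve.

(** * Bent lines as linear functions of their end *)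

Section Skeleton.
Variables (R : realType) (I : finType).
Local Notation N := (lattice I).
Local Notation M := (dual_space R I).

(** On its [l]-th domain the line is [s |-> B l - s *: m l]; it crosses the
    hyperplane orthogonal to [nv l] at time [t l], and ends in [y]. *)
Definition config (L : nat) (nv : nat -> N) (m : nat -> M)
    (t : nat -> R) (B : nat -> M) (y : M) : Prop :=
  [/\ B L = y, t L = 0 & forall l, (l < L)%N ->
    B l.+1 - B l = t l *: (m l.+1 - m l) /\
    pairing (nv l) (B l - t l *: m l) = 0].

Definition transverse (L : nat) (nv : nat -> N) (m : nat -> M) : Prop :=
  forall l, (l < L)%N ->
    pairing (nv l) (m l) != 0 /\ pairing (nv l) (m l.+1 - m l) = 0.

(** Seen from the end [y], where the velocity is [- m L], each bend [l] corrects
    the path at the times before [t l]. The formula makes sense for colliding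
    bends and is continuous in all the data. *)
Definition bent_path (L : nat) (m : nat -> M) (t : nat -> R) (y : M) (s : R) : M :=
  y - s *: m L + \sum_(l < L) Num.min (s - t l) 0 *: (m l.+1 - m l).

Section Fixed.
Variables (L : nat) (nv : nat -> N) (m : nat -> M).
Local Notation d l := (m l.+1 - m l).

Lemma bent_pathE t B y j s : config L nv m t B y -> (j <= L)%N ->
  (forall l, (l < j)%N -> t l <= s) ->
  (forall l, (j <= l < L)%N -> s <= t l) ->
  bent_path L m t y s = B j - s *: m j.
Proof.
move=> [BL _ h] jL h1 h2; rewrite /bent_path -BL.
rewrite -(big_mkord xpredT (fun l => Num.min (s - t l) 0 *: d l)).
rewrite (big_cat_nat (n := j)) //= [X in _ + (X + _)]big_nat big1 ?add0r; last first.
  by move=> l /andP[_ lj]; rewrite min_r ?scale0r // subr_ge0 h1.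
rewrite [X in _ + X](_ : _ =
  \sum_(j <= l < L) ((s *: m l.+1 - B l.+1) - (s *: m l - B l))); last first.
  apply: eq_big_nat => l /andP[jl lL]; rewrite min_l; last first.
    by rewrite subr_le0 h2 // jl.
  have [E _] := h _ lL.
  by rewrite scalerBl -E; apply/rowP => k; rewrite !mxE; ring.
rewrite telescope_sumr //.
by apply/rowP => k; rewrite !mxE; ring.
Qed.

Hypothesis tr : transverse L nv m.

(** From the line after a bend to the line before it. *)
Definition step_mx l : 'M[R]_#|I| :=
  1%:M - (pairing (nv l) (m l))^-1 *: (ncol R (nv l) *m d l).

Fixpoint sol_mx (k : nat) : 'M[R]_#|I| :=
  if k is k'.+1 then sol_mx k' *m step_mx (L - k) else 1%:M.

(** The hyperplanes of the bends being fixed, the [l]-th line and the time and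
    point of the [l]-th bend are linear functions of the end of the path. *)
Definition line_mx l := sol_mx (L - l).

Definition time_col l : 'cV[R]_#|I| :=
  if (l < L)%N then (pairing (nv l) (m l))^-1 *: (line_mx l.+1 *m ncol R (nv l))
  else 0.

Definition point_mx l : 'M[R]_#|I| := line_mx l - time_col l *m m l.

Lemma line_mxL : line_mx L = 1%:M.
Proof. by rewrite /line_mx subnn. Qed.

Lemma line_mxS l : (l < L)%N -> line_mx l = line_mx l.+1 *m step_mx l.
Proof.
move=> lL; rewrite /line_mx -[in LHS](subnSK lL) /= subnSK // subKn //.
exact: ltnW.
Qed.

Lemma mul_ncol (n : N) (x y : M) : x *m (ncol R n *m y) = pairing n x *: y.
Proof.
rewrite mulmxA pairingE; apply/rowP => k.
by rewrite [in LHS]mxE big_ord1 [in RHS]mxE.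
Qed.

Lemma step_mxE x l : x *m step_mx l = x - (pairing (nv l) x / pairing (nv l) (m l)) *: d l.
Proof.
by rewrite mulmxBr mulmx1 -scalemxAr mul_ncol scalerA [_ / _]mulrC.
Qed.

(** Bending changes the exponent along the wall, so a step is inverted by the
    opposite shear. *)
Lemma unit_line_mx l : (l <= L)%N -> line_mx l \in unitmx.
Proof.
move=> lL; rewrite -(subKn lL); elim: (L - l)%N (leq_subr l L) => [|k IH] kL.
  by rewrite subn0 line_mxL unitmx1.
have kL' : (L - k.+1 < L)%N by rewrite -subSn // subSS leq_subr.
rewrite line_mxS // unitmx_mul -subSn // subSS IH ?(ltnW kL) //=.
have [n0 nd] := tr kL'.
set l0 := (L - k.+1)%N in kL' n0 nd *.
suff : step_mx l0 *m (1%:M + (pairing (nv l0) (m l0))^-1 *: (ncol R (nv l0) *m d l0)) = 1%:M.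
  by move/mulmx1_unit => [].
apply/row_matrixP => i; rewrite !rowE mulmxA mulmx1; move: (delta_mx _ _) => x.
rewrite mulmxDr mulmx1 -scalemxAr mul_ncol step_mxE pairingB pairingZ nd mulr0.
by rewrite subr0 scalerA [_^-1 * _]mulrC subrK.
Qed.

Lemma time_colE l y : (l < L)%N ->
  lform (time_col l) y = pairing (nv l) (y *m line_mx l.+1) / pairing (nv l) (m l).
Proof.
move=> lL; rewrite /lform /time_col lL -scalemxAr mxE mulmxA -pairingE.
by rewrite mulrC.
Qed.

Lemma config_unique t B y : config L nv m t B y -> forall l, (l <= L)%N ->
  B l = y *m line_mx l /\ t l = lform (time_col l) y.
Proof.
move=> [BL tL h] l lL; rewrite -(subKn lL).
elim: (L - l)%N (leq_subr l L) => [|k IH] kL.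
  rewrite subn0 line_mxL mulmx1 BL tL /time_col ltnn; split=> //.
  by rewrite /lform mulmx0 mxE.
have kL' : (L - k.+1 < L)%N by rewrite -subSn // subSS leq_subr.
have [IH1 _] := IH (ltnW kL).
move: IH1; rewrite (_ : (L - k)%N = (L - k.+1).+1); last by rewrite -subSn.
set l0 := (L - k.+1)%N in kL' *; move=> Bl.
have [n0 nd] := tr kL'; have [E1 E2] := h _ kL'.
have tE : t l0 = pairing (nv l0) (B l0.+1) / pairing (nv l0) (m l0).
  apply: (canRL (mulfK n0)).
  have : pairing (nv l0) (B l0.+1 - B l0) = 0 by rewrite E1 pairingZ nd mulr0.
  move/eqP; rewrite pairingB subr_eq0 => /eqP ->; apply/eqP.
  by move/eqP: E2; rewrite pairingB pairingZ subr_eq0 eq_sym.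
split; last by rewrite time_colE // -Bl.
by rewrite line_mxS // mulmxA step_mxE -Bl -tE -E1 subKr.
Qed.

Lemma config_sol y :
  config L nv m (fun l => lform (time_col l) y) (fun l => y *m line_mx l) y.
Proof.
split=> [||l lL].
- by rewrite line_mxL mulmx1.
- by rewrite /time_col ltnn /lform mulmx0 mxE.
have [n0 nd] := tr lL.
have E : y *m line_mx l.+1 - y *m line_mx l = lform (time_col l) y *: d l.
  by rewrite time_colE // (line_mxS lL) mulmxA step_mxE subKr.
split=> //; rewrite pairingB pairingZ time_colE // divfK //.
rewrite -pairingB -opprB E pairingN pairingZ.
by rewrite nd mulr0 oppr0.
Qed.

Lemma mul_point_mx y l :
  y *m point_mx l = y *m line_mx l - lform (time_col l) y *: m l.
Proof.
rewrite mulmxBr mulmxA; congr (_ - _); apply/rowP => k.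
by rewrite [in LHS]mxE big_ord1 [in RHS]mxE.
Qed.

Lemma config_point t B y : config L nv m t B y -> forall l, (l <= L)%N ->
  B l - t l *: m l = y *m point_mx l.
Proof.
by move=> /config_unique h l /h[-> ->]; rewrite mul_point_mx.
Qed.

End Fixed.
End Skeleton.

(** * Piecewise linear paths *)

Section BentPath.
Variables (R : realType) (I : finType).
Local Notation N := (lattice I).
Local Notation M := (dual_space R I).
Variables (L : nat) (m : nat -> M).

Lemma bent_path_cvg (T : Type) (G : set_system T) (u : T -> R) (tt : nat -> T -> R)
    (yy : T -> M) s t y : Filter G ->
  u @ G --> (s : R) -> (forall l, (l < L)%N -> tt l @ G --> (t l : R)) -> yy @ G --> (y : M) ->
  bent_path L m (fun l => tt l x) (yy x) (u x) @[x --> G] --> bent_path L m t y s.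
Proof.
move=> FG us tl yl; rewrite /bent_path.
apply: cvgD; first by apply: cvgB => //; exact: cvgZ us (cvg_cst _).
apply: cvg_sum_fin => i; apply: cvgZ; last exact: cvg_cst.
rewrite minr_absE; under eq_cvg do rewrite minr_absE.
have h : (u x - tt i x) @[x --> G] --> s - t i by apply: cvgB => //; exact: tl.
apply: cvgM; last exact: cvg_cst.
apply: cvgB; first by apply: cvgD => //; exact: cvg_cst.
by apply: cvg_norm; apply: cvgB => //; exact: cvg_cst.
Qed.

Lemma bent_path_continuous t y : continuous (bent_path L m t y).
Proof.
by move=> s; apply: (@bent_path_cvg _ _ id (fun l _ => t l) (fun=> y)) => [|l _|];
  first exact: cvg_id; exact: cvg_cst.
Qed.

Variables (nv : nat -> N) (t : nat -> R) (B : nat -> M) (y : M).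
Hypothesis hc : config L nv m t B y.
Hypothesis tW : forall l, (l < L)%N -> t l <= t l.+1.

Lemma time_le i j : (i <= j <= L)%N -> t i <= t j.
Proof.
move=> /andP[ij jL]; elim: j ij jL => [|j IH]; first by rewrite leqn0 => /eqP ->.
rewrite leq_eqVlt => /predU1P[->//|ij] jL.
by apply: le_trans (tW jL); apply: IH => //; exact: ltnW.
Qed.

Lemma time_L : t L = 0. Proof. by case: hc. Qed.

Lemma nth_times j : (j <= L)%N -> (mkseq t L)`_j = t j.
Proof.
rewrite leq_eqVlt => /predU1P[->|jL]; last by rewrite nth_mkseq.
by rewrite nth_default ?size_mkseq // time_L.
Qed.

Lemma bent_path_domain j s : (j <= L)%N -> in_domain (mkseq t L) j s ->
  bent_path L m t y s = B j - s *: m j.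
Proof.
move=> jL; rewrite /in_domain (nth_times jL) => /andP[h1 h2].
apply: (bent_pathE hc) => // l.
  case: j jL h1 {h2} => //= j jL h1 lj; apply: le_trans h1.
  by rewrite nth_times ?(ltnW jL) // time_le // -ltnS lj /= ltnW.
by move=> /andP[jl lL]; apply: le_trans h2 _; rewrite time_le // jl ltnW.
Qed.

Lemma bent_path_bend l : (l < L)%N -> bent_path L m t y (t l) = B l - t l *: m l.
Proof.
move=> lL; apply: (bent_pathE hc); first exact: ltnW.
  by move=> k kl; rewrite time_le // (ltnW kl) ltnW.
by move=> k /andP[lk kL]; rewrite time_le // lk ltnW.
Qed.

Lemma bent_path_on_line s : s <= 0 ->
  exists2 j, (j <= L)%N & bent_path L m t y s = B j - s *: m j.
Proof.
move=> s0; have ex : exists j, s <= t j by exists L; rewrite time_L.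
case: (ex_minnP ex) => j sj jmin; exists j; first by apply: jmin; rewrite time_L.
have jL : (j <= L)%N by apply: jmin; rewrite time_L.
apply: (bent_pathE hc) => // l.
  by move=> lj; rewrite leNgt; apply/negP => /ltW/jmin; rewrite leqNgt lj.
by move=> /andP[jl lL]; apply: le_trans sj _; rewrite time_le // jl ltnW.
Qed.

Lemma bent_path_linear (cs : nat -> R[i]) :
  (forall l, (l < L)%N -> t l < t l.+1) ->
  piecewise_linear (mkseq t L) [seq - z.2 | z <- mkseq (fun l => (cs l, m l)) L.+1]
    (bent_path L m t y).
Proof.
move=> tS; split.
- apply/(sortedP 0) => i; rewrite size_mkseq => iL.
  by rewrite !nth_mkseq ?(ltnW iL) // tS // ltnW.
- apply/allP => _ /mapP[l + ->]; rewrite mem_iota /= => lL.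
  by rewrite -time_L; apply: lt_le_trans (tS _ lL) _; rewrite time_le // lL leqnn.
- by rewrite size_map !size_mkseq.
move=> j s s'; rewrite size_map size_mkseq ltnS => jL hs hs'.
rewrite !(bent_path_domain jL) // (nth_map (0, 0)) ?size_mkseq // nth_mkseq //=.
by apply/rowP => k; rewrite !mxE; ring.
Qed.

(** Compactness only concerns the unbounded domain, where the velocity [- m 0] is
    nonzero. *)
Lemma bent_path_proper : m 0 != 0 -> forall K : set M, compact K ->
  compact [set s | s <= 0 /\ K (bent_path L m t y s)].
Proof.
move=> m0 K cK.
have [C0 [_ hC0]] := compact_bounded cK.
have hC : forall z, K z -> `|z| <= C0 + 1 by apply: hC0; rewrite ltrDl.
set C := C0 + 1 in hC.
pose E := `|t 0%N| + (C + `|B 0%N|) / `|m 0%N|.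
refine (subclosed_compact (B := `[- E, 0]%classic) _ (@segment_compact _ _ _) _);
  last first.
- move=> s [s0 Ks]; rewrite /= in_itv /= s0 andbT lerNl.
  have [ts|st] := leP (t 0%N) s.
    apply: le_trans (_ : `|t 0%N| <= _).
      by rewrite ler0_norm ?lerN2 // (le_trans ts).
    rewrite lerDl divr_ge0 // addr_ge0 //.
    exact: le_trans (normr_ge0 _) (hC _ Ks).
  have E0 : bent_path L m t y s = B 0%N - s *: m 0%N.
    apply: (bent_pathE hc) => // l /andP[_ lL].
    by apply: le_trans (ltW st) _; rewrite time_le //= ltnW.
  rewrite -[leLHS](mulfK (_ : `|m 0%N| != 0)) ?normr_eq0 //.
  apply: le_trans (_ : (C + `|B 0%N|) / `|m 0%N| <= _); last by rewrite lerDr.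
  rewrite ler_pM2r ?invr_gt0 ?normr_gt0 //.
  rewrite (_ : - s * `|m 0%N| = `|bent_path L m t y s - B 0%N|); last first.
    by rewrite E0 addrAC subrr add0r normrN normrZ ler0_norm.
  by apply: le_trans (ler_normB _ _) _; rewrite lerD2r; exact: hC.
- have -> : [set s | s <= 0 /\ K (bent_path L m t y s)] =
      [set s | s <= 0] `&` bent_path L m t y @^-1` K by [].
  apply: closedI; first exact: closed_le.
  apply: closed_comp; first by move=> s _; exact: bent_path_continuous.
  by apply: compact_closed => //; exact: norm_hausdorff.
Qed.

End BentPath.

Section Degenerate.
Variables (R : realType) (I : finType).
Local Notation M := (dual_space R I).

(** The breaks are the distinct negative bending times: the jumps of colliding
    bends add up, and bends at time [0] do not change the path. *)
Lemma bent_path_piecewise (L : nat) (m : nat -> M) (t : nat -> R) (y : M) :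
  (forall l, (l < L)%N -> t l <= 0) ->
  exists ts vs, piecewise_linear ts vs (bent_path L m t y).
Proof.
move=> t0; pose r := undup [seq x <- mkseq t L | x < 0].
pose ts := sort <=%O r.
have tsr x : x \in ts = (x \in mkseq t L) && (x < 0).
  by rewrite mem_sort mem_undup mem_filter andbC.
have ts_sorted : sorted <%O ts.
  by rewrite lt_sorted_uniq_le sort_uniq undup_uniq sort_le_sorted.
have ts0 j : ts`_j <= 0.
  have [js|sj] := ltnP j (size ts); last by rewrite nth_default.
  by have := mem_nth 0 js; rewrite tsr => /andP[_ /ltW].
pose v j := - m L + \sum_(l < L | ts`_j <= t l) (m l.+1 - m l).
exists ts, (mkseq v (size ts).+1); split=> //.
- by apply/allP => x; rewrite tsr => /andP[].
- by rewrite size_mkseq.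
move=> j; suff main s : in_domain ts j s -> bent_path L m t y s =
    y + s *: v j - \sum_(l < L | ts`_j <= t l) t l *: (m l.+1 - m l).
  move=> s s'; rewrite size_mkseq => jL /main -> /main ->; rewrite nth_mkseq //.
  by apply/rowP => k; rewrite !mxE; ring.
move=> /andP[h1 h2].
pose hi (l : 'I_L) := ts`_j <= t l.
suff -> : bent_path L m t y s = y - s *: m L +
    (s *: (\sum_(l < L | hi l) (m l.+1 - m l)) - \sum_(l < L | hi l) t l *: (m l.+1 - m l)).
  by rewrite /v -/hi; move: (\sum_(l < L | _) _) (\sum_(l < L | _) _) => u w;
    apply/rowP => k; rewrite !mxE; ring.
rewrite /bent_path scaler_sumr; congr (_ + _).
rewrite -sumrB /hi (bigID (fun l : 'I_L => ts`_j <= t l)) /= [X in _ + X]big1 ?addr0.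
  by apply: eq_bigr => l hl; rewrite min_l ?scalerBl // subr_le0 (le_trans h2).
move=> l; rewrite -ltNge => lt; rewrite min_r ?scale0r // subr_ge0.
have tl : t l \in ts.
  by rewrite tsr (lt_le_trans lt (ts0 j)) andbT; apply/mapP; exists (val l); rewrite ?mem_iota /=.
have hom i k : (i <= k < size ts)%N -> ts`_i <= ts`_k.
  move=> /andP[ik ks]; have les : sorted <=%O ts by exact: sort_le_sorted.
  by apply: (sorted_leq_nth le_trans le_refl 0 les) => //; exact: leq_ltn_trans ik ks.
have tlE : ts`_(index (t l) ts) = t l by exact: nth_index.
have ij : (index (t l) ts < j)%N.
  rewrite ltnNge; apply/negP => ji.
  suff : ts`_j <= t l by rewrite leNgt lt.
  by rewrite -tlE hom // ji index_mem.
case: j {v h2 lt hi} ij h1 => // j; rewrite ltnS /= => ij; apply: le_trans.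
have [js|sj] := ltnP j (size ts); last by rewrite [leRHS]nth_default // t0.
by rewrite -tlE hom // ij js.
Qed.

End Degenerate.

Section GenericLine.
Variables (R : realType) (I : finType) (F : fixed_data I).
Variable sigma : set (dual_space R I).
Variables (W : choiceType) (D : W -> wall R I).
Local Notation N := (lattice I).
Local Notation M := (dual_space R I).

Definition bent_line (L : nat) (m : nat -> M) (t : nat -> R) (v : nat -> R[i]) (y : M) :
    generic_line R I :=
  GenericLine (bent_path L m t y) (mkseq t L)
    (mkseq (fun l => (\prod_(i < l) v i, m l)) L.+1).

Lemma bent_line_generic L nv m t B y v :
  config L nv m t B y -> (forall l, (l < L)%N -> t l < t l.+1) ->
  Mo F (m 0%N) -> m 0%N != 0 -> (forall l, (l < L)%N -> m l != m l.+1) ->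
  (forall s, s <= 0 -> ~ Sing D (bent_path L m t y s)) -> ~ Supp D y ->
  (forall l, (l < L)%N -> Supp D (B l - t l *: m l)) ->
  (forall l, (l < L)%N -> v l != 0 /\
    exists2 g, is_crossing_factor F sigma D (B l - t l *: m l) (- m l) (m l) g &
      g (m l.+1 - m l) = v l) ->
  is_generic_line F sigma D (bent_line L m t v y).
Proof.
move=> hc tS mM m0 mS hS hy hsup hv.
have tW l : (l < L)%N -> t l <= t l.+1 by move=> /tS/ltW.
have y0 : bent_path L m t y 0 = y.
  rewrite (@bent_path_domain _ _ _ _ _ _ _ _ hc tW L) ?scale0r ?subr0 //.
    by case: hc.
  rewrite /in_domain (nth_times hc (leqnn L)) (time_L hc) lexx andbT.
  case: (L) hc tW {tS mS hS hsup hv} => //= L' hc tW.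
  rewrite nth_mkseq // -[leRHS](time_L hc); exact: tW.
split.
- split.
  + by rewrite /initial_exponent /expo nth_mkseq.
  + by rewrite /initial_exponent /expo nth_mkseq.
  + by rewrite /coef nth_mkseq //= big_ord0.
- split=> //.
  + by apply: continuous_subspaceT => s; exact: bent_path_continuous.
  + exact: (bent_path_proper hc tW).
  + by rewrite [bent_line _ _ _ _ _ _]y0.
- exact: (bent_path_linear hc tW).
move=> l; rewrite size_mkseq => lL.
rewrite [gtimes _]/= nth_mkseq // [gpath _]/= (bent_path_bend hc tW) //.
rewrite /expo /coef !nth_mkseq //=; try by rewrite ltnW.
have [v0 [g hg gE]] := hv l lL.
split; [exact: hsup|exact: mS|].
exists g; split=> //; first by rewrite big_ord_recr gE.
apply/prodf_neq0 => i _.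
by have [] := hv i (leq_trans (ltn_ord i) lL).
Qed.

End GenericLine.

(** * Avoiding the singular locus *)

Section GeneralPosition.
Variables (R : realType) (I : finType) (F : fixed_data I) (e : seed F).
Local Notation N := (lattice I).
Local Notation M := (dual_space R I).

Lemma vspace_col (U : {vspace M}) : (\dim U < #|I|)%N ->
  exists2 c : 'cV[R]_#|I|, c != 0 & forall x, x \in U -> lform c x = 0.
Proof.
move=> dU.
pose A : 'M[R]_(\dim U, #|I|) := \matrix_(i < \dim U) (vbasis U)`_i.
have A0 : cokermx A != 0.
  rewrite -mxrank_eq0 mxrank_coker -lt0n subn_gt0.
  exact: leq_ltn_trans (rank_leq_row A) dU.
have [j cj] : exists j, col j (cokermx A) != 0.
  apply: contrapT => /forallNP h; case/eqP: A0; apply/matrixP => i j.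
  have /negP := h j; rewrite negbK => /eqP/matrixP/(_ i 0).
  by rewrite !mxE.
exists (col j (cokermx A)) => // x xU.
rewrite (coord_vbasis xU) /lform mulmx_suml summxE big1 // => i _.
rewrite -scalemxAl mxE (_ : (vbasis U)`_i = row i A); last by rewrite rowK.
rewrite -row_mul -[col j _]mulmx1 colE mulmx1 mulmxA mulmx_coker mul0mx row0.
by rewrite mxE mulr0.
Qed.

(** A hyperplane that contains [V] and [x0]. *)
Lemma codim2_col (V : {vspace M}) (x0 : M) : (\dim V + 2)%N = #|I| ->
  exists2 c : 'cV[R]_#|I|, c != 0 &
    lform c x0 = 0 /\ forall x, x \in V -> lform c x = 0.
Proof.
move=> dV; have [|c c0 hc] := @vspace_col (V + <[x0]>)%VS.
  apply: leq_ltn_trans (dimv_add_leqif _ _).1 _.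
  have d1 : (\dim <[x0]> <= 1)%N by rewrite dim_vline; case: (_ == _).
  by move: (\dim <[x0]>) (\dim V) dV d1 => k l; lia.
exists c => //; split=> [|x xV]; apply: hc.
  by apply: (subvP (addvSr _ _)); exact: memv_line.
by apply: (subvP (addvSl _ _)).
Qed.

Variables (W : choiceType) (D : W -> wall R I).
Hypothesis hwall : forall w, is_wall e (D w).

Lemma parallel_perp (n n' : N) (y : M) : n != 0 -> parallel n n' ->
  perp n y -> pairing n' y = 0.
Proof.
move=> /eqP/rowP/existsNP[i /eqP]; rewrite [X in _ != X]mxE => ni par hy.
have nR : (n 0 i)%:~R != 0 :> R by rewrite intr_eq0.
apply: (mulfI nR); rewrite mulr0 mulr_sumr.
transitivity ((n' 0 i)%:~R * pairing n y); last by rewrite hy mulr0.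
rewrite mulr_sumr; apply: eq_bigr => j _.
have E : (n 0 i)%:~R * (n' 0 j)%:~R = (n' 0 i)%:~R * (n 0 j)%:~R :> R.
  by rewrite -!intrM par mulrC.
by rewrite [LHS]mulrA [RHS]mulrA; congr (_ * _); exact: E.
Qed.

Lemma wnormal_neq0 w : wnormal (D w) != 0.
Proof.
have [[a -> a0] _ _ _ _] := hwall w; exact: (uf_comb_neq0 e a0).
Qed.

Lemma near_pairing_ge0 (n : N) (x : M) (ns : seq N) :
  (forall nu, nu \in ns -> 0 < pairing nu x \/ (forall y : M, perp n y -> pairing nu y = 0)) ->
  \forall y \near within (perp n) (nbhs x), forall nu, nu \in ns -> 0 <= pairing nu y.
Proof.
elim: ns => [|nu ns IH] h; first exact: nearW.
have h1 : \forall y \near within (perp n) (nbhs x), 0 <= pairing nu y.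
  have [|pos|van] := h nu; first by rewrite inE eqxx.
    apply: cvg_within.
    have c : lform (ncol R nu) y @[y --> x] --> lform (ncol R nu) x.
      exact: (@lform_cvg R _ M (nbhs x) id x (ncol R nu) _ cvg_id).
    have : 0 < lform (ncol R nu) x by rewrite /lform -pairingE.
    move=> h0; apply: filterS (cvgr_gt _ c _ h0) => y.
    by rewrite /lform -pairingE => /ltW.
  by near=> y; rewrite van //; near: y; exact: withinT.
have h2 := IH (fun mu hmu => h mu (mem_behead (s := nu :: ns) hmu)).
apply: filterS2 h1 h2 => y y1 y2 mu; rewrite inE => /predU1P[->//|]; exact: y2.
Unshelve. all: by end_near. Qed.

(** Inequalities that are strict at a point, or that vanish on the hyperplane of
    the wall, hold nearby; so some other inequality is an equality on the
    boundary. *)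
Lemma wall_boundary_codim2 w x : wall_boundary (D w) x ->
  exists2 nu, ~ parallel (wnormal (D w)) nu & pairing nu x = 0.
Proof.
move=> [wx nx]; apply: contrapT => h; apply: nx.
have [_ [[ns wE] _] _ _ _] := hwall w.
rewrite wE; apply: near_pairing_ge0 => nu hnu.
have : 0 <= pairing nu x by move: wx; rewrite wE; apply.
rewrite le_eqVlt eq_sym => /predU1P[nx0|]; last by left.
right=> y; apply: parallel_perp; first exact: wnormal_neq0.
by apply: contrapT => np; apply: h; exists nu.
Qed.

(** The boundary of a wall lies in its faces. If two walls meet in codimension
    two away from their boundaries, they are not parallel, since otherwise the
    intersection would fill a neighbourhood in their hyperplane. *)
Lemma Sing_codim2 x : Sing D x -> exists n n' : N,
  [/\ ~ parallel n n', perp n x & perp n' x].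
Proof.
have bd w : wall_boundary (D w) x -> exists n n' : N,
    [/\ ~ parallel n n', perp n x & perp n' x].
  move=> hw; have [nu np nx] := wall_boundary_codim2 hw.
  exists (wnormal (D w)), nu; split=> //; case: hw => hw _.
  exact: (wall_cone_perp hwall).
case=> [[w /bd //]|[w1 [w2 [[V [inV _] dV] [h1 h2]]]]].
have [/bd//|b1] := pselect (wall_boundary (D w1) x).
have [/bd//|b2] := pselect (wall_boundary (D w2) x).
exists (wnormal (D w1)), (wnormal (D w2)).
split; [|exact: (wall_cone_perp hwall)..].
move=> par.
have near1 : \forall z \near within (perp (wnormal (D w1))) (nbhs x), wcone (D w1) z.
  by apply: contrapT => h; apply: b1.
have near2 : \forall z \near within (perp (wnormal (D w2))) (nbhs x), wcone (D w2) z.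
  by apply: contrapT => h; apply: b2.
have [p1 p2] := (wall_cone_perp hwall h1, wall_cone_perp hwall h2).
have sub (y : M) : perp (wnormal (D w1)) y -> y \in V.
  move=> y1; have y2 : perp (wnormal (D w2)) y.
    exact: (parallel_perp (wnormal_neq0 w1) par).
  have n1 := near_perp_line near1 p1 y1.
  have n2 := near_perp_line near2 p2 y2.
  near (0 : R)^'+ => t.
  have t0 : t != 0 by apply: lt0r_neq0; near: t; apply: nbhs_right_gt.
  have : x + t *: y \in V.
    apply: inV; split; near: t.
      exact: (@cvg_within _ (nbhs (0 : R)) _ _ _ n1).
    exact: (@cvg_within _ (nbhs (0 : R)) _ _ _ n2).
  have xV : x \in V by exact: inV.
  by rewrite rpredDl // rpredZeq (negPf t0).
have [v nv] : exists v : M, pairing (wnormal (D w1)) v != 0.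
  have /eqP/rowP/existsNP[i /eqP] := wnormal_neq0 w1.
  rewrite [X in _ != X]mxE => ni; exists (delta_mx 0 i).
  by rewrite pairingE -rowE !mxE intr_eq0.
have [c c0 [cv cV]] := codim2_col v dV.
case/eqP: c0; apply/colP => i; rewrite [RHS]mxE.
have -> : c i 0 = lform c (delta_mx 0 i) by rewrite /lform -rowE mxE.
set u := delta_mx 0 i.
pose r := pairing (wnormal (D w1)) u / pairing (wnormal (D w1)) v.
rewrite -[u](subrK (r *: v)) lformD lformZ cv mulr0 addr0; apply: cV; apply: sub.
by rewrite /perp /= pairingB pairingZ divfK ?subrr.
Unshelve. all: by end_near. Qed.

Section Avoid.
Variables (L : nat) (nv : nat -> N) (m : nat -> M).
Hypothesis tr : transverse L nv m.

(** A subspace of codimension two and the direction of a domain span at most a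
    hyperplane; transported to the end of the path by the invertible [line_mx],
    countably many hyperplanes must be avoided, since [N] is countable. *)
Lemma generic_end (e0 e1 : M) (eps : R) : 0 < eps ->
  exists2 s, 0 < s < eps & ~ Supp D (curve e0 e1 s) /\
    forall l r, (l <= L)%N ->
      ~ Sing D (curve e0 e1 s *m line_mx L nv m l - r *: m l).
Proof.
have /choice[col hcol] : forall z : (N * N) * nat, exists c : 'cV[R]_#|I|,
    ~ parallel z.1.1 z.1.2 -> c != 0 /\ lform c (m z.2) = 0 /\
    forall x, perp z.1.1 x -> perp z.1.2 x -> lform c x = 0.
  move=> [[n n'] l] /=.
  have [par|np] := pselect (parallel n n'); first by exists 0.
  have [V dV hV] := perp_pair_vspace R np.
  have [c c0 [cm cV]] := codim2_col (m l) dV.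
  by exists c => _; split=> //; split=> // x x1 x2; apply: cV; apply/hV.
pose f (z : (N * N) * nat + N) : 'cV[R]_#|I| :=
  match z with
  | inl z => line_mx L nv m z.2 *m col z
  | inr n => ncol R n
  end.
pose P (z : (N * N) * nat + N) :=
  match z with
  | inl z => (z.2 <= L)%N /\ ~ parallel z.1.1 z.1.2
  | inr n => n != 0
  end.
move=> eps0.
have [|c [[z [zL np]|n n0] <-]|s hs avoid] :=
    @curve_avoids R _ e0 e1 [set f z | z in P] _ _ eps eps0.
- by apply: (sub_countable (card_image_le _ _)); exact: countableP.
- have [c0 _] := hcol z np.
  apply: contra_neq c0 => /(congr1 (mulmx (invmx (line_mx L nv m z.2)))).
  by rewrite mulmxA mulVmx ?mul1mx ?mulmx0 // unit_line_mx.
- apply: contra_neq n0 => n0; apply/rowP => i.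
  by have /colP/(_ i) := n0; rewrite !mxE => /eqP; rewrite intr_eq0 => /eqP ->.
exists s => //; split=> [[w _ /(wall_cone_perp hwall)]|l r lL /Sing_codim2].
  rewrite /perp /= pairingE => h.
  have := avoid (ncol R (wnormal (D w))); rewrite /lform h eqxx => h1.
  suff /h1 : [set f z | z in P] (ncol R (wnormal (D w))) by [].
  by exists (inr (wnormal (D w))) => //=; exact: wnormal_neq0.
move=> [n [n' [np x1 x2]]].
have [_ [cm cV]] := hcol ((n, n'), l) np.
have := avoid (line_mx L nv m l *m col ((n, n'), l)).
have := cV _ x1 x2; rewrite -scaleNr lformD lformZ cm mulr0 addr0.
rewrite /lform mulmxA => ->; rewrite eqxx => h1.
suff /h1 : [set f z | z in P] (line_mx L nv m l *m col ((n, n'), l)) by [].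
by exists (inl ((n, n'), l)).
Qed.

End Avoid.

End GeneralPosition.

(** * Broken lines from degenerate limits *)

Lemma near_seq (T : Type) (G : set_system T) (E : eqType) (s : seq E) (Q : E -> T -> Prop) :
  Filter G -> (forall x, x \in s -> \forall t \near G, Q x t) ->
  \forall t \near G, forall x, x \in s -> Q x t.
Proof.
move=> FG; elim: s => [|x s IH] h; first exact: nearW.
have h1 : \forall t \near G, Q x t by apply: h; rewrite inE eqxx.
have h2 := IH (fun z hz => h z (mem_behead (s := x :: s) hz)).
by apply: filterS2 h1 h2 => t t1 t2 z; rewrite inE => /predU1P[->//|]; exact: t2.
Qed.

Lemma near_nat (T : Type) (G : set_system T) L (Q : nat -> T -> Prop) :
  Filter G -> (forall l, (l < L)%N -> \forall t \near G, Q l t) ->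
  \forall t \near G, forall l, (l < L)%N -> Q l t.
Proof.
move=> FG h.
have h' : forall l, l \in iota 0 L -> \forall t \near G, Q l t.
  by move=> l; rewrite mem_iota => /h.
apply: filterS (@near_seq _ _ _ (iota 0 L) Q FG h') => t ht l lL.
by apply: ht; rewrite mem_iota.
Qed.

Lemma infinitely_often (E : finType) (f : nat -> E) :
  exists v, forall k, exists2 k', (k <= k')%N & f k' = v.
Proof.
apply: contrapT => /forallNP h.
have /choice[b hb] : forall v, exists k, forall k', (k <= k')%N -> f k' <> v.
  move=> v; have /existsNP[k hk] := h v; exists k => k' kk E0.
  by apply: hk; exists k'.
by apply: (hb (f (\max_v b v)%N) _ _ erefl); exact: leq_bigmax.
Qed.

Section Construction.
Variables (R : realType) (I : finType) (F : fixed_data I) (e : seed F).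
Variable sigma : set (dual_space R I).
Hypothesis sigma_cone : rational_polyhedral_cone sigma.
Hypothesis sigma_strict : strictly_convex sigma.
Variables (W : choiceType) (D : W -> wall R I).
Hypothesis hwall : forall w, is_wall e (D w).
Hypothesis hfin : forall k, finite_set (nontrivial_mod F sigma D k).
Local Notation N := (lattice I).
Local Notation M := (dual_space R I).
Local Notation P := (Pmon F sigma).
Local Notation J := (Jpow F sigma).
Local Notation NT := (nontrivial_mod F sigma D).
Local Notation factor_mod := (crossing_factor_mod F sigma D).

Variables (L : nat) (m : nat -> M) (nv : nat -> N) (S : nat -> seq W) (e0 e1 : M).
Local Notation line := (line_mx L nv m).
Local Notation time := (time_col L nv m).
Local Notation pt := (point_mx L nv m).
Local Notation d l := (m l.+1 - m l).

Hypothesis tr : transverse L nv m.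
Hypothesis mM : Mo F (m 0%N).
Hypothesis m0 : m 0%N != 0.
Hypothesis mS : forall l, (l < L)%N -> m l != m l.+1.
Hypothesis dP : forall l, (l < L)%N -> P (d l).
Hypothesis nvS : forall l, (l < L)%N -> exists2 w, w \in S l & wnormal (D w) = nv l.
Hypothesis bend : forall l x, (l < L)%N -> ~ Sing D x ->
  (forall w, w \in S l -> wcone (D w) x) ->
  exists2 g, is_crossing_factor F sigma D x (- m l) (m l) g & g (d l) != 0.
Hypothesis order : forall l, (l < L)%N ->
  lex_pos (lform (time l.+1 - time l) e0) (lform (time l.+1 - time l) e1).
Hypothesis cones : forall l w, (l < L)%N -> w \in S l -> exists2 ns : seq N,
  wcone (D w) = [set x | forall n, n \in ns -> 0 <= pairing n x] &
  forall nu, nu \in ns -> (forall y : M, perp (nv l) y -> pairing nu y = 0) \/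
    lex_pos (pairing nu (e0 *m pt l)) (pairing nu (e1 *m pt l)).

Local Notation C s := (curve e0 e1 s).

Let good s := (forall l, (l < L)%N -> lform (time l) (C s) < lform (time l.+1) (C s)) /\
  forall l, (l < L)%N -> forall w, w \in S l -> wcone (D w) (C s *m pt l).

Lemma lformBc (c c' : 'cV[R]_#|I|) (x : M) : lform (c - c') x = lform c x - lform c' x.
Proof. by rewrite /lform mulmxBr !mxE. Qed.

Lemma lform_mul (A : 'M[R]_#|I|) n (x : M) : lform (A *m ncol R n) x = pairing n (x *m A).
Proof. by rewrite /lform mulmxA pairingE. Qed.

Lemma perp_point l (x : M) : (l < L)%N -> perp (nv l) (x *m pt l).
Proof.
move=> lL; have [_ _ h] := config_sol tr x.
by have [_ h2] := h l lL; rewrite /perp /= mul_point_mx.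
Qed.

Let near_good : \forall s \near (0 : R)^'+, good s.
Proof.
have h1 : \forall s \near (0 : R)^'+, forall l, (l < L)%N ->
    lform (time l) (C s) < lform (time l.+1) (C s).
  apply: near_nat => l lL; have := curve_pos (order lL).
  by apply: filterS => s; rewrite lformBc subr_gt0.
have h2 : \forall s \near (0 : R)^'+, forall l, (l < L)%N ->
    forall w, w \in S l -> wcone (D w) (C s *m pt l).
  apply: near_nat => l lL; apply: near_seq => w wS.
  have [ns wE hns] := cones lL wS.
  have : \forall s \near (0 : R)^'+, forall nu, nu \in ns -> 0 <= pairing nu (C s *m pt l).
    apply: near_seq => nu hnu; have [van|lp] := hns nu hnu.
      by apply: nearW => s; rewrite van //; exact: perp_point.
    move: lp; rewrite -!lform_mul => /curve_pos; apply: filterS => s.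
    by rewrite lform_mul => /ltW.
  by apply: filterS => s h; rewrite wE.
by apply: filterS2 h1 h2 => s.
Qed.

Let generic s := [/\ good s, ~ Supp D (C s) &
  forall l r, (l <= L)%N -> ~ Sing D (C s *m line l - r *: m l)].

Lemma exists_generic k : exists2 s, 0 < s < k.+1%:R^-1 & generic s.
Proof.
have /nbhs_ballP[eps /= eps0 heps] := near_good.
have k0 : (0 : R) < k.+1%:R^-1 by rewrite invr_gt0.
have [|s /andP[s0 sm] [s1 s2]] := @generic_end R I F e W D hwall L nv m tr e0 e1
    (Num.min eps k.+1%:R^-1).
  by rewrite lt_min eps0 k0.
move: sm; rewrite lt_min => /andP[se sk].
exists s; first by rewrite s0.
split=> //; apply: heps => //=; by rewrite -ball_normE /= sub0r normrN gtr0_norm.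
Qed.

Lemma exists_precision : exists K, forall l, (l < L)%N -> ~ J K (d l).
Proof.
have /choice[b hb] : forall l, exists k, (l < L)%N -> ~ J k (d l).
  move=> l; have [lL|Ll] := ltnP l L; last by exists 0%N.
  by have [k hk] := Jpow_separated e sigma_cone sigma_strict (dP lL); exists k.
exists (\max_(l < L) b l)%N => l lL h; apply: (hb l lL).
by apply: Jpow_anti h => //; exact: (leq_bigmax (Ordinal lL)).
Qed.

(** The coefficient at a bend only depends on which of the finitely many walls
    that are nontrivial modulo a fixed [J^K] contain it. By the pigeonhole
    principle it is constant along a suitable sequence of deformations. *)
Lemma generic_sequence : exists (u : nat -> R) (v : nat -> R[i]),
  forall k, [/\ 0 < u k < k.+1%:R^-1, generic (u k) &
    forall l, (l < L)%N -> v l != 0 /\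
      exists2 g, is_crossing_factor F sigma D (C (u k) *m pt l) (- m l) (m l) g &
        g (d l) = v l].
Proof.
have [K hK] := exists_precision.
pose A := fset_set (NT K).
have /choice[s hs] : forall k, exists s, 0 < s < k.+1%:R^-1 /\ generic s.
  by move=> k; have [s] := exists_generic k; exists s.
(* The walls that count at each bend of the deformed line. *)
pose code s := [ffun l : 'I_L => [set w : A | `[< wcone (D (val w)) (C s *m pt l) >]]%SET].
have [v0 hv0] := infinitely_often (fun k => code (s k)).
have codeE s1 s2 l x v : (l < L)%N -> code s1 = code s2 ->
    factor_mod K (C s1 *m pt l) x v = factor_mod K (C s2 *m pt l) x v.
  move=> lL E; rewrite /crossing_factor_mod.
  suff -> : walls_at D (C s1 *m pt l) `&` NT K = walls_at D (C s2 *m pt l) `&` NT K by [].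
  apply/seteqP; suff sub a b : code a = code b ->
      walls_at D (C a *m pt l) `&` NT K `<=` walls_at D (C b *m pt l) `&` NT K.
    by split; apply: sub.
  move=> {}E w [w1 w2]; split=> //.
  have wA : w \in A by rewrite in_fset_set //; exact/mem_set.
  have /ffunP/(_ (Ordinal lL))/setP/(_ [` wA]%fset) := E.
  by rewrite !ffunE !inE /= => h; apply/asboolP; rewrite -h; apply/asboolP.
have /choice[u hu] : forall k, exists s', [/\ 0 < s' < k.+1%:R^-1, generic s' & code s' = v0].
  move=> k; have [k' kk kE] := hv0 k; exists (s k').
  have [/andP[s0 s1] sg] := hs k'; split=> //; rewrite s0 (lt_le_trans s1) //.
  by rewrite lef_pV2 ?posrE // ler_nat.
exists u, (fun l => factor_mod K (C (u 0%N) *m pt l) (- m l) (m l) (d l)) => k.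
have [uk gk ck] := hu k; split=> // l lL.
have [_ _ c0] := hu 0%N.
have [g hg gd] : exists2 g, is_crossing_factor F sigma D (C (u k) *m pt l) (- m l) (m l) g &
    g (d l) != 0.
  have [[_ hg] _ hS] := gk; apply: bend => //; last exact: hg.
  by rewrite mul_point_mx; apply: hS; exact: ltnW.
have gE : g (d l) = factor_mod K (C (u 0%N) *m pt l) (- m l) (m l) (d l).
  rewrite (crossing_factorE hg (dP lL) (hK _ lL)).
  by rewrite (@codeE (u k) (u 0%N)) // ck c0.
by rewrite -gE; split=> //; exists g.
Qed.

Let gamma := bent_path L m (fun l => lform (time l) e0) e0.

Let weak_order l : (l < L)%N -> lform (time l) e0 <= lform (time l.+1) e0.
Proof.
by move=> /order; rewrite lformBc => -[/ltW|[/eqP + _]]; rewrite ?subr_ge0 // subr_eq0 => /eqP ->.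
Qed.

Let weak_cones l w : (l < L)%N -> w \in S l -> wcone (D w) (e0 *m pt l).
Proof.
move=> lL wS; have [ns -> hns] := cones lL wS => nu /hns[van|[/ltW//|[-> _]//]].
by rewrite van //; exact: perp_point.
Qed.

Lemma line_generic s v : generic s ->
  (forall l, (l < L)%N -> v l != 0 /\
      exists2 g, is_crossing_factor F sigma D (C s *m pt l) (- m l) (m l) g &
        g (d l) = v l) ->
  is_generic_line F sigma D (bent_line L m (fun l => lform (time l) (C s)) v (C s)).
Proof.
move=> [[gs1 gs2] gs3 gs4] hv.
have hc := config_sol tr (C s).
apply: (bent_line_generic hc) => //.
- move=> r r0; have [j jL ->] := bent_path_on_line hc (fun l lL => ltW (gs1 l lL)) r0.
  exact: gs4.
- move=> l lL; rewrite -mul_point_mx; have [w wS _] := nvS lL.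
  by exists w => //; exact: gs2 wS.
- by move=> l lL; rewrite -mul_point_mx; exact: hv.
Qed.

(** Bends that collide off the singular locus would be at parallel walls, and the
    line cannot come back to a hyperplane that it has crossed. If the last bend
    collided with the end of the line, then the end would be on a wall. *)
Lemma limit_strict : ~ Supp D e0 -> (forall s, s <= 0 -> ~ Sing D (gamma s)) ->
  forall l, (l < L)%N -> lform (time l) e0 < lform (time l.+1) e0.
Proof.
move=> nsup nsing l lL; rewrite lt_neqAle weak_order // andbT; apply/negP => /eqP tE.
have hc := config_sol tr e0; have [hL _ hB] := hc.
have [hBl _] := hB l lL.
have ptE : e0 *m pt l = e0 *m line l.+1 - lform (time l.+1) e0 *: m l.+1.
  rewrite mul_point_mx -tE -[line l.+1](subrK (line l)) mulmxDr mulmxBr hBl.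
  by apply/rowP => k; rewrite !mxE; ring.
have [w wS wn] := nvS lL; have wx := weak_cones lL wS.
have [lL'|Ll] := ltnP l.+1 L; last first.
  have E : l.+1 = L by apply/eqP; rewrite eqn_leq lL.
  apply: nsup; exists w => //; move: wx; rewrite ptE E line_mxL mulmx1.
  by have [_ -> _] := hc; rewrite scale0r subr0.
have [w' wS' wn'] := nvS lL'; have wx' := weak_cones lL' wS'.
have xE : e0 *m pt l.+1 = e0 *m pt l by rewrite ptE mul_point_mx.
rewrite xE in wx'.
have xS : ~ Sing D (e0 *m pt l).
  rewrite mul_point_mx -(bent_path_bend hc weak_order lL); apply: nsing.
  by have := time_le weak_order (i := l) (j := L); rewrite (ltnW lL) leqnn (time_L hc); apply.
have par := walls_parallel hwall xS wx' wx; rewrite wn wn' in par.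
(* In a deformation the line would leave the hyperplane at the first of the two
   bends and be in it again at the second. *)
have [s _ [[gs1 _] _ _]] := exists_generic 0.
have [_ _ hBs] := config_sol tr (C s); have [hBl' _] := hBs l lL.
have p1 := perp_point (C s) lL; have p2 := perp_point (C s) lL'.
have n0 : nv l.+1 != 0 by rewrite -wn' (wnormal_neq0 hwall).
have p3 := parallel_perp n0 par p2.
have [nm nd] := tr lL.
have : (lform (time l.+1) (C s) - lform (time l) (C s)) * pairing (nv l) (m l.+1) = 0.
  rewrite -pairingZ (_ : _ *: _ = C s *m pt l - C s *m pt l.+1); last first.
    rewrite !mul_point_mx; move: hBl'; move: (C s *m _) (C s *m _) => u z /eqP.
    rewrite subr_eq => /eqP ->.
    by apply/rowP => k; rewrite !mxE; ring.
  by rewrite pairingB p3 p1 subrr.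
move/eqP; rewrite mulf_eq0 subr_eq0 gt_eqF ?gs1 //=.
move: nd; rewrite pairingB => /eqP; rewrite subr_eq0 => /eqP ->.
by rewrite (negPf nm).
Qed.

(** The deformations are generic broken lines with the same exponents and
    coefficients that converge to the limit path. If this path is itself in
    general position, it has to be a generic broken line instead. *)
Lemma broken_line_from_limit : exists b : broken_line R I,
  is_broken_line F sigma D b /\ forall t, t <= 0 -> b t = gamma t.
Proof.
have hc := config_sol tr e0.
have g0 : gamma 0 = e0.
  rewrite /gamma (bent_pathE hc (leqnn L)) ?scale0r ?subr0 ?line_mxL ?mulmx1 //.
    move=> l lL; rewrite -(time_L hc).
    by apply: (time_le weak_order); rewrite (ltnW lL) leqnn.
  by move=> l /andP[/leq_ltn_trans h /h]; rewrite ltnn.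
have [[nsup nsing]|sg] := pselect (~ Supp D e0 /\ forall s, s <= 0 -> ~ Sing D (gamma s)).
  have st := limit_strict nsup nsing.
  have xS l : (l < L)%N -> ~ Sing D (e0 *m pt l).
    move=> lL; rewrite mul_point_mx -(bent_path_bend hc weak_order lL); apply: nsing.
    rewrite -(time_L hc); apply: (time_le weak_order); by rewrite (ltnW lL) leqnn.
  have /choice[v hv] : forall l, exists v, (l < L)%N -> v != 0 /\
      exists2 g, is_crossing_factor F sigma D (e0 *m pt l) (- m l) (m l) g & g (d l) = v.
    move=> l; have [lL|Ll] := ltnP l L; last by exists 0.
    have [g hg gd] := bend lL (xS l lL) (fun w => @weak_cones l w lL).
    by exists (g (d l)) => _; split=> //; exists g.
  pose g := bent_line L m (fun l => lform (time l) e0) v e0.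
  exists (BrokenLine gamma (fun=> g)); split=> //; left; exists g; split=> //.
  apply: (bent_line_generic hc) => //.
  - move=> l lL; rewrite -mul_point_mx; have [w wS _] := nvS lL.
    by exists w => //; exact: weak_cones wS.
  - by move=> l lL; rewrite -mul_point_mx; exact: hv.
have [u [v huv]] := generic_sequence.
pose g k := bent_line L m (fun l => lform (time l) (C (u k))) v (C (u k)).
exists (BrokenLine gamma g); split=> //; right; split.
- rewrite [BrokenLine _ _ _]g0.
  have [s|ns] := pselect (Supp D e0); first by left.
  right; apply: contrapT => h; apply: sg; split=> // s s0 hs.
  by apply: h; exists s.
- apply: bent_path_piecewise => l lL; rewrite -(time_L hc).
  by apply: (time_le weak_order); rewrite (ltnW lL) leqnn.
- move=> k; split=> //; have [_ gk vk] := huv k; exact: line_generic.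
- move=> l; rewrite size_mkseq => lL; have [w wS _] := nvS lL; exists w => k.
  have [_ [[gs1 gs2] _ _] _] := huv k.
  rewrite /bends_at [gtimes _]/= nth_mkseq // [gpath _]/=.
  rewrite (bent_path_bend (config_sol tr (C (u k))) _ lL) => [|j jL]; last exact/ltW/gs1.
  by rewrite -mul_point_mx; exact: gs2 wS.
move=> t t0; have cu : (fun k => C (u k)) @ \oo --> e0.
  apply: curve_cvg; apply: (@squeeze_cvgr _ _ _ _ (fun=> 0) harmonic).
  - by apply: nearW => k; have [/andP[/ltW -> /ltW ->] _ _] := huv k.
  - exact: cvg_cst.
  - exact: cvg_harmonic.
apply: (@bent_path_cvg R I L m _ _ (fun=> t) (fun l k => lform (time l) (C (u k)))
  (fun k => C (u k))) => //; first exact: cvg_cst.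
by move=> l lL; exact: lform_cvg.
Qed.

End Construction.

(** * The data of a broken line *)

Section LineData.
Variables (R : realType) (I : finType) (F : fixed_data I) (e : seed F).
Hypothesis p1_inj : p1_injective R F.
Variable sigma : set (dual_space R I).
Hypothesis sigma_cone : rational_polyhedral_cone sigma.
Hypothesis sigma_strict : strictly_convex sigma.
Hypothesis sigma_p1 : forall i, i \in uf F -> sigma (p1 R F (e i)).
Variables (W : choiceType) (D : W -> wall R I).
Hypothesis hwall : forall w, is_wall e (D w).
Hypothesis hfin : forall k, finite_set (nontrivial_mod F sigma D k).
Hypothesis hfun : forall w, exists2 c : nat, (0 < c)%N &
        wfun (D w) = spow F sigma (binomial_fun F (wnormal (D w))) c.
Local Notation N := (lattice I).
Local Notation M := (dual_space R I).
Local Notation P := (Pmon F sigma).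

Definition bends (L : nat) (m : nat -> M) (nv : nat -> N) (x : nat -> M) : Prop :=
  forall l, (l < L)%N -> [/\ ~ Sing D (x l),
    exists2 w, wcone (D w) (x l) & wnormal (D w) = nv l &
    exists2 g, is_crossing_factor F sigma D (x l) (- m l) (m l) g & g (m l.+1 - m l) != 0].

Lemma generic_line_config (g : generic_line R I) (nv : nat -> N) :
  is_generic_line F sigma D g ->
  (forall l, (l < size (gtimes g))%N ->
    exists2 w, bends_at D g l w & wnormal (D w) = nv l) ->
  let L := size (gtimes g) in
  let t l := (gtimes g)`_l in
  let B l := g (t l) + t l *: expo g l in
  [/\ config L nv (expo g) t B (g 0),
      forall l, (l < L)%N -> t l < t l.+1,
      bends L (expo g) nv (fun l => B l - t l *: expo g l) &
      forall l, (l < L)%N -> expo g l != expo g l.+1].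
Proof.
move=> [_ [_ _ hS _] [st neg sz lin] hb] hnv L t B.
have tL : t L = 0 by rewrite /t nth_default.
have szm : size (gmonos g) = L.+1 by rewrite -sz size_map.
have tS l : (l < L)%N -> t l < t l.+1.
  move=> lL; have [lL'|Ll] := ltnP l.+1 L; first exact: (sortedP 0 st).
  rewrite {2}/t nth_default //; have /allP := neg; apply; exact: mem_nth.
have tneg l : (l <= L)%N -> t l <= 0.
  rewrite leq_eqVlt => /predU1P[->|lL]; first by rewrite tL.
  by have /allP := neg; move=> /(_ _ (mem_nth 0 lL)) /ltW.
split=> //.
- split=> // [|l lL]; first by rewrite /B tL scale0r addr0.
  split; last first.
    rewrite /B addrK; have [w hw <-] := hnv l lL; exact: (wall_cone_perp hwall).
  have := lin l.+1 (t l.+1) (t l); rewrite sz !ltnS => /(_ lL).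
  rewrite /in_domain /= !(ltW (tS l lL)) !lexx => /(_ isT isT).
  rewrite (nth_map (0, 0)) ?szm // => E.
  rewrite /B /= E -/(expo g l.+1).
  by apply/rowP => k; rewrite !mxE; ring.
- move=> l lL; rewrite /B addrK; have [_ _ [f [hf -> c0]]] := hb l lL.
  split; [by apply: hS; apply: tneg; exact: ltnW|exact: hnv|exists f => //].
  by apply: contra_neq c0 => ->; rewrite mulr0.
- by move=> l lL; have [] := hb l lL.
Qed.

Lemma bends_data L m nv x : Mo F (m 0%N) -> bends L m nv x ->
  (forall l, (l < L)%N -> m l != m l.+1) ->
  [/\ forall l, (l <= L)%N -> Mo F (m l),
      transverse L nv m,
      forall l, (l < L)%N -> P (m l.+1 - m l) &
      forall l, (l < L)%N -> exists2 n0, n0 \in No F & exists2 r : R, r != 0 &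
        forall y : M, pairing n0 y = r * pairing (nv l) y].
Proof.
move=> m0 hb mS.
have dP l : (l < L)%N -> P (m l.+1 - m l).
  by move=> lL; have [_ _ [g hg gd]] := hb l lL; exact: (bend_P hg gd).
have mM l : (l <= L)%N -> Mo F (m l).
  elim: l => [//|l IH] lL; rewrite -[m l.+1](subrK (m l)).
  by apply: Mo_add; [have [] := dP l lL|apply: IH; exact: ltnW].
have bd l (lL : (l < L)%N) : [/\ pairing (nv l) (m l.+1 - m l) = 0,
    pairing (nv l) (m l) != 0 &
    exists2 n0, n0 \in No F & exists2 r : R, r != 0 &
    forall y : M, pairing n0 y = r * pairing (nv l) y].
  have [xS [w xw <-] [g hg gd]] := hb l lL.
  have d0 : m l.+1 - m l != 0 by rewrite subr_eq0 eq_sym mS.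
  exact: (bend_direction p1_inj sigma_cone sigma_strict sigma_p1 hwall hfin hfun
    xS xw (mM l (ltnW lL)) hg gd d0).
by split=> // l lL; have [] := bd l lL.
Qed.

(** The exponents and the hyperplanes of the bends are common to all the
    approximations. As the lines and the times then depend linearly on the end,
    the convergence of the ends controls the limit path. *)
Lemma broken_line_data (b : broken_line R I) : is_broken_line F sigma D b ->
  exists L m nv (t : nat -> nat -> R) (B : nat -> nat -> M),
  [/\ [/\ Iexp b = m 0%N, Fexp b = m L, Mo F (m 0%N) & m 0%N != 0],
      forall l, (l < L)%N -> m l != m l.+1,
      forall k, [/\ config L nv m (t k) (B k) (bapprox b k 0),
        forall l, (l < L)%N -> t k l < t k l.+1 &
        bends L m nv (fun l => B k l - t k l *: m l)],
      forall l, (l < L)%N -> exists2 w, wnormal (D w) = nv l &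
        forall k, wcone (D w) (B k l - t k l *: m l) &
      (fun k => bapprox b k 0) @ \oo --> b 0].
Proof.
move=> hb.
have [hg hbd hlim] : [/\ forall k, is_generic_line F sigma D (bapprox b k) /\
      gmonos (bapprox b k) = gmonos (bapprox b 0%N),
    forall j, (j < size (gtimes (bapprox b 0%N)))%N ->
        exists w, forall k, bends_at D (bapprox b k) j w &
    (fun k => bapprox b k 0) @ \oo --> b 0].
  case: hb => [[g [gg bg ba]]|[_ _ h1 h2 h3]]; last by split=> //; exact: h3.
  split.
  - by move=> k; rewrite !ba.
  - move=> j; rewrite ba => jL; have [_ _ _ /(_ j jL)[[w _ hw] _ _]] := gg.
    by exists w => k; rewrite ba.
  - under eq_fun do rewrite ba.
    by rewrite bg //; exact: cvg_cst.
pose L := (size (gmonos (bapprox b 0%N))).-1.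
have sz k : size (gtimes (bapprox b k)) = L.
  by have [[_ _ [_ _ + _] _] h] := hg k; rewrite /L -h size_map => ->.
have /choice[nv hnv] : forall l, exists n, (l < L)%N ->
    exists2 w, wnormal (D w) = n & forall k, bends_at D (bapprox b k) l w.
  move=> l; have [lL|Ll] := ltnP l L; last by exists 0.
  by have [|w hw] := hbd l; rewrite ?sz //; exists (wnormal (D w)) => _; exists w.
pose m := expo (bapprox b 0%N).
have mE k : expo (bapprox b k) = m by rewrite /m /expo; have [_ ->] := hg k.
pose t k l := (gtimes (bapprox b k))`_l.
pose B k l := bapprox b k (t k l) + t k l *: m l.
have hk k : [/\ config L nv m (t k) (B k) (bapprox b k 0),
    forall l, (l < L)%N -> t k l < t k l.+1,
    bends L m nv (fun l => B k l - t k l *: m l) &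
    forall l, (l < L)%N -> m l != m l.+1].
  have [hgk _] := hg k; have := @generic_line_config _ nv hgk.
  rewrite sz mE; apply => l lL; have [w <- hw] := hnv l lL.
  by exists w.
exists L, m, nv, t, B; split=> //.
- have [[[h1 h2 _] _ _ _] _] := hg 0%N; split=> //.
- by have [] := hk 0%N.
- by move=> k; have [] := hk k.
- by move=> l lL; have [w wn hw] := hnv l lL; exists w => // k; rewrite /B addrK; exact: hw.
Qed.

End LineData.

(** * Limits of generic lines *)

Section Limits.
Variables (R : realType) (I : finType) (F : fixed_data I) (e : seed F).
Variable sigma : set (dual_space R I).
Hypothesis sigma_cone : rational_polyhedral_cone sigma.
Hypothesis sigma_strict : strictly_convex sigma.
Variables (W : choiceType) (D : W -> wall R I).
Hypothesis hwall : forall w, is_wall e (D w).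
Hypothesis hfin : forall k, finite_set (nontrivial_mod F sigma D k).
Local Notation N := (lattice I).
Local Notation M := (dual_space R I).
Local Notation P := (Pmon F sigma).
Local Notation J := (Jpow F sigma).
Local Notation NT := (nontrivial_mod F sigma D).

(** A possibly degenerate line ending in [x0], given by [t] and [B], that is a
    limit of nondegenerate ones, such as the line given by [s] and [B'] that
    ends in [y]; the walls [S l] are those responsible for the [l]-th bend. *)
Record limit_line (L : nat) (m : nat -> M) (nv : nat -> N) (t : nat -> R) (B : nat -> M)
    (s : nat -> R) (B' : nat -> M) (S : nat -> seq W) (x0 y : M) : Prop := LimitLine {
  ll_tr : transverse L nv m;
  ll_config : config L nv m t B x0;
  ll_config' : config L nv m s B' y;
  ll_weak : forall l, (l < L)%N -> t l <= t l.+1;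
  ll_strict : forall l, (l < L)%N -> s l < s l.+1;
  ll_bends : bends F sigma D L m nv (fun l => B' l - s l *: m l);
  ll_normal : forall l, (l < L)%N -> exists2 w, w \in S l & wnormal (D w) = nv l;
  ll_walls : forall l w, (l < L)%N -> w \in S l ->
    wcone (D w) (B l - t l *: m l) /\ wcone (D w) (B' l - s l *: m l);
  ll_precision : exists K, forall l, (l < L)%N -> ~ J K (m l.+1 - m l) /\
    forall w, wcone (D w) (B' l - s l *: m l) -> NT K w -> w \in S l
}.

Lemma lform_limit_ge0 (c : 'cV[R]_#|I|) (u : nat -> M) (a : M) : u @ \oo --> a ->
  (forall n, 0 <= lform c (u n)) -> 0 <= lform c a.
Proof.
move=> ua h; rewrite leNgt; apply/negP => neg.
have hc : lform c (u n) @[n --> \oo] --> lform c a by exact: lform_cvg.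
have [n _ /(_ n (leqnn n))] := cvgr_lt _ hc _ neg.
by rewrite /= ltNge h.
Qed.

Section OneLine.
Variables (L : nat) (m : nat -> M) (nv : nat -> N) (t : nat -> nat -> R)
  (B : nat -> nat -> M) (y : nat -> M) (x0 : M) (K : nat).
Local Notation x k l := (B k l - t k l *: m l).
Hypothesis tr : transverse L nv m.
Hypothesis lines : forall k, [/\ config L nv m (t k) (B k) (y k),
  forall l, (l < L)%N -> t k l < t k l.+1 & bends F sigma D L m nv (fun l => x k l)].
Hypothesis common : forall l, (l < L)%N ->
  exists2 w, wnormal (D w) = nv l & forall k, wcone (D w) (x k l).
Hypothesis nJ : forall l, (l < L)%N -> ~ J K (m l.+1 - m l).
Hypothesis yx : y @ \oo --> x0.

Definition wall_code (k : nat) : {ffun 'I_L -> {set fset_set (NT K)}} :=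
  [ffun l : 'I_L => [set w : fset_set (NT K) | `[< wcone (D (val w)) (x k l) >]]%SET].

(** Times and points of bends are linear in the end of the line, so inequalities
    between times and the closed conditions of lying on walls pass to the
    limit. The walls that matter are the same for all [k] by assumption. *)
Lemma limit_of_lines k0 : (forall k, wall_code k = wall_code k0) ->
  exists t0 B0 S, limit_line L m nv t0 B0 (t k0) (B k0) S x0 (y k0).
Proof.
move=> hcode.
have /choice[S hS] : forall l, exists S : seq W, (l < L)%N ->
    [/\ exists2 w, w \in S & wnormal (D w) = nv l,
        forall w, w \in S -> forall k, wcone (D w) (x k l) &
        forall w, wcone (D w) (x k0 l) -> NT K w -> w \in S].
  move=> l; have [lL|Ll] := ltnP l L; last by exists [::].
  have [w0 w0n hw0] := common lL.
  pose s := [seq w <- fset_set (NT K) | `[< wcone (D w) (x k0 l) >]].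
  exists (w0 :: s) => _; split=> [|w|w wx wK].
  - by exists w0; rewrite ?mem_head.
  - rewrite inE => /predU1P[->//|]; rewrite mem_filter => /andP[/asboolP wx wK] k.
    have /ffunP/(_ (Ordinal lL))/setP/(_ [` wK]%fset) := hcode k.
    by rewrite !ffunE !inE /= => E; apply/asboolP; rewrite E; apply/asboolP.
  - rewrite inE mem_filter; apply/orP; right; apply/andP; split; first exact/asboolP.
    by rewrite in_fset_set //; exact/mem_set.
exists (fun l => lform (time_col L nv m l) x0), (fun l => x0 *m line_mx L nv m l), S.
have [hc0 st0 hb0] := lines k0.
split=> //.
- exact: config_sol.
- move=> l lL; rewrite -subr_ge0 -lformBc; apply: lform_limit_ge0 yx _ => k.
  have [hc st _] := lines k; rewrite lformBc subr_ge0.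
  have [_ <-] := config_unique tr hc lL; have [_ <-] := config_unique tr hc (ltnW lL).
  exact/ltW/st.
- by move=> l lL; have [] := hS l lL.
- move=> l w lL wS; have [_ hw _] := hS l lL; split; last exact: hw.
  have [_ [[ns wE] _] _ _ _] := hwall w.
  rewrite -mul_point_mx wE => nu hnu; rewrite -lform_mul.
  apply: lform_limit_ge0 yx _ => k; have [hc _ _] := lines k.
  rewrite lform_mul -(config_point tr hc (ltnW lL)).
  by have := hw w wS k; rewrite wE; apply.
- by exists K => l lL; split; [exact: nJ|have [] := hS l lL].
Qed.

End OneLine.

End Limits.

(** * Rescaling a broken line *)

Section LexPos.
Variable R : realType.
Implicit Types x y z : R.

Lemma lex_posD x0 x1 y0 y1 : lex_pos x0 x1 -> lex_pos y0 y1 ->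
  lex_pos (x0 + y0) (x1 + y1).
Proof.
move=> [hx|[-> hx]] [hy|[-> hy]]; rewrite /lex_pos ?add0r ?addr0.
- by left; apply: addr_gt0.
- by left.
- by left.
- by right; split=> //; apply: addr_gt0.
Qed.

Lemma lex_posM k x0 x1 : 0 < k -> lex_pos x0 x1 -> lex_pos (k * x0) (k * x1).
Proof.
move=> k0 [hx|[-> hx]]; first by left; apply: mulr_gt0.
by right; rewrite mulr0; split=> //; apply: mulr_gt0.
Qed.

End LexPos.

Section Half.
Variables (R : realType) (I : finType) (F : fixed_data I) (e : seed F).
Hypothesis p1_inj : p1_injective R F.
Variable sigma : set (dual_space R I).
Hypothesis sigma_cone : rational_polyhedral_cone sigma.
Hypothesis sigma_strict : strictly_convex sigma.
Hypothesis sigma_p1 : forall i, i \in uf F -> sigma (p1 R F (e i)).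
Variables (W : choiceType) (D : W -> wall R I).
Hypothesis hwall : forall w, is_wall e (D w).
Hypothesis hfin : forall k, finite_set (nontrivial_mod F sigma D k).
Hypothesis hfun : forall w, exists2 c : nat, (0 < c)%N &
        wfun (D w) = spow F sigma (binomial_fun F (wnormal (D w))) c.
Local Notation N := (lattice I).
Local Notation M := (dual_space R I).
Local Notation P := (Pmon F sigma).

Variables (L : nat) (m : nat -> M) (nv : nat -> N) (t : nat -> R) (B : nat -> M)
    (s : nat -> R) (B' : nat -> M) (S : nat -> seq W) (x0 y : M).
Hypothesis ll : limit_line F sigma D L m nv t B s B' S x0 y.
Local Notation d l := (m l.+1 - m l).
Local Notation x l := (B l - t l *: m l).
Local Notation x' l := (B' l - s l *: m l).

Variables a c : R.
Hypotheses (a0 : 0 < a) (c0 : 0 < c).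

(** The path [gamma(t) / (c - a t)] passes through the same walls, which are
    cones. Its derivative is [- twisted l / (c - a t) ^+ 2] on the [l]-th domain,
    so after a change of time it is a piecewise linear path of exponents
    [twisted l], bending [scale l] times as much as [gamma]. *)
Definition scale l : R := c - a * t l.
Definition twisted l : M := c *: m l - a *: B l.

Lemma ll_time_le0 l : (l <= L)%N -> t l <= 0.
Proof.
move=> lL; rewrite -(time_L (ll_config ll)).
by apply: (time_le (ll_weak ll)); rewrite lL leqnn.
Qed.

Lemma scale_ge l : (l <= L)%N -> c <= scale l.
Proof.
by move=> lL; rewrite /scale lerDl oppr_ge0 mulr_ge0_le0 ?ll_time_le0 // ltW.
Qed.

Lemma scale_gt0 l : (l <= L)%N -> 0 < scale l.
Proof. by move=> lL; apply: lt_le_trans c0 (scale_ge lL). Qed.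

Lemma scaleL : scale L = c.
Proof. by rewrite /scale (time_L (ll_config ll)) mulr0 subr0. Qed.

Lemma twistedL : twisted L = c *: m L - a *: x0.
Proof. by rewrite /twisted; have [-> _ _] := ll_config ll. Qed.

Lemma twistedS l : (l < L)%N -> twisted l.+1 - twisted l = scale l *: d l.
Proof.
move=> lL; have [_ _ h] := ll_config ll; have [E _] := h l lL.
rewrite /twisted /scale -[B l.+1](subrK (B l)) E.
by apply/rowP => k; rewrite !mxE; ring.
Qed.

Lemma twisted_normal l : (l < L)%N ->
  pairing (nv l) (twisted l) = scale l * pairing (nv l) (m l) /\
  pairing (nv l) (twisted l.+1) = scale l * pairing (nv l) (m l).
Proof.
move=> lL; have [_ _ h] := ll_config ll; have [_] := h l lL.
rewrite pairingB pairingZ => /eqP; rewrite subr_eq0 => /eqP E.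
have E1 : pairing (nv l) (twisted l) = scale l * pairing (nv l) (m l).
  by rewrite /twisted /scale pairingB !pairingZ E; ring.
split=> //; rewrite -[twisted l.+1](subrK (twisted l)) twistedS // pairingD E1.
have [_ nd] := ll_tr ll lL.
by rewrite pairingZ nd mulr0 add0r.
Qed.

(** If two bends collide in the limit, the times [s l] decide their order. *)
Lemma scale_lex l : (l < L)%N ->
  lex_pos ((scale l.+1)^-1 - (scale l)^-1)
    (a * (s l.+1 - t l.+1) / scale l.+1 - a * (s l - t l) / scale l).
Proof.
move=> lL; have s1 := scale_gt0 lL; have s0 := scale_gt0 (ltnW lL).
have := ll_weak ll lL; rewrite le_eqVlt => /predU1P[tE|tlt]; last first.
  left; rewrite subr_gt0 ltf_pV2 ?posrE // /scale ltrD2l ltrN2.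
  by rewrite ltr_pM2l.
right; have E : scale l.+1 = scale l by rewrite /scale tE.
rewrite E subrr -tE -mulrBl; split=> //.
rewrite divr_gt0 // -mulrBr mulr_gt0 //.
have := ll_strict ll lL; lra.
Qed.

(** A point of the deformation is a positive combination of a bend of the limit
    line, which may be on the boundary of a wall, and of a bend of the nearby
    generic line, which is not. *)
Lemma cone_lex l w : (l < L)%N -> w \in S l -> exists2 ns : seq N,
  wcone (D w) = [set z | forall n, n \in ns -> 0 <= pairing n z] &
  forall nu, nu \in ns -> (forall z : M, perp (nv l) z -> pairing nu z = 0) \/
    lex_pos (pairing nu ((scale l)^-1 *: x l))
      (pairing nu ((a * (s l - t l) / scale l) *: x l + (x' l - x l))).
Proof.
move=> lL wS; have [_ [[ns wE] _] _ _ _] := hwall w; exists ns => // nu hnu.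
have [wx wx'] := ll_walls ll lL wS.
have [xS [w0 w0x w0n] _] := ll_bends ll lL.
have nx : 0 <= pairing nu (x l) by move: wx; rewrite wE; apply.
have nx' : 0 <= pairing nu (x' l) by move: wx'; rewrite wE; apply.
move: nx nx'; rewrite le_eqVlt => /predU1P[nx|nx]; last first.
  by move=> _; right; left; rewrite pairingZ mulr_gt0 // invr_gt0 scale_gt0 // ltnW.
rewrite le_eqVlt => /predU1P[nx'|nx']; last first.
  right; right; rewrite pairingZ -nx mulr0; split=> //.
  by rewrite pairingD pairingZ pairingB -nx mulr0 add0r subr0.
(* Both bends are on a face of the wall; as the generic one is not on its
   boundary, the inequality is trivial. *)
left => z hz; apply: (wall_face hwall xS wx' wE hnu (esym nx')).
have par := walls_parallel hwall xS w0x wx'.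
by apply: parallel_perp par _; rewrite ?w0n // -w0n; exact: wnormal_neq0 hwall _.
Qed.

Hypothesis mM : forall l, (l <= L)%N -> Mo F (m l).
Hypothesis mS : forall l, (l < L)%N -> m l != m l.+1.
Hypothesis dP : forall l, (l < L)%N -> P (d l).
Hypothesis n0 : forall l, (l < L)%N -> exists2 n0, n0 \in No F &
  exists2 r : R, r != 0 & forall z : M, pairing n0 z = r * pairing (nv l) z.

Lemma bend_robust l k (M' z : M) : (l < L)%N ->
  `|pairing (nv l) M'| = k%:R * `|pairing (nv l) (m l)| ->
  ~ Sing D z -> (forall w, w \in S l -> wcone (D w) z) ->
  exists2 g, is_crossing_factor F sigma D z (- M') M' g & g (d l *+ k) != 0.
Proof.
move=> lL hM zS hz.
have [xS _ [g1 hg1 gd]] := ll_bends ll lL.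
have [w wS wn] := ll_normal ll lL.
have [_ wx'] := ll_walls ll lL wS.
have [K hK] := ll_precision ll; have [nJ sub] := hK l lL.
have d0 : d l != 0 by rewrite subr_eq0 eq_sym mS.
apply: (bend_scales p1_inj sigma_cone sigma_strict sigma_p1 hwall hfin hfun
  xS wx' (mM (ltnW lL)) hg1 gd nJ zS (hz w wS)).
  by move=> v [v1 v2]; apply: hz; exact: sub.
by rewrite wn.
Qed.

Definition integral_multiple l k := Mo F (k%:R *: twisted l) /\
  ((l < L)%N -> exists2 j, (0 < j)%N & k%:R * scale l = j%:R).

Lemma integral_multipleM l k j : (0 < j)%N ->
  integral_multiple l k -> integral_multiple l (k * j)%N.
Proof.
move=> j0 [h1 h2]; split=> [|lL].
  by rewrite mulnC natrM -scalerA scaler_nat; exact: Mo_Mn.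
have [i i0 E] := h2 lL; exists (j * i)%N; first by rewrite muln_gt0 j0.
by rewrite mulnC !natrM -mulrA E.
Qed.

(** The scales are rational: [twisted l] is an integral combination of known
    exponents up to the factor [scale l], which is a ratio of pairings with
    a vector of [N°]. *)
Lemma twisted_rational : Mo F (c *: m L - a *: x0) ->
  exists2 k, (0 < k)%N & forall l, (l <= L)%N -> integral_multiple l k.
Proof.
move=> hL.
suff [k k0 hk] : exists2 k, (0 < k)%N & forall l, (L - L <= l <= L)%N -> integral_multiple l k.
  by exists k => // l lL; apply: hk; rewrite subnn.
elim: {1 4}L (leqnn L) => [|i IH] iL.
  exists 1%N => // l; rewrite subn0 -eqn_leq => /eqP <-.
  by split; [rewrite scale1r twistedL|rewrite ltnn].
have [k k0 hk] := IH (ltnW iL).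
have lL : (L - i.+1 < L)%N by rewrite -subSn // subSS leq_subr.
have lS : (L - i)%N = (L - i.+1).+1 by rewrite -subSn.
set l := (L - i.+1)%N in lL lS *.
have [nn nnN [r r0 hr]] := n0 lL.
have [nm nd] := ll_tr ll lL.
have [h1 _] : integral_multiple l.+1 k by apply: hk; rewrite lS leqnn.
have /intrP[z2 z2E] := mM (ltnW lL) nnN.
have /intrP[z1 z1E] := h1 _ nnN.
have [_ tn] := twisted_normal lL.
have z20 : z2 != 0.
  by rewrite -(intr_eq0 R) -z2E hr mulf_neq0.
(* The pairing of the exponent with the vector [nn] of [N°] is an integer before
   and after rescaling. *)
have kz : k%:R * scale l * z2%:~R = z1%:~R.
  by rewrite -z1E -z2E pairingZ !hr tn; ring.
have s0 : 0 < scale l by apply: scale_gt0; exact: ltnW.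
have kN : k%:R * `|z2|%N%:R * scale l = `|z1|%N%:R.
  have abs (z : int) : `|z|%N%:R = `|z%:~R| :> R by rewrite -intr_norm.
  rewrite !abs -kz normrM [X in _ = X * _]ger0_norm; first by ring.
  by rewrite mulr_ge0 // ltW.
have j0 : (0 < `|z2|)%N by rewrite absz_gt0.
have E : (k * `|z2|)%N%:R * scale l = `|z1|%N%:R by rewrite natrM.
exists (k * `|z2|)%N; first by rewrite muln_gt0 k0.
move=> l'; rewrite leq_eqVlt => /andP[/predU1P[<-|ll'] l'L]; last first.
  by apply: integral_multipleM => //; apply: hk; rewrite lS ll'.
split=> [|_]; last first.
  by exists `|z1|%N => //; rewrite -(ltr0n R) -E mulr_gt0 // ltr0n muln_gt0 k0.
have := integral_multipleM j0 (hk l.+1 _); rewrite lS leqnn => /(_ lL)[h _].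
rewrite -[twisted l](subKr (twisted l.+1)) twistedS // scalerBr scalerA E.
apply: Mo_add => //; apply: Mo_opp; rewrite scaler_nat; apply: Mo_Mn.
by have [] := dP lL.
Qed.

End Half.

(** * Joining two rescaled lines *)

Section Joined.
Variables (R : realType) (I : finType) (F : fixed_data I) (e : seed F).
Hypothesis p1_inj : p1_injective R F.
Variable sigma : set (dual_space R I).
Hypothesis sigma_cone : rational_polyhedral_cone sigma.
Hypothesis sigma_strict : strictly_convex sigma.
Hypothesis sigma_p1 : forall i, i \in uf F -> sigma (p1 R F (e i)).
Variables (W : choiceType) (D : W -> wall R I).
Hypothesis hwall : forall w, is_wall e (D w).
Hypothesis hfin : forall k, finite_set (nontrivial_mod F sigma D k).
Hypothesis hfun : forall w, exists2 c : nat, (0 < c)%N &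
        wfun (D w) = spow F sigma (binomial_fun F (wnormal (D w))) c.
Local Notation N := (lattice I).
Local Notation M := (dual_space R I).
Local Notation P := (Pmon F sigma).

Variables (p : nat) (m1 : nat -> M) (nv1 : nat -> N) (t1 : nat -> R) (B1 : nat -> M)
    (s1 : nat -> R) (B1' : nat -> M) (S1 : nat -> seq W).
Variables (q : nat) (m2 : nat -> M) (nv2 : nat -> N) (t2 : nat -> R) (B2 : nat -> M)
    (s2 : nat -> R) (B2' : nat -> M) (S2 : nat -> seq W).
Variables x0 y : M.
Hypothesis ll1 : limit_line F sigma D p m1 nv1 t1 B1 s1 B1' S1 x0 y.
Hypothesis ll2 : limit_line F sigma D q m2 nv2 t2 B2 s2 B2' S2 x0 y.
Hypothesis hsum : m1 p + m2 q = x0.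

Variables a b k : R.
Hypotheses (a0 : 0 < a) (b0 : 0 < b) (k0 : 0 < k).
Local Notation sc1 := (scale t1 a (a + b)).
Local Notation sc2 := (scale t2 b (a + b)).
Local Notation tw1 := (twisted m1 B1 a (a + b)).
Local Notation tw2 := (twisted m2 B2 b (a + b)).
Local Notation d1 l := (m1 l.+1 - m1 l).
Local Notation d2 l := (m2 l.+1 - m2 l).
Local Notation x1 l := (B1 l - t1 l *: m1 l).
Local Notation x1' l := (B1' l - s1 l *: m1 l).
Local Notation x2 l := (B2 l - t2 l *: m2 l).
Local Notation x2' l := (B2' l - s2 l *: m2 l).

(** The bends of the joined line are those of the first line, then those of the
    second line in reverse order. *)
Definition join {T : Type} (f1 f2 : nat -> T) (l : nat) : T :=
  if (l < p)%N then f1 l else f2 (p + q - l.+1)%N.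

Definition join_exponent l : M :=
  if (l <= p)%N then k *: tw1 l else - (k *: tw2 (p + q - l)).

(** The domains extrapolated to time [0], at which the joined line ends in
    [b^-1 *: m2 0]. *)
Definition join_line l : M :=
  if (l <= p)%N then b^-1 *: (B1 l - m1 l) else b^-1 *: m2 (p + q - l).

Definition join_line' l : M :=
  if (l <= p)%N then B1' l - B1 l else B2' (p + q - l) - B2 (p + q - l).

(** The joined line starts at time [- (k * a * b)^-1] and reaches the [l]-th bend
    of the first half [(a * sc1 l * k)^-1] later; the [j]-th bend of the second
    half is [(b * sc2 j * k)^-1] before its end. *)
Definition join_time l : R :=
  if (l < p + q)%N then
    join (fun l => ((a * sc1 l)^-1 - (a * b)^-1) / k)
         (fun j => - (b * sc2 j * k)^-1) l
  else 0.

Definition join_time' l : R :=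
  if (l < p + q)%N then
    join (fun l => (s1 l - t1 l) / (sc1 l * k)) (fun j => - ((s2 j - t2 j) / (sc2 j * k))) l
  else 0.

Lemma join_cases l : (l < p + q)%N -> (l < p)%N \/
  exists2 j, (j < q)%N & l = (p + (q - j.+1))%N.
Proof.
move=> lL; have [lp|pl] := ltnP l p; [by left|right].
by exists (p + q - l.+1)%N; lia.
Qed.

Lemma join_left T (f1 f2 : nat -> T) l : (l < p)%N -> join f1 f2 l = f1 l.
Proof. by rewrite /join => ->. Qed.

Lemma join_right T (f1 f2 : nat -> T) j : (j < q)%N ->
  join f1 f2 (p + (q - j.+1)) = f2 j.
Proof.
move=> jq; rewrite /join ltnNge leq_addr /=; congr f2; lia.
Qed.

(** The balancing condition: the two rescaled lines fit together. *)
Let tw12 : tw1 p = - tw2 q.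
Proof.
rewrite (twistedL ll1) (twistedL ll2) -hsum.
by apply/rowP => i; rewrite !mxE; ring.
Qed.

Let B1p : B1 p = x0. Proof. by case: (ll_config ll1). Qed.
Let B2q : B2 q = x0. Proof. by case: (ll_config ll2). Qed.
Let B1'p : B1' p = y. Proof. by case: (ll_config' ll1). Qed.
Let B2'q : B2' q = y. Proof. by case: (ll_config' ll2). Qed.

Lemma join_domain_right j : (j <= q)%N ->
  [/\ join_exponent (p + (q - j)) = - (k *: tw2 j),
      join_line (p + (q - j)) = b^-1 *: m2 j &
      join_line' (p + (q - j)) = B2' j - B2 j].
Proof.
rewrite /join_exponent /join_line /join_line' leq_eqVlt => /predU1P[->|jq].
  rewrite subnn addn0 leqnn tw12 scalerN B1p B2q B1'p B2'q -hsum.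
  by split=> //; rewrite addrC addKr.
have -> : (p + (q - j) <= p)%N = false by lia.
by have -> : (p + q - (p + (q - j)))%N = j by lia.
Qed.

Lemma join_domain_left l : (l <= p)%N ->
  [/\ join_exponent l = k *: tw1 l, join_line l = b^-1 *: (B1 l - m1 l) &
      join_line' l = B1' l - B1 l].
Proof. by rewrite /join_exponent /join_line /join_line' => ->. Qed.

Let jS j : (j < q)%N -> (p + (q - j.+1)).+1 = (p + (q - j))%N.
Proof. by lia. Qed.

Let ab0 : 0 < a + b. Proof. exact: addr_gt0. Qed.

Lemma join_jump_left l : (l < p)%N ->
  join_exponent l.+1 - join_exponent l = (k * sc1 l) *: d1 l.
Proof.
move=> lp; have [-> _ _] := join_domain_left (ltnW lp).
have [-> _ _] := join_domain_left lp.
by rewrite -scalerBr (twistedS ll1) // scalerA.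
Qed.

Lemma join_jump_right j : (j < q)%N ->
  join_exponent (p + (q - j.+1)).+1 - join_exponent (p + (q - j.+1)) =
  (k * sc2 j) *: d2 j.
Proof.
move=> jq; rewrite jS //; have [-> _ _] := join_domain_right jq.
have [-> _ _] := join_domain_right (ltnW jq).
by rewrite opprK addrC -scalerBr (twistedS ll2) // scalerA.
Qed.

Lemma join_time_left l : (l < p)%N ->
  join_time l = ((a * sc1 l)^-1 - (a * b)^-1) / k /\
  join_time' l = (s1 l - t1 l) / (sc1 l * k).
Proof.
move=> lp; have lL : (l < p + q)%N by lia.
by rewrite /join_time /join_time' lL !join_left.
Qed.

Lemma join_time_right j : (j < q)%N ->
  join_time (p + (q - j.+1)) = - (b * sc2 j * k)^-1 /\
  join_time' (p + (q - j.+1)) = - ((s2 j - t2 j) / (sc2 j * k)).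
Proof.
move=> jq; have lL : (p + (q - j.+1) < p + q)%N by lia.
by rewrite /join_time /join_time' lL !join_right.
Qed.

Let ne0 : [/\ a != 0, b != 0 & k != 0].
Proof. by rewrite !gt_eqF. Qed.

Let sc1n l : (l < p)%N -> a + b - a * t1 l != 0.
Proof. by move=> lp; rewrite gt_eqF // (scale_gt0 ll1 a0 ab0) // ltnW. Qed.

Let sc2n l : (l < q)%N -> a + b - b * t2 l != 0.
Proof. by move=> lp; rewrite gt_eqF // (scale_gt0 ll2 b0 ab0) // ltnW. Qed.

(** The deformation of the ends of the two lines from [x0] towards [y] deforms
    the joined line to first order in this way; its bends become combinations
    of the bends of the limit lines and of the lines ending in [y]. *)
Lemma join_step_left l : (l < p)%N ->
  [/\ join_line l.+1 - join_line l =
        join_time l *: (join_exponent l.+1 - join_exponent l),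
      join_line' l.+1 - join_line' l =
        join_time' l *: (join_exponent l.+1 - join_exponent l),
      join_line l - join_time l *: join_exponent l = (sc1 l)^-1 *: x1 l &
      join_line' l - join_time' l *: join_exponent l =
        (a * (s1 l - t1 l) / sc1 l) *: x1 l + (x1' l - x1 l)].
Proof.
move=> lp; rewrite join_jump_left //.
have [-> ->] := join_time_left lp.
have [-> -> ->] := join_domain_left (ltnW lp).
have [_ -> ->] := join_domain_left lp.
have [_ _ h] := ll_config ll1; have [E _] := h l lp.
have [_ _ h'] := ll_config' ll1; have [E' _] := h' l lp.
have [an bn kn] := ne0; have sn := sc1n lp.
rewrite -[B1 l.+1](subrK (B1 l)) -[B1' l.+1](subrK (B1' l)) E E' /twisted /scale.
by split; apply/rowP => i; rewrite !mxE; field; rewrite ?an ?bn ?kn ?sn.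
Qed.

Lemma join_step_right j : (j < q)%N -> let l := (p + (q - j.+1))%N in
  [/\ join_line l.+1 - join_line l =
        join_time l *: (join_exponent l.+1 - join_exponent l),
      join_line' l.+1 - join_line' l =
        join_time' l *: (join_exponent l.+1 - join_exponent l),
      join_line l - join_time l *: join_exponent l = (sc2 j)^-1 *: x2 j &
      join_line' l - join_time' l *: join_exponent l =
        (b * (s2 j - t2 j) / sc2 j) *: x2 j + (x2' j - x2 j)].
Proof.
move=> jq l; rewrite join_jump_right //.
have [-> ->] := join_time_right jq.
have [-> -> ->] := join_domain_right jq.
rewrite jS //; have [_ -> ->] := join_domain_right (ltnW jq).
have [_ _ h] := ll_config ll2; have [E _] := h j jq.
have [_ _ h'] := ll_config' ll2; have [E' _] := h' j jq.
have [an bn kn] := ne0; have sn := sc2n jq.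
have tE : tw2 j.+1 = tw2 j + sc2 j *: d2 j by rewrite -(twistedS ll2) // [RHS]addrC subrK.
rewrite tE -[B2 j.+1](subrK (B2 j)) -[B2' j.+1](subrK (B2' j)) E E' /twisted /scale.
by split; apply/rowP => i; rewrite !mxE; field; rewrite ?an ?bn ?kn ?sn.
Qed.

Local Notation nh := (join nv1 nv2).

Let normal1 l : (l < p)%N ->
  pairing (nv1 l) (x1 l) = 0 /\ pairing (nv1 l) (x1' l) = 0.
Proof.
move=> lp; have [_ _ h] := ll_config ll1; have [_ E] := h l lp.
by have [_ _ h'] := ll_config' ll1; have [_ E'] := h' l lp.
Qed.

Let normal2 l : (l < q)%N ->
  pairing (nv2 l) (x2 l) = 0 /\ pairing (nv2 l) (x2' l) = 0.
Proof.
move=> lp; have [_ _ h] := ll_config ll2; have [_ E] := h l lp.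
by have [_ _ h'] := ll_config' ll2; have [_ E'] := h' l lp.
Qed.

Lemma join_lineL : join_line (p + q) = b^-1 *: m2 0%N /\
  join_line' (p + q) = B2' 0%N - B2 0%N.
Proof. by have [_ + +] := join_domain_right (leq0n q); rewrite subn0. Qed.

Lemma join_config :
  config (p + q) nh join_exponent join_time join_line (b^-1 *: m2 0%N) /\
  config (p + q) nh join_exponent join_time' join_line' (B2' 0%N - B2 0%N).
Proof.
have [e1 e2] := join_lineL.
split; split=> //; try by rewrite /join_time /join_time' ltnn.
  move=> l /join_cases[lp|[j jq ->]].
    have [-> _ -> _] := join_step_left lp; split=> //.
    by rewrite join_left // pairingZ (normal1 lp).1 mulr0.
  have [-> _ -> _] := join_step_right jq; split=> //.
  by rewrite join_right // pairingZ (normal2 jq).1 mulr0.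
move=> l /join_cases[lp|[j jq ->]].
  have [_ -> _ ->] := join_step_left lp; split=> //; have [n1 n2] := normal1 lp.
  by rewrite join_left // pairingD pairingZ [X in _ + X]pairingB n1 n2 mulr0 subrr addr0.
have [_ -> _ ->] := join_step_right jq; split=> //; have [n1 n2] := normal2 jq.
by rewrite join_right // pairingD pairingZ [X in _ + X]pairingB n1 n2 mulr0 subrr addr0.
Qed.

Let sc1_gt0 l : (l <= p)%N -> 0 < sc1 l.
Proof. by move=> lp; exact: (scale_gt0 ll1). Qed.

Let sc2_gt0 l : (l <= q)%N -> 0 < sc2 l.
Proof. by move=> lp; exact: (scale_gt0 ll2). Qed.

Lemma join_transverse : transverse (p + q) nh join_exponent.
Proof.
move=> l /join_cases[lp|[j jq ->]].
  rewrite join_jump_left // join_left //; have [nm nd] := ll_tr ll1 lp.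
  have [-> _ _] := join_domain_left (ltnW lp).
  rewrite !pairingZ (twisted_normal ll1 _ _ lp).1 nd mulr0; split=> //.
  by rewrite !mulf_neq0 // gt_eqF // sc1_gt0 // ltnW.
rewrite join_jump_right // join_right //; have [nm nd] := ll_tr ll2 jq.
have [-> _ _] := join_domain_right jq.
rewrite pairingN !pairingZ (twisted_normal ll2 _ _ jq).2 nd mulr0; split=> //.
by rewrite oppr_eq0 !mulf_neq0 // gt_eqF // sc2_gt0 // ltnW.
Qed.

(** On each half this is the order of the rescaled bends; the halves are separated
    by the time at which [(a + b)^-1 *: x0] is reached. *)
Lemma join_order l : (l < p + q)%N ->
  lex_pos (join_time l.+1 - join_time l) (join_time' l.+1 - join_time' l).
Proof.
have [an bn kn] := ne0; have cn : a + b != 0 by rewrite gt_eqF.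
have ak : 0 < (a * k)^-1 by rewrite invr_gt0 mulr_gt0.
have bk : 0 < (b * k)^-1 by rewrite invr_gt0 mulr_gt0.
have [sL1 sL2] : sc1 p = a + b /\ sc2 q = a + b.
  by rewrite (scaleL ll1) (scaleL ll2).
have [tp1 tp2] : t1 p = 0 /\ t2 q = 0.
  by rewrite (time_L (ll_config ll1)) (time_L (ll_config ll2)).
have [sp1 sp2] : s1 p = 0 /\ s2 q = 0.
  by rewrite (time_L (ll_config' ll1)) (time_L (ll_config' ll2)).
move=> /join_cases[lp|[j jq ->]].
  have lex := lex_posM ak (scale_lex ll1 a0 ab0 lp).
  have [-> ->] := join_time_left lp.
  have n0 : sc1 l != 0 by rewrite gt_eqF // sc1_gt0 // ltnW.
  have [lp'|pl] := ltnP l.+1 p.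
    have [-> ->] := join_time_left lp'.
    have n1 : sc1 l.+1 != 0 by rewrite gt_eqF // sc1_gt0.
    move: lex; move: (sc1 l) (sc1 l.+1) n0 n1 => u v n0 n1.
    by congr lex_pos; field; rewrite ?an ?bn ?kn ?n0 ?n1.
  have lE : l.+1 = p by apply/eqP; rewrite eqn_leq lp pl.
  move: lex; rewrite lE sL1 tp1 sp1 => lex.
  have [q0|q0] := posnP q.
    have -> : join_time p = 0 by rewrite /join_time q0 addn0 ltnn.
    have -> : join_time' p = 0 by rewrite /join_time' q0 addn0 ltnn.
    have pos : lex_pos (b * (a + b) * k)^-1 0.
      by left; rewrite invr_gt0 !mulr_gt0.
    move: (lex_posD lex pos); move: (sc1 l) n0 => u n0.
    by congr lex_pos; field; rewrite ?an ?bn ?kn ?n0 ?cn.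
  have qq : (q.-1 < q)%N by rewrite prednK.
  have := join_time_right qq; rewrite prednK // subnn addn0 => -[-> ->].
  have := lex_posM bk (scale_lex ll2 b0 ab0 qq); rewrite prednK // sL2 tp2 sp2 => lex2.
  have n2 : sc2 q.-1 != 0 by rewrite gt_eqF // sc2_gt0 // ltnW.
  move: (lex_posD lex lex2); move: (sc1 l) (sc2 q.-1) n0 n2 => u v n0 n2.
  by congr lex_pos; field; rewrite ?an ?bn ?kn ?n0 ?n2 ?cn.
have [-> ->] := join_time_right jq; rewrite jS //.
have n0 : sc2 j != 0 by rewrite gt_eqF // sc2_gt0 // ltnW.
case: j jq n0 => [|j] jq n0.
  rewrite subn0 /join_time /join_time' ltnn !sub0r !opprK; left.
  by rewrite invr_gt0 !mulr_gt0 // sc2_gt0.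
have [-> ->] := join_time_right (ltnW jq).
have n1 : sc2 j != 0 by rewrite gt_eqF // sc2_gt0 // ltnW // ltnW.
have := lex_posM bk (scale_lex ll2 b0 ab0 (ltnW jq)).
move: (sc2 j) (sc2 j.+1) n0 n1 => u v n0 n1.
by congr lex_pos; field; rewrite ?an ?bn ?kn ?n0 ?n1.
Qed.

Lemma bent_path_ext L (m : nat -> M) t t' z s :
  (forall l, (l < L)%N -> t l = t' l) -> bent_path L m t z s = bent_path L m t' z s.
Proof.
move=> h; rewrite /bent_path; congr (_ + _); apply: eq_bigr => l _.
by rewrite h.
Qed.

Hypothesis mM1 : Mo F (m1 0%N).
Hypothesis mM2 : Mo F (m2 0%N).
Hypothesis mS1 : forall l, (l < p)%N -> m1 l != m1 l.+1.
Hypothesis mS2 : forall l, (l < q)%N -> m2 l != m2 l.+1.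
Hypothesis k1 : forall l, (l < p)%N -> exists2 j, (0 < j)%N & k * sc1 l = j%:R.
Hypothesis k2 : forall l, (l < q)%N -> exists2 j, (0 < j)%N & k * sc2 l = j%:R.

Lemma join_broken_line : Mo F (join_exponent 0) -> join_exponent 0 != 0 ->
  exists b' : broken_line R I, is_broken_line F sigma D b' /\
    forall s, s <= 0 -> b' s = bent_path (p + q) join_exponent join_time (b^-1 *: m2 0%N) s.
Proof.
move=> hM hn0.
have [M1 _ P1 N1] := bends_data p1_inj sigma_cone sigma_strict sigma_p1 hwall hfin hfun
  mM1 (ll_bends ll1) mS1.
have [M2 _ P2 N2] := bends_data p1_inj sigma_cone sigma_strict sigma_p1 hwall hfin hfun
  mM2 (ll_bends ll2) mS2.
have [hc hc'] := join_config.
have tr := join_transverse.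
have uE l : (l <= p + q)%N ->
    lform (time_col (p + q) nh join_exponent l) (b^-1 *: m2 0%N) = join_time l.
  by move=> lL; have [_ ->] := config_unique tr hc lL.
have uE' l : (l <= p + q)%N ->
    lform (time_col (p + q) nh join_exponent l) (B2' 0%N - B2 0%N) = join_time' l.
  by move=> lL; have [_ ->] := config_unique tr hc' lL.
have jump l : (l < p + q)%N -> exists (u : M) (i : nat),
   [/\ join_exponent l.+1 - join_exponent l = u *+ i, P (u *+ i) & u *+ i != 0].
  move=> /join_cases[lp|[j jq ->]].
    have [i i0 iE] := k1 lp; exists (d1 l), i.
    rewrite join_jump_left // iE scaler_nat; split=> //.
      by apply: Pmon_Mn => //; exact: P1.
    by rewrite -scaler_nat scaler_eq0 negb_or pnatr_eq0 -lt0n i0 subr_eq0 eq_sym mS1.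
  have [i i0 iE] := k2 jq; exists (d2 j), i.
  rewrite join_jump_right // iE scaler_nat; split=> //.
    by apply: Pmon_Mn => //; exact: P2.
  by rewrite -scaler_nat scaler_eq0 negb_or pnatr_eq0 -lt0n i0 subr_eq0 eq_sym mS2.
have [||||||b' [hb' bE]] := @broken_line_from_limit R I F e sigma sigma_cone sigma_strict
    W D hwall hfin (p + q) join_exponent nh (join S1 S2) (b^-1 *: m2 0%N) (B2' 0%N - B2 0%N)
    tr hM hn0.
- move=> l /jump[u [i [E _ u0]]]; apply: contra_neq u0 => E'.
  by rewrite -E E' subrr.
- by move=> l /jump[u [i [-> ]]].
- move=> l /join_cases[lp|[j jq ->]].
    by rewrite !join_left //; exact: (ll_normal ll1).
  by rewrite !join_right //; exact: (ll_normal ll2).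
- move=> l x /join_cases[lp|[j jq ->]] xS hS.
    have [i i0 iE] := k1 lp.
    rewrite join_jump_left // iE scaler_nat; rewrite join_left // in hS.
    apply: (bend_robust p1_inj sigma_cone sigma_strict sigma_p1 hwall hfin hfun ll1) => //.
    have [-> _ _] := join_domain_left (ltnW lp).
    rewrite pairingZ (twisted_normal ll1 _ _ lp).1 mulrA iE normrM.
    by rewrite [X in X * _]ger0_norm.
  have [i i0 iE] := k2 jq.
  rewrite join_jump_right // iE scaler_nat; rewrite join_right // in hS.
  apply: (bend_robust p1_inj sigma_cone sigma_strict sigma_p1 hwall hfin hfun ll2) => //.
  have [-> _ _] := join_domain_right jq.
  rewrite pairingN normrN pairingZ (twisted_normal ll2 _ _ jq).2 mulrA iE normrM.
  by rewrite [X in X * _]ger0_norm.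
- move=> l lL; rewrite !lformBc !uE ?uE' //; try exact: ltnW.
  exact: join_order.
- move=> l w lL wS.
  rewrite -(config_point tr hc (ltnW lL)) -(config_point tr hc' (ltnW lL)).
  move: lL wS => /join_cases[lp|[j jq ->]] wS.
    have [_ _ -> ->] := join_step_left lp; rewrite join_left // in wS; rewrite join_left //.
    exact: (cone_lex hwall ll1 a0 ab0).
  have [_ _ -> ->] := join_step_right jq; rewrite join_right // in wS; rewrite join_right //.
  exact: (cone_lex hwall ll2 b0 ab0).
exists b'; split=> // s s0; rewrite bE //.
by apply: bent_path_ext => l lL; rewrite uE // ltnW.
Qed.

Lemma join_time_bounds l : (l < p + q)%N ->
  [/\ - (k * a * b)^-1 <= join_time l, join_time l <= 0,
      (l < p)%N -> join_time l <= - (k * b * (a + b))^-1 &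
      (p <= l)%N -> - (k * b * (a + b))^-1 <= join_time l].
Proof.
have [an bn kn] := ne0; have cn : a + b != 0 by rewrite gt_eqF.
have kb : 0 < k * b by apply: mulr_gt0.
have mid0 : - (k * b * (a + b))^-1 <= 0 by rewrite oppr_le0 invr_ge0 ltW // mulr_gt0.
have start : - (k * a * b)^-1 <= - (k * b * (a + b))^-1.
  rewrite lerN2 lef_pV2 ?posrE ?mulr_gt0 // mulrAC ler_pM2l // lerDl; exact: ltW.
move=> /join_cases[lp|[j jq ->]].
  have [-> _] := join_time_left lp; have s0 := sc1_gt0 (ltnW lp).
  have h : ((a * sc1 l)^-1 - (a * b)^-1) / k <= - (k * b * (a + b))^-1.
    have -> : - (k * b * (a + b))^-1 = ((a * (a + b))^-1 - (a * b)^-1) / k.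
      by field; rewrite ?an ?bn ?kn ?cn.
    rewrite ler_pM2r ?invr_gt0 // lerD2r lef_pV2 ?posrE ?mulr_gt0 // ler_pM2l //.
    by apply: (scale_ge ll1 _ a0); exact: ltnW.
  split=> // [||pl]; last by rewrite ltnNge pl in lp.
  + have -> : - (k * a * b)^-1 = (0 - (a * b)^-1) / k.
      by field; rewrite ?an ?bn ?kn.
    by rewrite ler_pM2r ?invr_gt0 // lerD2r invr_ge0 ltW // mulr_gt0.
  + exact: le_trans h mid0.
have [-> _] := join_time_right jq; have s0 := sc2_gt0 (ltnW jq).
have h : - (k * b * (a + b))^-1 <= - (b * sc2 j * k)^-1.
  rewrite lerN2 lef_pV2 ?posrE ?mulr_gt0 // [k * b]mulrC -!mulrA ler_pM2l //.
  rewrite [sc2 j * k]mulrC ler_pM2l //; by apply: (scale_ge ll2 _ b0); exact: ltnW.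
split=> //.
- exact: le_trans start h.
- by rewrite oppr_le0 invr_ge0 ltW // !mulr_gt0.
- by rewrite ltnNge leq_addr.
Qed.

Lemma join_values :
  let g := bent_path (p + q) join_exponent join_time (b^-1 *: m2 0%N) in
  [/\ g (- (k * a * b)^-1) = a^-1 *: m1 0%N,
      g (- (k * b * (a + b))^-1) = (a + b)^-1 *: x0 &
      g 0 = b^-1 *: m2 0%N].
Proof.
move=> g; have [hc _] := join_config.
have [an bn kn] := ne0; have cn : a + b != 0 by rewrite gt_eqF.
split.
- rewrite /g (bent_pathE hc (leq0n _)) => [|//|l /andP[_ lL]]; last first.
    by have [] := join_time_bounds lL.
  have [-> -> _] := join_domain_left (leq0n p); rewrite /twisted.
  by apply/rowP => i; rewrite !mxE; field; rewrite ?an ?bn ?kn.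
- rewrite /g (bent_pathE hc (leq_addr q p)) => [|l lp|l /andP[pl lL]].
  + have [-> -> _] := join_domain_left (leqnn p); rewrite (twistedL ll1) B1p -hsum.
    by apply/rowP => i; rewrite !mxE; field; rewrite ?an ?bn ?kn ?cn.
  + have lL : (l < p + q)%N by lia.
    by have [_ _ h _] := join_time_bounds lL; exact: h.
  + by have [_ _ _ h] := join_time_bounds lL; exact: h.
- rewrite /g (bent_pathE hc (leqnn _)) => [|l lL|l /andP[/leq_ltn_trans h /h]].
  + by rewrite scale0r subr0; have [-> _] := join_lineL.
  + by have [] := join_time_bounds lL.
  + by rewrite ltnn.
Qed.

(** Next to a bend, the exponent of a line is not along the wall, so it is nonzero. *)
Lemma join_exponent_eq0 : join_exponent 0 = 0 ->
  [/\ p = 0%N, q = 0%N & b *: m1 0%N = a *: m2 0%N].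
Proof.
have [an bn kn] := ne0.
have [-> _ _] := join_domain_left (leq0n p) => /eqP.
rewrite scaler_eq0 (negPf kn) /= => /eqP tw0.
have p0 : p = 0%N.
  apply/eqP; rewrite -leqn0 leqNgt; apply/negP => pp.
  have [nm _] := ll_tr ll1 pp; have [+ _] := twisted_normal ll1 a (a + b) pp.
  rewrite tw0 pairing0 => /esym/eqP; rewrite mulf_eq0 (negPf nm) orbF gt_eqF //.
  exact: sc1_gt0.
have tw1p : tw1 p = 0 by rewrite p0.
have q0 : q = 0%N.
  apply/eqP; rewrite -leqn0 leqNgt; apply/negP => qq.
  have qq' : (q.-1 < q)%N by rewrite prednK.
  have [nm _] := ll_tr ll2 qq'; have [_ +] := twisted_normal ll2 b (a + b) qq'.
  rewrite prednK // -[tw2 q]opprK -tw12 tw1p oppr0 pairing0 => /esym/eqP.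
  rewrite mulf_eq0 (negPf nm) orbF gt_eqF //.
  by apply: sc2_gt0; exact: ltnW.
split=> //; move: tw1p; rewrite (twistedL ll1) -hsum p0 q0 => /eqP.
by rewrite subr_eq0 scalerDl scalerDr => /eqP /addrI.
Qed.

End Joined.

(** * The segment of a balanced pair *)

Section Main.
Variables (R : realType) (I : finType) (F : fixed_data I) (e : seed F).
Hypothesis p1_inj : p1_injective R F.
Variable sigma : set (dual_space R I).
Hypothesis sigma_cone : rational_polyhedral_cone sigma.
Hypothesis sigma_strict : strictly_convex sigma.
Hypothesis sigma_p1 : forall i, i \in uf F -> sigma (p1 R F (e i)).
Variables (W : choiceType) (D : W -> wall R I).
Hypothesis hwall : forall w, is_wall e (D w).
Hypothesis hfin : forall k, finite_set (nontrivial_mod F sigma D k).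
Hypothesis hfun : forall w, exists2 c : nat, (0 < c)%N &
        wfun (D w) = spow F sigma (binomial_fun F (wnormal (D w))) c.
Local Notation M := (dual_space R I).

(** For the case where the segment is a point. *)
Lemma straight_broken_line (m0 z : M) : Mo F m0 -> m0 != 0 ->
  exists2 b : broken_line R I, is_broken_line F sigma D b & b 0 = z.
Proof.
move=> hM hn.
have [|||||||||b [hb bE]] := @broken_line_from_limit R I F e sigma sigma_cone sigma_strict
    W D hwall hfin 0 (fun=> m0) (fun=> 0) (fun=> [::]) z 0 => //.
by exists b => //; rewrite bE // /bent_path big_ord0 scale0r subr0 addr0.
Qed.

Lemma cvg_subsequence (u : nat -> M) (z : M) (f : nat -> nat) :
  (forall n, (n <= f n)%N) -> u @ \oo --> z -> (u \o f) @ \oo --> z.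
Proof.
move=> fn uz; apply: cvg_comp uz => A [n _ hA].
by exists n => // i /= ni; apply: hA; exact: leq_trans ni (fn i).
Qed.

Lemma balanced_segment (b1 b2 : broken_line R I) (x0 : M) (a b : nat) :
  is_broken_line F sigma D b1 -> is_broken_line F sigma D b2 ->
  Mo F x0 -> balanced b1 b2 x0 -> (0 < a)%N -> (0 < b)%N ->
  exists (T : R) (seg : R -> dual_space R I),
    [/\ is_broken_line_segment F sigma D T seg,
        seg 0 = a%:R^-1 *: Iexp b1,
        seg T = b%:R^-1 *: Iexp b2
      & seg (b%:R / (a + b)%:R * T) = (a + b)%:R^-1 *: x0].
Proof.
move=> hb1 hb2 hx0 [based e1 e2 hF] an bn.
have [p [m1 [nv1 [t1 [B1 [[I1 F1 mM1 m10] mS1 lines1 com1 lim1]]]]]] :=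
  broken_line_data hwall hb1.
have [q [m2 [nv2 [t2 [B2 [[I2 F2 mM2 m20] mS2 lines2 com2 lim2]]]]]] :=
  broken_line_data hwall hb2.
rewrite e1 in lim1; rewrite e2 in lim2.
have [_ _ bends1] := lines1 0%N; have [_ _ bends2] := lines2 0%N.
have [M1 tr1 P1 N1] := bends_data p1_inj sigma_cone sigma_strict
  sigma_p1 hwall hfin hfun mM1 bends1 mS1.
have [M2 tr2 P2 N2] := bends_data p1_inj sigma_cone sigma_strict
  sigma_p1 hwall hfin hfun mM2 bends2 mS2.
have [K1 nJ1] := exists_precision e sigma_cone sigma_strict P1.
have [K2 nJ2] := exists_precision e sigma_cone sigma_strict P2.
(* Both lines are restricted to a subsequence along which the walls at the bends
   that matter do not change. *)
have [v hv] := infinitely_often (fun k =>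
  (wall_code F sigma D p m1 t1 B1 K1 k, wall_code F sigma D q m2 t2 B2 K2 k)).
have /choice[f hf] : forall n, exists k, (n <= k)%N /\
   (wall_code F sigma D p m1 t1 B1 K1 k, wall_code F sigma D q m2 t2 B2 K2 k) = v.
  by move=> n; have [k nk kv] := hv n; exists k.
have fn n : (n <= f n)%N by have [] := hf n.
have fE n : wall_code F sigma D p m1 t1 B1 K1 (f n) = wall_code F sigma D p m1 t1 B1 K1 (f 0%N)
   /\ wall_code F sigma D q m2 t2 B2 K2 (f n) = wall_code F sigma D q m2 t2 B2 K2 (f 0%N).
  by have [_ E] := hf n; have [_ E0] := hf 0%N; move: E; rewrite -E0 => -[].
have com1' l : (l < p)%N -> exists2 w, wnormal (D w) = nv1 l &
    forall n, wcone (D w) (B1 (f n) l - t1 (f n) l *: m1 l).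
  by move=> /com1[w wn hw]; exists w.
have com2' l : (l < q)%N -> exists2 w, wnormal (D w) = nv2 l &
    forall n, wcone (D w) (B2 (f n) l - t2 (f n) l *: m2 l).
  by move=> /com2[w wn hw]; exists w.
have [t1' [B1' [S1 ll1]]] := @limit_of_lines R I F e sigma W D hwall hfin p m1 nv1
  (t1 \o f) (B1 \o f) (fun n => bapprox b1 (f n) 0) x0 K1 tr1 (fun n => lines1 (f n))
  com1' nJ1 (cvg_subsequence fn lim1) 0%N (fun n => (fE n).1).
have [t2' [B2' [S2 ll2]]] := @limit_of_lines R I F e sigma W D hwall hfin q m2 nv2
  (t2 \o f) (B2 \o f) (fun n => bapprox b2 (f n) 0) x0 K2 tr2 (fun n => lines2 (f n))
  com2' nJ2 (cvg_subsequence fn lim2) 0%N (fun n => (fE n).2).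
rewrite /= -(based (f 0%N)) in ll2.
rewrite F1 F2 in hF; rewrite I1 I2.
have a0 : (0 : R) < a%:R by rewrite ltr0n.
have b0 : (0 : R) < b%:R by rewrite ltr0n.
have ab0 : (0 : R) < a%:R + b%:R by apply: addr_gt0.
have [k1 k10 hk1] : exists2 k, (0 < k)%N & forall l, (l <= p)%N ->
    integral_multiple F p m1 t1' B1' a%:R (a%:R + b%:R) l k.
  apply: (twisted_rational ll1) => //; rewrite -natrD !scaler_nat.
  by apply: Mo_add; [|apply: Mo_opp]; apply: Mo_Mn => //; exact: M1.
have [k2 k20 hk2] : exists2 k, (0 < k)%N & forall l, (l <= q)%N ->
    integral_multiple F q m2 t2' B2' b%:R (a%:R + b%:R) l k.
  apply: (twisted_rational ll2) => //; rewrite -natrD !scaler_nat.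
  by apply: Mo_add; [|apply: Mo_opp]; apply: Mo_Mn => //; exact: M2.
(* A common multiple makes the exponents of both halves integral. *)
pose k := (k1 * k2)%N.
have k0 : (0 : R) < k%:R by rewrite ltr0n muln_gt0 k10.
have hk1' l : (l <= p)%N -> integral_multiple F p m1 t1' B1' a%:R (a%:R + b%:R) l k.
  by move=> lp; apply: integral_multipleM => //; exact: hk1.
have hk2' l : (l <= q)%N -> integral_multiple F q m2 t2' B2' b%:R (a%:R + b%:R) l k.
  by move=> lp; rewrite /k mulnC; apply: integral_multipleM => //; exact: hk2.
rewrite natrD.
have [z|nz] := eqVneq (join_exponent p m1 B1' q m2 B2' a%:R b%:R k%:R 0) 0.
  (* The segment is a point, on a broken line of some other exponent. *)
  have [p0 q0 mE] := join_exponent_eq0 ll1 ll2 hF a0 b0 k0 z.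
  have [b' hb' b'0] := straight_broken_line (a%:R^-1 *: m1 0%N) mM1 m10.
  exists 0, (fun s => b' (0 + s)); split.
  - exists b', 0, 0; split=> //; first by rewrite lexx.
    by rewrite subr0.
  - by rewrite addr0.
  - rewrite addr0 b'0; have := congr1 (fun w => (a%:R * b%:R)^-1 *: w) mE.
    by rewrite !scalerA invfM mulfVK ?gt_eqF // mulrAC mulVf ?gt_eqF // mul1r.
  - rewrite mulr0 addr0 b'0; apply: (scalerI (lt0r_neq0 ab0)).
    rewrite scalerA scalerA mulfV ?gt_eqF // scale1r -hF p0 q0 mulrDl mulfV ?gt_eqF //.
    rewrite scalerDl scale1r; congr (_ + _).
    by rewrite mulrC -scalerA mE scalerA mulVf ?scale1r // gt_eqF.
have hM0 : Mo F (join_exponent p m1 B1' q m2 B2' a%:R b%:R k%:R 0).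
  have [-> _ _] := join_domain_left m1 B1' (B1 (f 0%N)) q m2 B2' (B2 (f 0%N))
    a%:R b%:R k%:R (leq0n p).
  by have [] := hk1' 0%N (leq0n p).
have [|//|b' [hb' bE]] := join_broken_line p1_inj sigma_cone sigma_strict sigma_p1 hwall hfin
  hfun ll1 ll2 hF a0 b0 k0 mM1 mM2 mS1 mS2 _ _ hM0 nz.
- by move=> l lp; have [_ h] := hk1' l (ltnW lp); exact: h.
- by move=> l lp; have [_ h] := hk2' l (ltnW lp); exact: h.
have [v1 v2 v3] := join_values ll1 ll2 hF a0 b0 k0.
pose T : R := (k%:R * a%:R * b%:R)^-1.
have T0 : 0 <= T by rewrite invr_ge0 ltW // !mulr_gt0.
exists T, (fun s => b' (- T + s)); split.
- exists b', (- T), 0; split=> //; first by rewrite lexx oppr_le0 T0.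
  by rewrite sub0r opprK.
- by rewrite addr0 bE ?oppr_le0.
- by rewrite addNr bE.
- have E : - T + b%:R / (a%:R + b%:R) * T = - (k%:R * b%:R * (a%:R + b%:R))^-1.
    by rewrite /T; field; rewrite !gt_eqF.
  by rewrite E bE // oppr_le0 invr_ge0 ltW // !mulr_gt0.
Qed.

End Main.

Theorem theorem4p10 (R : realType) (I : finType) (F : fixed_data I) (e : seed F)
    (p1_inj : p1_injective R F)
    (sigma : set (dual_space R I))
    (sigma_cone : rational_polyhedral_cone sigma)
    (sigma_full : codim 0 sigma)
    (sigma_strict : strictly_convex sigma)
    (sigma_p1 : forall i, i \in uf F -> sigma (p1 R F (e i)))
    (W : choiceType) (D : W -> wall R I)
    (hD : cluster_scattering_diagram e sigma D)
    (b1 b2 : broken_line R I)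
    (hb1 : is_broken_line F sigma D b1) (hb2 : is_broken_line F sigma D b2)
    (x0 : dual_space R I) (hx0 : Mo F x0)
    (hbal : balanced b1 b2 x0)
    (a b : nat) (ha : (0 < a)%N) (hb : (0 < b)%N) :
  exists (T : R) (seg : R -> dual_space R I),
    [/\ is_broken_line_segment F sigma D T seg,
        seg 0 = a%:R^-1 *: Iexp b1,
        seg T = b%:R^-1 *: Iexp b2
      & seg (b%:R / (a + b)%:R * T) = (a + b)%:R^-1 *: x0].
Proof.
have [[hwall hfin] _ _ _ hfun] := hD.
exact: (balanced_segment p1_inj sigma_cone sigma_strict sigma_p1 hwall hfin hfun).
Qed.
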